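(* Let $\theta\in[0,1]$, let $p>1$ if $n\in\{1,2\}$ and $1<p<\frac{n+2}{n-2}$ if $n\ge 3$, and let $(u_0,u_1)\in H_0^1(\Omega)\times L^2(\Omega)$ satisfy $$E(0)<d\qquad\text{and}\qquad I(u_0)<0.$$ Let $u$ be an energy solution of the initial--boundary value problem (P) (described in the context) with initial data $(u_0,u_1)$ on $[0,T_{\max})$. Fix $\beta\in\bigl(0,\,2(d-E(0))\bigr]$ and set $$\sigma_\theta:=\max\Bigl\{0,\ \frac1\beta\Bigl[\frac{2}{p-1}\|A^{\theta/2}u_0\|^2-(u_0,u_1)\Bigr]\Bigr\}.$$ Then for every $\sigma>\sigma_\theta$ one has $$\tfrac{p-1}{2}\bigl[(u_0,u_1)+\beta\sigma\bigr]>\|A^{\theta/2}u_0\|^2,$$ the solution blows up in finite time (that is, $T_{\max}<\infty$), and $$T_{\max}\ \le\ \frac{\|u_0\|^2+\beta\sigma^2}{\frac{p-1}{2}\bigl[(u_0,u_1)+\beta\sigma\bigr]-\|A^{\theta/2}u_0\|^2}.$$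
   Context: Let $\Omega\subset\mathbb{R}^n$, $n\ge1$, be a bounded open set (no boundary regularity is assumed). All functions are real-valued. $(\cdot,\cdot)$ is the inner product of $L^2(\Omega)$, $\|\cdot\|_q$ the norm of $L^q(\Omega)$, $\|\cdot\|:=\|\cdot\|_2$, and $\langle\cdot,\cdot\rangle$ the duality pairing between $H^{-1}(\Omega)$ and $H_0^1(\Omega)$. $A:=-\Delta$ with Dirichlet boundary conditions, with eigenpairs $(\lambda_k,e_k)_{k\ge1}$, $0<\lambda_1\le\lambda_2\le\cdots$, $(e_k)$ an orthonormal basis of $L^2(\Omega)$. For $s\ge0$, $A^sv=\sum_k\lambda_k^s(v,e_k)e_k$ on $D(A^s)=\{v\in L^2(\Omega):\sum_k\lambda_k^{2s}(v,e_k)^2<\infty\}$; thus $D(A^{1/2})=H_0^1(\Omega)$, $\|A^{1/2}v\|=\|\nabla v\|$, $A^0=\mathrm{Id}$, and $H_0^1(\Omega)\subset D(A^{\theta/2})$ for $\theta\in[0,1]$. Problem (P): $u_{tt}+A^\theta u_t-\Delta u=|u|^{p-1}u$ in $\Omega\times(0,T)$, $u=0$ on $\partial\Omega\times(0,T)$, $u(\cdot,0)=u_0$, $u_t(\cdot,0)=u_1$ in $\Omega$. Functionals: $E(t):=\frac12\|u_t(t)\|^2+\frac12\|\nabla u(t)\|^2-\frac1{p+1}\|u(t)\|_{p+1}^{p+1}$; $I(v):=\|\nabla v\|^2-\|v\|_{p+1}^{p+1}$; $J(v):=\frac12\|\nabla v\|^2-\frac1{p+1}\|v\|_{p+1}^{p+1}$;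 $d:=\inf\{J(v): v\in H_0^1(\Omega)\setminus\{0\},\ I(v)=0\}$; $\Phi(t):=\|u_t(t)\|^2+\|\nabla u(t)\|^2$. Energy solution: for $T\in(0,\infty]$, $u$ is an energy solution of (P) on $[0,T)$ if (S1) $u\in C([0,T);H_0^1(\Omega))\cap C^1([0,T);L^2(\Omega))$ and $u_t\in L^2_{\mathrm{loc}}([0,T);D(A^{\theta/2}))$; (S2) $u(0)=u_0$, $u_t(0)=u_1$, $u_{tt}\in L^2_{\mathrm{loc}}([0,T);H^{-1}(\Omega))$ and $\langle u_{tt},v\rangle+(A^{\theta/2}u_t,A^{\theta/2}v)+(\nabla u,\nabla v)=\langle|u|^{p-1}u,v\rangle$ for a.e. $t\in(0,T)$ and all $v\in H_0^1(\Omega)$ (where $\langle|u|^{p-1}u,v\rangle=\int_\Omega|u|^{p-1}uv\,\mathrm{d}x$); (S3) $E(t)+\int_0^t\|A^{\theta/2}u_s(s)\|^2\,\mathrm{d}s\le E(0)$ for all $t\in[0,T)$; (S4) $T$ is maximal in the sense that either $T=\infty$, or $T<\infty$ and $\limsup_{t\to T^-}\Phi(t)=+\infty$. One then writes $T=T_{\max}$ and says that $u$ blows up at time $T_{\max}$ when $T_{\max}<\infty$. *)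

(* Defs.v *)
From HB Require Import structures.
From mathcomp Require Import all_boot all_order all_algebra.
From mathcomp Require Import all_classical all_reals all_analysis.

Set Implicit Arguments.
Unset Strict Implicit.
Unset Printing Implicit Defensive.

Import Order.TTheory GRing.Theory Num.Theory.
Import numFieldNormedType.Exports.
Local Open Scope classical_set_scope.
Local Open Scope ring_scope.

(* 'rV[R]_n carries the product (= Borel) sigma-algebra. *)
Section measurable_rV.
Context {R : realType} {n : nat}.

Let coors (i : 'I_n) (x : 'rV[R]_n) : measurableTypeR R := x ord0 i.

Let rV_set0 : g_sigma_preimage coors set0.
Proof. exact: sigma_algebra0. Qed.

Let rV_setC A : g_sigma_preimage coors A -> g_sigma_preimage coors (~` A).
Proof. exact: sigma_algebraC. Qed.

Let rV_bigcup (F : (set 'rV[R]_n)^nat) :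
  (forall i, g_sigma_preimage coors (F i)) ->
  g_sigma_preimage coors (\bigcup_i (F i)).
Proof. exact: sigma_algebra_bigcup. Qed.

HB.instance Definition _ := @isMeasurable.Build default_measure_display
  'rV[R]_n (g_sigma_preimage coors) rV_set0 rV_setC rV_bigcup.

End measurable_rV.

Lemma measurable_coord {R : realType} {n : nat} (i : 'I_n) :
  measurable_fun [set: 'rV[R]_n] (fun x => x ord0 i).
Proof.
move=> _ Y mY; rewrite setTI; apply: sub_sigma_algebra => /=.
rewrite -bigcup_seq/=; exists i => /=; first by rewrite mem_index_enum.
by exists Y => //; rewrite setTI.
Qed.

Lemma measurable_fun_rV d (T : measurableType d) (R : realType) n
    (f : T -> 'rV[R]_n) :
  (forall i, measurable_fun [set: T] (fun x => f x ord0 i)) ->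
  measurable_fun [set: T] f.
Proof.
move=> mf.
have H : g_sigma_preimage
    (fun i => (fun x : 'rV[R]_n => x ord0 i : measurableTypeR R) \o f)
    `<=` measurable.
  apply: smallest_sub; first exact: sigma_algebra_measurable.
  case: n f mf => [|n] f mf; first by rewrite big_ord0.
  rewrite -bigcup_mkord_ord; apply: bigcup_sub => i Ii.
  by move=> A [B mB <-]; exact: mf.
move: H; rewrite g_sigma_preimage_comp => H _ A mA.
by apply: H; exists A.
Qed.

Section lebesgue_rV.
Context {R : realType}.

Definition cons_rV n (x : R * 'rV[R]_n) : 'rV[R]_n.+1 := row_mx x.1%:M x.2.

Definition behead_rV n (x : 'rV[R]_n.+1) : 'rV[R]_n := rsubmx (x : 'rV_(1 + n)).

Lemma measurable_cons_rV n : measurable_fun [set: R * 'rV[R]_n] (@cons_rV n).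
Proof.
apply: measurable_fun_rV => i; rewrite /cons_rV.
case: (split_ordP (i : 'I_(1 + n))) => j ->.
  rewrite (_ : (fun _ => _) = fst) //; apply/funext => x.
  by apply: etrans (row_mxEl _ _ _ _) _; rewrite mxE (ord1 j) eqxx mulr1n.
rewrite (_ : (fun _ => _) = (fun v : 'rV[R]_n => v ord0 j) \o snd); last first.
  by apply/funext => x; exact: row_mxEr.
exact: (measurableT_comp (measurable_coord j)).
Qed.

Lemma measurable_behead_rV n :
  measurable_fun [set: 'rV[R]_n.+1] (@behead_rV n).
Proof.
apply: measurable_fun_rV => i; rewrite /behead_rV.
by under eq_fun do rewrite mxE; exact: measurable_coord.
Qed.

Section step.
Context {n : nat} (m : {sigma_finite_measure set 'rV[R]_n -> \bar R}).

Definition lebesgue_cons : set 'rV[R]_n.+1 -> \bar R :=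
  pushforward (@lebesgue_measure R \x m)%E (@cons_rV n).

Let lebesgue_cons0 : lebesgue_cons set0 = 0%E.
Proof. by rewrite /lebesgue_cons /pushforward preimage_set0 measure0. Qed.

Let lebesgue_cons_ge0 A : (0 <= lebesgue_cons A)%E.
Proof. exact: (measure_ge0 (@lebesgue_measure R \x m)%E). Qed.

Let lebesgue_cons_sigma_additive : semi_sigma_additive lebesgue_cons.
Proof.
move=> F mF tF mUF; rewrite /lebesgue_cons /pushforward preimage_bigcup.
have mpre A : measurable A -> measurable (@cons_rV n @^-1` A).
  by move=> mA; rewrite -[X in measurable X]setTI; exact: measurable_cons_rV.
apply: (measure_semi_sigma_additive (s := (@lebesgue_measure R \x m)%E)).
- by move=> k; exact: mpre.
- apply/trivIsetP => /= i j _ _ ij; rewrite -preimage_setI.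
  by move/trivIsetP : tF => /(_ _ _ _ _ ij) ->//; rewrite preimage_set0.
- by rewrite -preimage_bigcup; exact: mpre.
Qed.

HB.instance Definition _ := isMeasure.Build _ _ _ lebesgue_cons
  lebesgue_cons0 lebesgue_cons_ge0 lebesgue_cons_sigma_additive.

Let lebesgue_cons_sigma_finite : sigma_finite setT lebesgue_cons.
Proof.
have /sigma_finiteP[F [UF ndF Foo]] := sigma_finiteT (@lebesgue_measure R).
have /sigma_finiteP[G [UG ndG Goo]] := sigma_finiteT m.
pose uncons (x : 'rV[R]_n.+1) : R * 'rV[R]_n := (x ord0 ord0, behead_rV x).
have muncons : measurable_fun setT uncons.
  by apply/measurable_fun_pair => /=; [exact: measurable_coord|exact: measurable_behead_rV].
have uK : cancel (@cons_rV n) uncons.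
  move=> [x v]; rewrite /uncons /behead_rV /cons_rV/= row_mxKr; congr (_, _).
  rewrite (_ : ord0 = lshift n (ord0 : 'I_1)); last exact/val_inj.
  by apply: etrans (row_mxEl _ _ _ _) _; rewrite mxE eqxx mulr1n.
exists (fun k => uncons @^-1` (F k `*` G k)).
  rewrite -preimage_bigcup (_ : \bigcup_k _ = setT) ?preimage_setT//.
  rewrite -setXTT UF UG predeqE => -[x y]; split.
    by move=> [k _ []/= ? ?]; split; exists k.
  move=> [/= [k _ Fkx] [l _ Gly]]; exists (maxn k l) => //; split.
  - by move: x Fkx; exact/subsetPset/ndF/leq_maxl.
  - by move: y Gly; exact/subsetPset/ndG/leq_maxr.
move=> k; have [mF Fk] := Foo k; have [mG Gk] := Goo k; split.
  by rewrite -[X in measurable X]setTI; apply: muncons => //; exact: measurableX.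
rewrite /lebesgue_cons /pushforward -comp_preimage.
rewrite (_ : uncons \o _ = id); last by apply/funext => x /=; rewrite uK.
by rewrite preimage_id product_measure1E// lte_mul_pinfty// ge0_fin_numE.
Qed.

HB.instance Definition _ := Measure_isSigmaFinite.Build _ _ _ lebesgue_cons
  lebesgue_cons_sigma_finite.

End step.

(* n-dimensional Lebesgue measure: lambda_(n+1) is the image of the product
   measure lambda_1 \x lambda_n under (x, v) |-> row_mx x v. *)
Fixpoint lebesgue_rV (n : nat) : {sigma_finite_measure set 'rV[R]_n -> \bar R} :=
  if n is k.+1 then lebesgue_cons (lebesgue_rV k) else dirac (0 : 'rV[R]_0).

End lebesgue_rV.

Section function_spaces.
Context {R : realType} {n : nat}.
Variable Om : set 'rV[R]_n.
Local Notation mu := (lebesgue_rV n : {measure set 'rV[R]_n -> \bar R}).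
Local Notation fct := ('rV[R]_n -> R).
Implicit Types (u v w f phi : fct).

(* Elements of the function spaces are represented by functions on R^n of which
   only the restriction to Om, up to negligible sets, matters. *)

Definition inL2 f : Prop :=
  measurable_fun Om f /\ mu.-integrable Om (fun x => (f x ^+ 2)%:E).

Definition inner f (g : fct) : R := \int[mu]_(x in Om) (f x * g x).

Definition L2norm f : R := Num.sqrt (inner f f).

Definition Lqnorm (q : R) f : R :=
  (\int[mu]_(x in Om) (`|f x| `^ q)) `^ q^-1.

Fixpoint Ck (k : nat) f : Prop :=
  continuous f /\
  if k is l.+1 then
    forall i : 'I_n, (forall x, derivable f x (delta_mx ord0 i)) /\
      Ck l (fun x => 'D_(delta_mx ord0 i) f x)
  else True.

Definition test_function phi : Prop :=
  [/\ forall k, Ck k phi,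
      compact (closure [set x | phi x != 0]) &
      closure [set x | phi x != 0] `<=` Om].

Definition is_weak_grad v (g : 'I_n -> fct) : Prop :=
  (forall i, inL2 (g i)) /\
  forall i phi, test_function phi ->
    inner v (fun x => 'D_(delta_mx ord0 i) phi x) = - inner (g i) phi.

(* The weak gradient is unique up to negligible sets; a representative is
   chosen. *)
Definition grad v : 'I_n -> fct := get [set g | is_weak_grad v g].

Definition inH1 v : Prop := inL2 v /\ exists g, is_weak_grad v g.

Definition grad_inner v w : R := \sum_(i < n) inner (grad v i) (grad w i).

Definition grad_norm v : R := Num.sqrt (grad_inner v v).

Definition H1norm v : R := Num.sqrt (L2norm v ^+ 2 + grad_norm v ^+ 2).

Definition inH10 v : Prop :=
  inH1 v /\ exists phi : nat -> fct,
    (forall k, test_function (phi k)) /\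
    (fun k => H1norm (v \- phi k)) @ \oo --> (0 : R).

(* H^{-1}: bounded linear functionals on H^1_0; their values outside H^1_0 are
   irrelevant. *)
Definition inHm1 (F : fct -> R) : Prop :=
  (forall (a : R) v w, inH10 v -> inH10 w ->
     F (fun x => a * v x + w x) = a * F v + F w) /\
  exists C : R, forall v, inH10 v -> `|F v| <= C * H1norm v.

Definition Hm1norm (F : fct -> R) : R :=
  sup [set `|F v| | v in [set v | inH10 v /\ H1norm v <= 1]].

(* Dirichlet eigenpairs of -Delta, numbered from 0; the eigenvalue equation is
   the weak one. *)
Record dirichlet_eigenpairs (lam : nat -> R) (e : nat -> fct) : Prop := {
  eigenvalue_gt0 : 0 < lam 0%N;
  eigenvalue_nd : forall k, lam k <= lam k.+1;
  eigenfunction_H10 : forall k, inH10 (e k);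
  eigenfunctionP : forall k v, inH10 v ->
    grad_inner (e k) v = lam k * inner (e k) v;
  eigenfunction_orthonormal : forall j k, inner (e j) (e k) = (j == k)%:R;
  eigenfunction_basis : forall v, inL2 v ->
    (fun N : nat =>
       L2norm (fun x => v x - \sum_(k < N) inner v (e k) * e k x))
    @ \oo --> (0 : R)
}.

Section fractional_powers.
Variables (lam : nat -> R) (e : nat -> fct).

Definition in_domA (s : R) v : Prop :=
  inL2 v /\
  (\sum_(0 <= k <oo) (lam k `^ (2 * s) * inner v (e k) ^+ 2)%:E < +oo)%E.

(* A^s v is the L^2 limit of the partial sums of its eigenfunction expansion
   (a representative is chosen; meaningful for v in D(A^s) only). *)
Definition Apow (s : R) v : fct :=
  get [set w | inL2 w /\
    (fun N : nat =>
       L2norm (fun x => w x -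
         \sum_(k < N) lam k `^ s * inner v (e k) * e k x))
    @ \oo --> (0 : R)].

Definition domA_norm (s : R) v : R :=
  Num.sqrt (L2norm v ^+ 2 + L2norm (Apow s v) ^+ 2).

End fractional_powers.

Section functionals.
Variable p : R.

Definition Ifun v : R := grad_norm v ^+ 2 - Lqnorm (p + 1) v `^ (p + 1).

Definition Jfun v : R :=
  2^-1 * grad_norm v ^+ 2 - (p + 1)^-1 * Lqnorm (p + 1) v `^ (p + 1).

Definition well_depth : R :=
  inf [set Jfun v | v in
    [set v | [/\ inH10 v, ~ ae_eq mu Om v (cst 0) & Ifun v = 0]]].

(* energy of a state (u, u_t) = (v, w) *)
Definition energy v w : R :=
  2^-1 * L2norm w ^+ 2 + 2^-1 * grad_norm v ^+ 2
  - (p + 1)^-1 * Lqnorm (p + 1) v `^ (p + 1).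

Definition Phi v w : R := L2norm w ^+ 2 + grad_norm v ^+ 2.

Definition nonlinear_pairing u v : R :=
  \int[mu]_(x in Om) (`|u x| `^ (p - 1) * u x * v x).

End functionals.
End function_spaces.

Section time_functions.
Context {R : realType}.
Variable T : \bar R.
Local Notation leb := (@lebesgue_measure R).

Definition itv0T : set R := [set t | 0 <= t /\ (t%:E < T)%E].
Definition oitv0T : set R := [set t | 0 < t /\ (t%:E < T)%E].

(* Functions of time take values in a space of real functions on some X
   (X = R^n for function spaces, X = H^1_0 for H^{-1}), given by a membership
   predicate V and a norm N. *)
Section vector_valued.
Context {X : Type}.
Variables (V : (X -> R) -> Prop) (N : (X -> R) -> R).
Implicit Types f : R -> X -> R.

Definition continuous_into f : Prop :=
  (forall t, itv0T t -> V (f t)) /\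
  forall t, itv0T t ->
    (fun s => N (f s \- f t)) @ within itv0T (nbhs t) --> (0 : R).

(* one-sided at t = 0 *)
Definition has_derivative_into f (g : R -> X -> R) : Prop :=
  forall t, itv0T t ->
    (fun s => N (fun x => (f s x - f t x) / (s - t) - g t x))
      @ within itv0T t^' --> (0 : R).

Definition simple_into (s : R -> X -> R) : Prop :=
  exists (m : nat) (E : 'I_m -> set R) (c : 'I_m -> X -> R),
    (forall i, measurable (E i) /\ V (c i)) /\
    s = fun t x => \sum_(i < m) \1_(E i) t * c i x.

(* Bochner measurability on (0, T) *)
Definition strongly_measurable f : Prop :=
  exists s : nat -> R -> X -> R, (forall k, simple_into (s k)) /\
    {ae leb, forall t, oitv0T t ->
      (fun k => N (f t \- s k t)) @ \oo --> (0 : R)}.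

Definition L2loc f : Prop :=
  [/\ {ae leb, forall t, oitv0T t -> V (f t)},
      strongly_measurable f &
      forall tau, oitv0T tau ->
        (\int[leb]_(t in `]0%R, tau[) (N (f t) ^+ 2)%:E < +oo)%E].

End vector_valued.

Definition time_test_function (phi : R -> R) : Prop :=
  [/\ forall k t, derivable (derive1n k phi) t 1,
      compact (closure [set t | phi t != 0]) &
      closure [set t | phi t != 0] `<=` oitv0T].

End time_functions.

Section energy_solution.
Context {R : realType} {n : nat}.
Variables (Om : set 'rV[R]_n) (lam : nat -> R) (e : nat -> 'rV[R]_n -> R).
Variables (theta p : R) (u0 u1 : 'rV[R]_n -> R).
Local Notation mu := (lebesgue_rV n : {measure set 'rV[R]_n -> \bar R}).
Local Notation leb := (@lebesgue_measure R).
Local Notation Ath := (Apow Om lam e (theta / 2)).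

(* utt is the distributional time derivative of ut as an H^{-1}-valued
   function, L^2 being embedded in H^{-1} by the inner product. *)
Definition Hm1_time_derivative (T : \bar R)
    (ut : R -> 'rV[R]_n -> R) (utt : R -> ('rV[R]_n -> R) -> R) : Prop :=
  forall v phi, inH10 Om v -> time_test_function T phi ->
    \int[leb]_(t in oitv0T T) (inner Om (ut t) v * derive1 phi t) =
    - \int[leb]_(t in oitv0T T) (utt t v * phi t).

Record energy_solution_with (T : \bar R) (u ut : R -> 'rV[R]_n -> R)
    (utt : R -> ('rV[R]_n -> R) -> R) : Prop := {
  sol_T_gt0 : (0 < T)%E;
  sol_u_cont : continuous_into T (inH10 Om) (H1norm Om) u;
  sol_ut_cont : continuous_into T (inL2 Om) (L2norm Om) ut;
  sol_ut_derivative : has_derivative_into T (L2norm Om) u ut;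
  sol_ut_L2loc : L2loc T (in_domA Om lam e (theta / 2))
    (domA_norm Om lam e (theta / 2)) ut;
  sol_u_init : ae_eq mu Om (u 0) u0;
  sol_ut_init : ae_eq mu Om (ut 0) u1;
  sol_utt_L2loc : L2loc T (inHm1 Om) (Hm1norm Om) utt;
  sol_utt_derivative : Hm1_time_derivative T ut utt;
  sol_equation : {ae leb, forall t, oitv0T T t -> forall v, inH10 Om v ->
    utt t v + inner Om (Ath (ut t)) (Ath v) + grad_inner Om (u t) v
    = nonlinear_pairing Om p (u t) v};
  sol_energy : forall t, itv0T T t ->
    ((energy Om p (u t) (ut t))%:E
     + \int[leb]_(s in `[0%R, t]) (L2norm Om (Ath (ut s)) ^+ 2)%:E
     <= (energy Om p (u 0%R) (ut 0%R))%:E)%E;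
  sol_maximal : T = +oo%E \/
    exists T0 : R, T = T0%:E /\
      limf_esup (fun t => (Phi Om (u t) (ut t))%:E) (T0^'-) = +oo%E
}.

Definition energy_solution (T : \bar R) (u : R -> 'rV[R]_n -> R) : Prop :=
  exists ut utt, energy_solution_with T u ut utt.

End energy_solution.

(* Main.v *)
Require Import Defs.
From mathcomp Require Import all_boot all_order all_algebra.
From mathcomp Require Import all_classical all_reals all_analysis.
From mathcomp Require Import measurable_realfun ring lra.

Import Order.TTheory GRing.Theory Num.Theory.
Import numFieldNormedType.Exports.
Local Open Scope classical_set_scope.
Local Open Scope ring_scope.

Set Implicit Arguments.
Unset Strict Implicit.
Unset Printing Implicit Defensive.

(* The pairing (u_t, u) and a = |A^{theta/2} u|^2 satisfy
   d/dt ((u_t, u) + a/2) = |u_t|^2 - I(u).  If I(v) < 0, scaling v onto the Nehari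
   manifold gives (p-1)/(2(p+1)) |grad v|^2 >= d, while I(v) >= 0 and J(v) <= E(0)
   give (p-1)/(2(p+1)) |grad v|^2 <= E(0) < d; so by continuity in time the first
   bound persists.  With the energy inequality,
     2 (|u_t|^2 - I(u)) + 2 beta >= (p+3) Y,
     Y = |u_t|^2 + int_0^t |A^{theta/2} u_t|^2 + beta.
   Put G = |u|^2 + int_0^t a + (tau - t) a(0) + beta (t + sigma)^2 and g = G'.
   Then g' >= (p+3) Y, and g^2 <= 4 G Y by Cauchy-Schwarz, hence
   (G/g)' <= - (p-1)/4; as G/g > 0 on [0, tau], this bounds every tau < Tmax.

   Two points make the argument elementary. The nonlinearity is only ever tested
   with u itself, so no Sobolev embedding is needed; and the differential
   inequalities are used in the integrated form F(s) - F(t) <= M(s) - M(t), for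
   s slightly larger than t, which only needs one-sided bounds on u_tt. *)

(** * Integrals of functions that need not be measurable *)

(* The integral of a nonnegative function is the supremum over simple functions
   below it, hence a lower integral when the function is not measurable; this is
   the case for the H^{-1} norm of u_tt and for |A^{theta/2} u_t|. Lower
   integrals are monotone and superadditive over sets, but not additive in the
   integrand. *)
Section lower_integral.
Context d (T : measurableType d) (R : realType) (mu : {measure set T -> \bar R}).
Local Open Scope ereal_scope.
Import HBSimple HBNNSimple.

(** The obstacle is regularity: u_t is continuous only in L^2 and u_tt lies only in H^{-1}, so the
    derivative of (u_t, u) does not come from a classical product rule. Increments of (u_t, v) are
    accessible for a fixed v in H^1_0, by testing the distributional derivative with mollified
    indicators. Hence u is frozen at the left end of a short interval; the resulting errors are eta
    times increments of a monotone function, so they can be added over time before eta tends to 0.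
    The damping term is handled through finitely many eigenmodes, because u_t(t) lies in
    D(A^{theta/2}) only for almost every t. The constants fit together as p + 3 = 4 (1 + alpha) with
    alpha = (p - 1)/4, which gives G g' >= (1 + alpha) g^2; the bound beta <= 2 (d - E(0)) is what
    lets beta enter Y with the same factor p + 3. The conclusion alpha tau < G(0)/g(0) has tau on
    both sides, since G(0) contains tau a(0); solving it for tau produces the denominator of the
    theorem, which the choice of sigma makes positive. *)

Lemma ae_le_integral_ge0 (D : set T) (f g : T -> \bar R) :
  (forall x, D x -> 0 <= f x) -> (forall x, D x -> 0 <= g x) ->
  {ae mu, forall x, D x -> f x <= g x} ->
  \int[mu]_(x in D) f x <= \int[mu]_(x in D) g x.
Proof.
move=> f0 g0 [N [mN N0 fgN]].
rewrite !ge0_integralE//; apply: ge_ereal_sup => _ [h /= hf <-].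
(* The exceptional set is removed from the simple function instead of from [f]: cutting [h] off on
   the null set [N] keeps its integral and brings it below [g] everywhere. *)
apply: ereal_sup_ubound => /=; exists (proj_nnsfun h (measurableC mN)).
  move=> x; rewrite /proj_nnsfun /= mindicE.
  have [xN|xN] := boolP (x \in ~` N); last first.
    by rewrite mulr0; apply: erestrict_ge0.
  rewrite mulr1 (le_trans (hf x))// /patch; case: ifPn => // xD.
  move: xN; rewrite inE /= => xN; apply: contrapT => fgx.
  by apply: xN; apply: fgN => /= /(_ (set_mem xD)).
rewrite -!integralT_nnsfun; apply: ge0_ae_eq_integral => //.
- by apply/measurable_EFinP.
- by apply/measurable_EFinP.
- by move=> x _; rewrite lee_fin; exact: fun_ge0.
- by move=> x _; rewrite lee_fin.
- exists N; split => // x /= /not_implyP[_ /eqP hx]; apply: contrapT => xN.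
  move: hx; rewrite /proj_nnsfun /= mindicE mem_set// mulr1 eqxx//.
Qed.

Lemma ae_eq_integral_ge0 (D : set T) (f g : T -> \bar R) :
  (forall x, D x -> 0 <= f x) -> (forall x, D x -> 0 <= g x) ->
  {ae mu, forall x, D x -> f x = g x} ->
  \int[mu]_(x in D) f x = \int[mu]_(x in D) g x.
Proof.
move=> f0 g0 fg; apply/eqP; rewrite eq_le; apply/andP; split;
  apply: ae_le_integral_ge0 => //; move: fg; apply: filterS => x fgx Dx;
  by rewrite fgx.
Qed.

Lemma ae_eq_integral_nonmeasurable (D : set T) (f g : T -> \bar R) :
  {ae mu, forall x, D x -> f x = g x} ->
  \int[mu]_(x in D) f x = \int[mu]_(x in D) g x.
Proof.
move=> fg; rewrite (integralE _ D f) (integralE _ D g); congr (_ - _);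
  apply: ae_eq_integral_ge0 => //; move: fg; apply: filterS => x fgx Dx.
  by rewrite !funeposE fgx.
by rewrite !funenegE fgx.
Qed.

(** By disjointness, a simple function below [f] on [A] plus one below [f] on [B] is still below [f]
    on [D]. With [B] empty this is monotonicity in the domain. *)
Lemma integral_superadditive (D A B : set T) (f : T -> \bar R) :
  (forall x, D x -> 0 <= f x) -> A `<=` D -> B `<=` D -> [disjoint A & B] ->
  \int[mu]_(x in A) f x + \int[mu]_(x in B) f x <= \int[mu]_(x in D) f x.
Proof.
move=> f0 AD BD /disj_setPS AB.
have fA x : A x -> 0 <= f x by move=> /AD/f0.
have fB x : B x -> 0 <= f x by move=> /BD/f0.
have [->|Doo] := eqVneq (\int[mu]_(x in D) f x) +oo; first by rewrite leey.
have D0 : 0 <= \int[mu]_(x in D) f x by exact: integral_ge0.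
have Dfin : \int[mu]_(x in D) f x \is a fin_num by rewrite ge0_fin_numE// ltey.
have sub E : E `<=` D -> \int[mu]_(x in E) f x <= \int[mu]_(x in D) f x.
  move=> ED; rewrite (integral_mkcond E) (integral_mkcond D).
  apply: ae_le_integral_ge0.
  - by move=> x _; apply: erestrict_ge0 => y /ED/f0.
  - by move=> x _; exact: erestrict_ge0.
  - apply: aeW => x _; rewrite /patch; case: ifPn => [xE|_].
      by rewrite mem_set//; apply: ED; exact: set_mem xE.
    by case: ifPn => // xD; apply: f0; exact: set_mem.
have Bfin : \int[mu]_(x in B) f x \is a fin_num.
  rewrite ge0_fin_numE ?integral_ge0//.
  by rewrite (le_lt_trans (sub _ BD))// -ge0_fin_numE.
rewrite -leeBrDr//.
rewrite (ge0_integralE _ fA); apply: ge_ereal_sup => _ [h hf <-].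
have hfin : sintegral mu h \is a fin_num.
  rewrite ge0_fin_numE ?sintegral_ge0//.
  rewrite (@le_lt_trans _ _ (\int[mu]_(x in D) f x))//; last by rewrite -ge0_fin_numE.
  rewrite (le_trans _ (sub _ AD))// (ge0_integralE _ fA).
  by apply: ereal_sup_ubound; exists h.
rewrite leeBrDr// addeC -leeBrDr//.
rewrite (ge0_integralE _ fB); apply: ge_ereal_sup => _ [k kf <-].
rewrite leeBrDr// addeC -sintegralD// (ge0_integralE _ f0).
apply: ereal_sup_ubound; exists (h \+ k)%R => //.
move=> x; move: (hf x) (kf x); rewrite /patch/= EFinD.
case: ifPn => xA; case: ifPn => xB.
- by have := AB x; rewrite /= => /(_ (conj (set_mem xA) (set_mem xB))).
- rewrite mem_set; last exact/AD/set_mem.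
  by move=> hx kx; rewrite -[f x]adde0 leeD.
- rewrite mem_set; last exact/BD/set_mem.
  by move=> hx kx; rewrite -[f x]add0e leeD.
- move=> hx kx; apply: (@le_trans _ _ (0 + 0)); first exact: leeD.
  by rewrite adde0; case: ifPn => // xD; apply: f0; exact: set_mem.
Qed.

End lower_integral.

(** * One-sided differential inequalities *)

Section real_lemmas.
Context {R : realType}.
Implicit Types (F M : R -> R) (A : set R).

Lemma within_nbhsP A (P : set R) (t : R) :
  (\forall s \near within A (nbhs t), P s) <->
  exists2 d : R, 0 < d & forall s, `|s - t| < d -> A s -> P s.
Proof.
split.
  rewrite near_withinE => /nbhs_ballP[d /= d0 dP]; exists d => // s std As.
  by apply: dP => //; rewrite /ball /= distrC.
move=> [d d0 dP]; rewrite near_withinE; apply/nbhs_ballP; exists d => //= s.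
by rewrite /ball /= distrC => std As; exact: dP.
Qed.

(* The differential form of the hypothesis is F' <= M', with right difference
   quotients; M need not be continuous. *)
Lemma le_of_right_local F M a b : a <= b ->
  (forall s t, a <= s -> s <= t -> t <= b -> M s <= M t) ->
  (forall t, t \in `[a, b] -> F s @[s --> within `[a, b] (nbhs t)] --> F t) ->
  (forall t, a <= t -> t < b -> exists2 d : R, 0 < d &
     forall s, t < s -> s < t + d -> s <= b -> F s - F t <= M s - M t) ->
  F b - F a <= M b - M a.
Proof.
move=> ab Mnd Fc loc.
(* Real induction: the set of good times contains its supremum [c], because [F] is continuous at [c]
   and [M] can only grow on the way up to it; the local bound then forbids [c < b]. *)
pose S := [set t | a <= t <= b /\ F t - F a <= M t - M a].
have Sa : S a by rewrite /S /= lexx ab !subrr.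
have Sub : ubound S b by move=> t [/andP[]].
have hS : has_sup S by split; [exists a|exists b].
pose c := sup S.
have ac : a <= c by apply: ub_le_sup => //; exists b.
have cb : c <= b by apply: ge_sup => //; exists a.
have Sc : S c.
  split; first by rewrite ac cb.
  rewrite leNgt; apply/negP => gap.
  have cab : c \in `[a, b] by rewrite in_itv /= ac cb.
  have e0 : 0 < F c - F a - (M c - M a) by rewrite subr_gt0.
  have /cvgrPdist_lt/(_ _ e0)/within_nbhsP[d d0 dP] := Fc _ cab.
  have [t [/andP[a_t tb] St] ct] := sup_adherent d0 hS.
  have tc : t <= c by apply: ub_le_sup; [exists b|split; rewrite ?a_t].
  have := dP t.
  rewrite distrC ger0_norm ?subr_ge0// => /(_ _ _)/wrap[].
    by rewrite -/c in ct; lra.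
  by rewrite /= in_itv /= a_t tb.
  have := Mnd t c a_t tc cb; have := ler_norm (F c - F t).
  lra.
have [cltb|bc] := ltP c b; last first.
  by have -> : b = c; [apply/eqP; rewrite eq_le bc cb|case: Sc].
have [d d0 dP] := loc c ac cltb.
have [_ FcMc] := Sc.
pose s := Num.min b (c + d / 2).
have cs : c < s by rewrite lt_min cltb /=; lra.
have sb : s <= b by rewrite ge_min lexx.
have scd : s < c + d by rewrite gt_min; apply/orP; right; lra.
have Ss : S s.
  split; first by rewrite sb; lra.
  by have := dP s cs scd sb; lra.
have : s <= c by apply: ub_le_sup; [exists b|].
lra.
Qed.

(* Turns a family of quadratic bounds, which can be integrated in time, into a
   Cauchy-Schwarz inequality. *)
Lemma discriminant_le (x y z : R) : 0 <= y ->
  (forall l, 2 * l * z <= x + l ^+ 2 * y) -> z ^+ 2 <= x * y.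
Proof.
move=> y0 H; have x0 : 0 <= x by have := H 0; lra.
have [y_eq0|yn0] := eqVneq y 0.
  have [-> |zn0] := eqVneq z 0; first by rewrite expr0n /= y_eq0 mulr0.
  (* For [y = 0] and [z != 0] the hypothesis would bound a nonconstant linear function of [l]; this
     [l] makes its left side [x + 1]. *)
  have := H ((x + 1) / (2 * z)); rewrite y_eq0 mulr0 addr0.
  by rewrite (_ : 2 * _ * z = x + 1); [lra|field; rewrite zn0].
have {}y0 : 0 < y by rewrite lt_neqAle eq_sym yn0.
have := H (z / y); rewrite -(ler_pM2r y0).
have -> : 2 * (z / y) * z * y = 2 * z ^+ 2 by field.
have -> : (x + (z / y) ^+ 2 * y) * y = x * y + z ^+ 2 by field.
lra.
Qed.
End real_lemmas.

(** * Levine's concavity argument for the quotient G / g *)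

Section concavity.
Context {R : realType}.

(** One time step of (G/g)' <= - al: [X], [x] are G, g at the start, [Gs], [gs] after time [h]. If
    g' were exactly [D] and G' exactly [x], the derivative of the quotient would be 1 - X D / x^2 =
    - al; [del] is the slack of the difference quotients, and [eps] pays for it and for the term of
    second order in [h]. *)
Lemma quotient_decrease (X x Gs gs al eps del h D : R) :
  0 < x -> 0 < gs -> 0 < h ->
  Gs - X <= (x + del) * h -> (D - del) * h <= gs - x ->
  D * X = (1 + al) * x ^+ 2 -> del * (X + x) <= eps * x ^+ 2 / 2 ->
  (al - eps) * h * x * (D - del) <= eps * x ^+ 2 / 2 ->
  (al - eps) * h * x <= X ->
  Gs / gs + (al - eps) * h <= X / x.
Proof.
move=> x0 gs0 h0 hG hg hD h1 h2 h3.
rewrite -lerBrDr ler_pdivrMr//.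
have -> : (X / x - (al - eps) * h) * gs = (X - (al - eps) * h * x) * gs / x.
  by field; rewrite gt_eqF.
rewrite ler_pdivlMr//.
have h3' : 0 <= X - (al - eps) * h * x by rewrite subr_ge0.
have hg' : x + (D - del) * h <= gs by rewrite -lerBrDl.
apply: le_trans (ler_wpM2l h3' hg').
have hG' : Gs <= X + (x + del) * h by rewrite -lerBlDl.
apply: le_trans (ler_wpM2r (ltW x0) hG') _.
have key : 0 <= h * (eps * x ^+ 2 - del * (X + x) - (al - eps) * h * x * (D - del)).
  by apply: mulr_ge0; [exact: ltW|lra].
rewrite -subr_ge0; apply: le_trans key _; rewrite le_eqVlt; apply/orP; left; apply/eqP.
have -> : (X - (al - eps) * h * x) * (x + (D - del) * h) - (X + (x + del) * h) * x =
  h * (D * X - del * X - (al - eps) * x ^+ 2 - x ^+ 2 - del * x -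
    (al - eps) * h * x * (D - del)) by ring.
by rewrite hD; ring.
Qed.

(* Levine's concavity argument for G^-al, with G' = g, in the form
   (G / g)' <= - al. *)
Lemma concavity_bound (G g : R -> R) (al tau : R) : 0 < tau -> 0 < al ->
  (forall t, t \in `[0, tau] -> G s @[s --> within `[0, tau] (nbhs t)] --> G t) ->
  (forall t, t \in `[0, tau] -> g s @[s --> within `[0, tau] (nbhs t)] --> g t) ->
  (forall t, t \in `[0, tau] -> 0 < G t) -> (forall t, t \in `[0, tau] -> 0 < g t) ->
  (forall t del, 0 < t -> t < tau -> 0 < del -> exists2 d, 0 < d &
    forall s, t < s -> s < t + d -> s <= tau ->
      G s - G t <= (g t + del) * (s - t) /\
      ((1 + al) * g t ^+ 2 / G t - del) * (s - t) <= g s - g t) ->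
  al * tau < G 0 / g 0.
Proof.
move=> tau0 al0 cG cg G0 g0 loc; pose F t := G t / g t.
have cF t : t \in `[0, tau] -> F s @[s --> within `[0, tau] (nbhs t)] --> F t.
  move=> tt; have gt := cg t tt; have Gt := cG t tt.
  by apply: (cvgM Gt); apply: (cvgV _ gt); rewrite gt_eqF// g0.
have F0 t : t \in `[0, tau] -> 0 < F t by move=> tt; rewrite divr_gt0 ?G0 ?g0.
(* The local bounds hold at positive times only, so the decrease is first shown on [[a, tau]] with a
   loss [eps]; continuity of [F] at 0 recovers the left endpoint. *)
have main a eps : 0 < a -> a < tau -> 0 < eps -> eps <= al ->
    F tau + (al - eps) * (tau - a) <= F a.
  move=> a0 atau eps0 epsal.
  have ale : 0 <= al - eps by rewrite subr_ge0.
  have inI t : a <= t -> t <= tau -> t \in `[0, tau].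
    by move=> at_ tt; rewrite in_itv /= tt andbT (le_trans (ltW a0)).
  pose F1 t := F t + (al - eps) * t.
  suff H : F1 tau - F1 a <= 0 by move: H; rewrite /F1; lra.
  apply: (@le_trans _ _ (cst 0 tau - cst 0 a)); last by rewrite subrr.
  apply: le_of_right_local => //; first exact: ltW.
    move=> t tat; have /andP[t1 t2] : a <= t <= tau by move: tat; rewrite in_itv.
    have c := cF t (inI t t1 t2).
    have cw : F s @[s --> within `[a, tau] (nbhs t)] --> F t.
      apply: cvg_trans c => A AF.
      have {}AF : nbhs t [set s | s \in `[0, tau] -> A (F s)] := AF.
      apply: filterS AF => s + sa; apply; move: sa; rewrite /= in_itv /= => /andP[s1 s2].
      exact: inI.
    have ci : s @[s --> within `[a, tau] (nbhs t)] --> t by exact: cvg_within.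
    exact: (cvgD cw (cvgM (cvg_cst (al - eps)) ci)).
  move=> t at_ ttau; have tI := inI t at_ (ltW ttau).
  have [X0 x0] := (G0 t tI, g0 t tI).
  pose D := (1 + al) * g t ^+ 2 / G t.
  have D0 : 0 <= D.
    by rewrite divr_ge0 ?(ltW X0)// mulr_ge0 ?sqr_ge0// addr_ge0// ltW.
  (* Half of the loss allowed by [eps]: one half absorbs the slack of the difference quotients, the
     other the second-order term. *)
  pose q := eps * g t ^+ 2 / 2.
  have q0 : 0 < q by rewrite divr_gt0// mulr_gt0// exprn_gt0.
  have Xx : 0 < G t + g t by rewrite addr_gt0.
  have del0 : 0 < q / (G t + g t) by rewrite divr_gt0.
  have [d d0 dP] := loc t _ (lt_le_trans a0 at_) ttau del0.
  have K0 : 0 < al * g t * D + 1.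
    by rewrite ltr_wpDl// mulr_ge0// mulr_ge0// ltW.
  have d20 : 0 < q / (al * g t * D + 1) by rewrite divr_gt0.
  have alx : 0 < al * g t by rewrite mulr_gt0.
  have d30 : 0 < G t / (al * g t) by rewrite divr_gt0.
  (* In order: validity of the local bounds, smallness of the second-order term, and nonnegativity
     of [G t - (al - eps) * (s - t) * g t]. The [+ 1] only keeps the denominator positive. *)
  exists (Num.min d (Num.min (q / (al * g t * D + 1)) (G t / (al * g t)))).
    by rewrite !lt_min d0 d20 d30.
  move=> s ts std stau.
  have [sd sd2 sd3] : [/\ s < t + d, s - t <= q / (al * g t * D + 1) &
      s - t <= G t / (al * g t)].
    by move: std; rewrite -ltrBlDl !lt_min ltrBlDl => /and3P[-> /ltW-> /ltW->].
  have [h1 h2] := dP s ts sd stau.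
  have h0 : 0 < s - t by rewrite subr_gt0.
  have sI := inI s (le_trans at_ (ltW ts)) stau.
  have small : (al - eps) * (s - t) * g t <= al * g t * (s - t).
    by rewrite mulrAC ler_wpM2r ?(ltW h0)// ler_wpM2r ?(ltW x0)// gerBl ltW.
  have s0 : 0 <= (al - eps) * (s - t) * g t by rewrite !mulr_ge0// ltW.
  rewrite ler_pdivlMr// in sd2; rewrite ler_pdivlMr// in sd3.
  have := @quotient_decrease (G t) (g t) (G s) (g s) al eps (q / (G t + g t)) (s - t) D
    x0 (g0 s sI) h0 h1 h2.
  rewrite divfK ?gt_eqF// divfK ?gt_eqF// => /(_ erefl (lexx _)) H.
  rewrite subrr /F1 /F; suff : G s / g s + (al - eps) * (s - t) <= G t / g t by lra.
  apply: H.
    apply: (@le_trans _ _ ((al - eps) * (s - t) * g t * D)).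
      by rewrite ler_wpM2l// gerBl ltW.
    apply: (@le_trans _ _ (al * g t * (s - t) * D)); first by rewrite ler_wpM2r.
    apply: le_trans sd2; rewrite mulrAC mulrC mulrDr mulr1 lerDl; exact: ltW.
  by apply: le_trans small _; rewrite mulrC.
have i0 : 0 \in `[0, tau] by rewrite in_itv /= lexx ltW.
have itau : tau \in `[0, tau] by rewrite in_itv /= lexx ltW.
have Ft0 := F0 tau itau.
have eta0 : 0 < F tau / 4 by rewrite divr_gt0.
have /cvgrPdist_le/(_ _ eta0)/within_nbhsP[d d0 dP] := cF 0 i0.
(* Three losses of at most [F tau / 4] each are arranged: [F a - F 0], [al * a] and, below,
   [eps * tau]. The last quarter of [F tau] makes the final inequality strict. *)
pose a := Num.min (tau / 2) (Num.min (d / 2) (F tau / 4 / al)).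
have a0 : 0 < a by rewrite !lt_min (divr_gt0 tau0)// (divr_gt0 d0)// (divr_gt0 eta0).
have [a1 a2 a3] : [/\ a <= tau / 2, a <= d / 2 & a <= F tau / 4 / al].
  by rewrite /a !ge_min !lexx !orbT.
have atau : a < tau by lra.
have aI : a \in `[0, tau] by rewrite in_itv /= (ltW a0) (ltW atau).
have ad : `|a - 0| < d by rewrite subr0 gtr0_norm//; lra.
have := dP a ad aI; rewrite ler_distlC => /andP[_ Fa].
pose eps := Num.min al (F tau / 4 / tau).
have eps0 : 0 < eps by rewrite lt_min al0 (divr_gt0 eta0).
have [e1 e2] : eps <= al /\ eps <= F tau / 4 / tau by rewrite /eps !ge_min !lexx orbT.
have m := main a eps a0 atau eps0 e1.
rewrite ler_pdivlMr// in a3; rewrite ler_pdivlMr// in e2.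
have ea : 0 <= eps * a by rewrite mulr_ge0// ltW.
rewrite -/(F 0); move: (F tau) (F a) (F 0) Ft0 Fa m a3 e2 => x y z Ft0 Fa m a3 e2.
lra.
Qed.

End concavity.

(** * Semi-inner products *)

(** Functions are not identified almost everywhere, so the forms are only positive semidefinite, and
    their laws are required only inside [V]. A single theory then covers L^2, the gradient form and
    the H^1 product. *)
Record semi_inner (R : realType) (T : Type) (V : (T -> R) -> Prop)
    (B : (T -> R) -> (T -> R) -> R) : Prop := {
  semi_inner_closed : forall a f g, V f -> V g -> V (fun x => a * f x + g x);
  semi_innerC : forall f g, V f -> V g -> B f g = B g f;
  semi_innerDl : forall a f g h, V f -> V g -> V h ->
    B (fun x => a * f x + g x) h = a * B f h + B g h;
  semi_inner_ge0 : forall f, V f -> 0 <= B f f }.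

Section semi_inner_theory.
Context {R : realType} {T : Type}.
Variables (V : (T -> R) -> Prop) (B : (T -> R) -> (T -> R) -> R).
Hypothesis VB : semi_inner V B.
Implicit Types f g h : T -> R.
Let N f := Num.sqrt (B f f).

Lemma semi_inner_subV f g : V f -> V g -> V (f \- g).
Proof.
move=> Vf Vg; rewrite (_ : _ \- _ = fun x => -1 * g x + f x).
  exact: (semi_inner_closed VB).
by apply/funext => x /=; rewrite mulN1r addrC.
Qed.

Lemma semi_inner0V f : V f -> V (fun=> 0).
Proof.
move=> Vf; rewrite (_ : (fun=> 0) = f \- f); first exact: semi_inner_subV.
by apply/funext => x /=; rewrite subrr.
Qed.

Lemma semi_innerZV a f : V f -> V (fun x => a * f x).
Proof.
move=> Vf; rewrite (_ : (fun x => _) = (fun x => a * f x + 0)); last first.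
  by apply/funext => x; rewrite addr0.
by apply: (semi_inner_closed VB) => //; exact: semi_inner0V Vf.
Qed.

Lemma semi_innerBl f g h : V f -> V g -> V h -> B (f \- g) h = B f h - B g h.
Proof.
move=> Vf Vg Vh; rewrite (_ : _ \- _ = fun x => -1 * g x + f x); last first.
  by apply/funext => x /=; rewrite mulN1r addrC.
by rewrite (semi_innerDl VB)// mulN1r addrC.
Qed.

Lemma semi_innerBr f g h : V f -> V g -> V h -> B h (f \- g) = B h f - B h g.
Proof.
move=> Vf Vg Vh; rewrite (semi_innerC VB)//; last exact: semi_inner_subV.
by rewrite semi_innerBl// (semi_innerC VB Vh Vf) (semi_innerC VB Vh Vg).
Qed.

Lemma semi_inner0l f h : V f -> V h -> B (fun=> 0) h = 0.
Proof.
move=> Vf Vh; rewrite (_ : (fun=> 0) = f \- f).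
  by rewrite semi_innerBl// subrr.
by apply/funext => x /=; rewrite subrr.
Qed.

Lemma semi_innerZl a f h : V f -> V h -> B (fun x => a * f x) h = a * B f h.
Proof.
move=> Vf Vh; rewrite (_ : (fun x => _) = (fun x => a * f x + 0)); last first.
  by apply/funext => x; rewrite addr0.
rewrite (semi_innerDl VB)//; last exact: semi_inner0V Vf.
by rewrite (semi_inner0l Vf)// addr0.
Qed.

Lemma semi_innerZZ a f : V f ->
  B (fun x => a * f x) (fun x => a * f x) = a ^+ 2 * B f f.
Proof.
move=> Vf; have Vaf := semi_innerZV a Vf.
by rewrite semi_innerZl// (semi_innerC VB)// semi_innerZl// mulrA.
Qed.

Lemma semi_inner_sumV n (c : nat -> R) (e : nat -> T -> R) :
  (forall k, V (e k)) -> V (fun x => \sum_(k < n) c k * e k x).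
Proof.
move=> Ve; elim: n => [|n IH].
  rewrite (_ : (fun x => _) = (fun=> 0)); first exact: (semi_inner0V (Ve 0%N)).
  by apply/funext => x; rewrite big_ord0.
rewrite (_ : (fun x => _) =
  fun x => c n * e n x + \sum_(k < n) c k * e k x); last first.
  by apply/funext => x; rewrite big_ord_recr /= addrC.
exact: (semi_inner_closed VB).
Qed.

Lemma semi_inner_suml n (c : nat -> R) (e : nat -> T -> R) h :
  (forall k, V (e k)) -> V h ->
  B (fun x => \sum_(k < n) c k * e k x) h = \sum_(k < n) c k * B (e k) h.
Proof.
move=> Ve Vh; elim: n => [|n IH].
  rewrite big_ord0 (_ : (fun x => _) = (fun=> 0)).
    exact: (semi_inner0l (Ve 0%N)).
  by apply/funext => x; rewrite big_ord0.
rewrite (_ : (fun x => _) =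
  fun x => c n * e n x + \sum_(k < n) c k * e k x); last first.
  by apply/funext => x; rewrite big_ord_recr /= addrC.
rewrite (semi_innerDl VB)//; last exact: semi_inner_sumV.
by rewrite IH big_ord_recr /= addrC.
Qed.

Lemma semi_inner_sum_sqr n (c w : nat -> R) (e : nat -> T -> R) :
  (forall k, V (e k)) -> (forall j k, B (e j) (e k) = w k * (j == k)%:R) ->
  B (fun x => \sum_(k < n) c k * e k x) (fun x => \sum_(k < n) c k * e k x) =
  \sum_(k < n) w k * c k ^+ 2.
Proof.
move=> Ve ee; have Vs := semi_inner_sumV n c Ve.
rewrite semi_inner_suml//; apply: eq_bigr => k _.
rewrite (semi_innerC VB)// semi_inner_suml// (bigD1 k)//= big1 ?addr0.
  by rewrite ee eqxx mulr1; ring.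
by move=> j jk; rewrite ee (negbTE jk : (j == k :> nat) = false) !mulr0.
Qed.

(** Pythagoras for an orthogonal system whose squares are the weights [w k]. Writing the
    coefficients as [w k * c k] lets the same L^2 coefficients serve both L^2 (weights 1) and the
    gradient form (weights the eigenvalues). *)
Lemma semi_inner_residual n (c w : nat -> R) (e : nat -> T -> R) f :
  (forall k, V (e k)) -> V f ->
  (forall k, B (e k) f = w k * c k) ->
  (forall j k, B (e j) (e k) = w k * (j == k)%:R) ->
  B (f \- fun x => \sum_(k < n) c k * e k x)
    (f \- fun x => \sum_(k < n) c k * e k x) =
  B f f - \sum_(k < n) w k * c k ^+ 2.
Proof.
move=> Ve Vf ef ee; set s := fun x => _.
have Vs : V s by exact: semi_inner_sumV.
have sf : B s f = \sum_(k < n) w k * c k ^+ 2.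
  by rewrite semi_inner_suml//; apply: eq_bigr => k _; rewrite ef; ring.
have ss : B s s = \sum_(k < n) w k * c k ^+ 2 by exact: semi_inner_sum_sqr.
have Vfs := semi_inner_subV Vf Vs.
rewrite semi_innerBl// !semi_innerBr// (semi_innerC VB Vf Vs)// sf ss; ring.
Qed.

Lemma semi_inner_bessel n (c w : nat -> R) (e : nat -> T -> R) f :
  (forall k, V (e k)) -> V f ->
  (forall k, B (e k) f = w k * c k) ->
  (forall j k, B (e j) (e k) = w k * (j == k)%:R) ->
  \sum_(k < n) w k * c k ^+ 2 <= B f f.
Proof.
move=> Ve Vf ef ee; rewrite -subr_ge0 -(semi_inner_residual n Ve Vf ef ee).
apply: (semi_inner_ge0 VB); apply: semi_inner_subV => //.
exact: semi_inner_sumV.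
Qed.

(** Nonnegativity of [B] at f - l g. With [l] left free, such bounds can be added to others before
    [discriminant_le] optimises over [l]. *)
Lemma semi_inner_quadratic f g l : V f -> V g ->
  2 * l * B f g <= B f f + l ^+ 2 * B g g.
Proof.
move=> Vf Vg; have Vlg := semi_innerZV l Vg.
have := semi_inner_ge0 VB (semi_inner_subV Vf Vlg).
rewrite semi_innerBl//; last exact: semi_inner_subV.
rewrite !semi_innerBr// (semi_innerC VB Vf Vlg)// semi_innerZZ// !semi_innerZl//.
rewrite (semi_innerC VB Vg Vf)//; lra.
Qed.

Lemma semi_inner_CS_sqr f g : V f -> V g -> B f g ^+ 2 <= B f f * B g g.
Proof.
move=> Vf Vg; apply: discriminant_le; first exact: (semi_inner_ge0 VB).
by move=> l; exact: semi_inner_quadratic.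
Qed.

Lemma semi_inner_CS f g : V f -> V g -> `|B f g| <= N f * N g.
Proof.
move=> Vf Vg; rewrite /N -sqrtrM ?(semi_inner_ge0 VB)// -sqrtr_sqr.
by rewrite ler_wsqrtr// semi_inner_CS_sqr.
Qed.

Lemma semi_norm_sqr f : V f -> N f ^+ 2 = B f f.
Proof. by move=> Vf; rewrite sqr_sqrtr// (semi_inner_ge0 VB). Qed.

Lemma semi_normBC f g : V f -> V g -> N (f \- g) = N (g \- f).
Proof.
move=> Vf Vg; have Vgf := semi_inner_subV Vg Vf.
have -> : f \- g = (fun x => -1 * (g \- f) x).
  by apply/funext => x /=; ring.
by rewrite /N semi_innerZZ// sqrrN expr1n mul1r.
Qed.

Lemma semi_norm_triangle f g : V f -> V g -> N f <= N g + N (f \- g).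
Proof.
move=> Vf Vg; have Vfg := semi_inner_subV Vf Vg.
have N0 h : 0 <= N h by exact: sqrtr_ge0.
rewrite -(ler_pXn2r (_ : (0 < 2)%N)) ?nnegrE ?addr_ge0//.
have -> : N f ^+ 2 = B g g + 2 * B g (f \- g) + B (f \- g) (f \- g).
  rewrite semi_norm_sqr// semi_innerBr// semi_innerBl// !semi_innerBr//.
  rewrite (semi_innerC VB Vg Vf)//; ring.
rewrite sqrrD !semi_norm_sqr// lerD2r lerD2l.
have := semi_inner_CS Vg Vfg; have := ler_norm (B g (f \- g)).
rewrite -mulr_natl; lra.
Qed.

Lemma semi_norm_dist f g : V f -> V g -> `|N f - N g| <= N (f \- g).
Proof.
move=> Vf Vg; rewrite ler_norml; apply/andP; split.
  by have := semi_norm_triangle Vg Vf; rewrite (semi_normBC Vg Vf); lra.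
by have := semi_norm_triangle Vf Vg; lra.
Qed.

Lemma semi_inner_dist f f' g g' : V f -> V f' -> V g -> V g' ->
  `|B f g - B f' g'| <= N (f \- f') * N g + N f' * N (g \- g').
Proof.
move=> Vf Vf' Vg Vg'; have Vff := semi_inner_subV Vf Vf'.
have Vgg := semi_inner_subV Vg Vg'.
rewrite (_ : _ - _ = B (f \- f') g + B f' (g \- g')).
  by rewrite (le_trans (ler_normD _ _))// lerD// semi_inner_CS.
by rewrite semi_innerBl// semi_innerBr//; ring.
Qed.

Lemma semi_norm_cvg (U : Type) (F : set_system U) {FF : Filter F}
    (f : U -> T -> R) f0 : (\forall s \near F, V (f s)) -> V f0 ->
  N (f s \- f0) @[s --> F] --> 0 -> N (f s) @[s --> F] --> N f0.
Proof.
move=> Vf Vf0 ff; apply/cvgrPdist_le => eps eps0.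
have /cvgrPdist_le/(_ _ eps0) := ff; apply: filterS2 Vf => s Vs.
rewrite sub0r normrN ger0_norm ?sqrtr_ge0// => Nf.
by rewrite distrC (le_trans (semi_norm_dist _ _)).
Qed.

Lemma semi_inner_cvg (U : Type) (F : set_system U) {FF : Filter F}
    (f g : U -> T -> R) f0 g0 :
  (\forall s \near F, V (f s)) -> (\forall s \near F, V (g s)) -> V f0 -> V g0 ->
  N (f s \- f0) @[s --> F] --> 0 -> N (g s \- g0) @[s --> F] --> 0 ->
  B (f s) (g s) @[s --> F] --> B f0 g0.
Proof.
move=> Vf Vg Vf0 Vg0 ff gg.
have dom : N (f s \- f0) * N (g s) + N f0 * N (g s \- g0) @[s --> F] --> 0.
  rewrite [X in _ --> X](_ : _ = 0 * N g0 + N f0 * 0); last by ring.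
  apply: cvgD; apply: cvgM => //; last exact: cvg_cst.
  exact: semi_norm_cvg.
apply/cvgrPdist_le => eps eps0.
have /cvgrPdist_le/(_ _ eps0) := dom; apply: filterS3 Vf Vg => s Vs Vs'.
rewrite sub0r normrN => /(le_trans (ler_norm _)) H.
by rewrite distrC (le_trans (semi_inner_dist _ _ _ _)).
Qed.

End semi_inner_theory.

(** * Almost everywhere limits *)

Section ae_convergence.
Context d (T : measurableType d) (R : realType) (mu : {measure set T -> \bar R}).
Variables (D : set T) (mD : measurable D).

(** Multiplying by the indicator of the complement of a measurable null set makes the convergence
    hold everywhere, so the truncated limit is measurable. *)
Lemma ae_cvg_measurable (g : nat -> T -> R) (f : T -> R) :
  (forall k, measurable_fun D (g k)) ->
  {ae mu, forall x, D x -> g k x @[k --> \oo] --> f x} ->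
  exists2 h, measurable_fun D h & {ae mu, forall x, D x -> f x = h x}.
Proof.
move=> mg [N [mN N0 gfN]].
exists (fun x => f x * \1_(~` N) x).
  apply: (@measurable_fun_cvg _ _ _ _ (fun k x => g k x * \1_(~` N) x)).
    by move=> k; apply: measurable_funM => //; exact: measurable_indic (measurableC mN).
  move=> x Dx; rewrite indicE; have [xN|xN] := boolP (x \in ~` N); last first.
    by under eq_fun do rewrite mulr0; rewrite mulr0; exact: cvg_cst.
  under eq_fun do rewrite mulr1; rewrite mulr1.
  move: xN; rewrite inE /= => xN; apply: contrapT => gfx; apply: xN.
  by apply: gfN => /= /(_ Dx).
exists N; split => // x /= /not_implyP[Dx /eqP fh]; apply: contrapT => xN.
by move: fh; rewrite indicE mem_set// mulr1 eqxx.
Qed.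

(** With z_j the successive differences, |z_j| <= 2^-j + 2^j z_j^2, and the integral of 2^j z_j^2 is
    at most 2^-j. Hence the telescoping series converges absolutely wherever the sum of the 2^j
    z_j^2 is finite, that is almost everywhere. *)
Lemma ae_cvg_fast (g : nat -> T -> R) :
  (forall k, measurable_fun D (g k)) ->
  (forall j, (\int[mu]_(x in D) ((g j.+1 x - g j x) ^+ 2)%:E <= (4^-1 ^+ j)%:E)%E) ->
  {ae mu, forall x, D x -> cvgn (g ^~ x)}.
Proof.
move=> mg ig.
pose s j x := (2 ^+ j * (g j.+1 x - g j x) ^+ 2)%:E : \bar R.
have p2 j : 0 <= 2 ^+ j :> R by apply: exprn_ge0; exact: ler0n.
have s0 j x : (0 <= s j x)%E by rewrite lee_fin; apply: mulr_ge0 => //; exact: sqr_ge0.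
have md j : measurable_fun D (fun x => (g j.+1 x - g j x) ^+ 2).
  by apply: (@measurable_funX _ _ _ _ (fun x => g j.+1 x - g j x)); exact: measurable_funB.
have ms j : measurable_fun D (s j).
  by apply/measurable_EFinP; exact: measurable_funM.
have : (\int[mu]_(x in D) \sum_(0 <= j <oo) s j x < +oo)%E.
  rewrite integral_nneseries//.
  apply: (@le_lt_trans _ _ (\sum_(0 <= j <oo) (2 / (2 ^ (j + 1))%:R)%:E)%E).
    apply: lee_nneseries => //; first by move=> j _; rewrite integral_ge0.
    move=> j _; rewrite /s.
    under eq_integral do rewrite EFinM.
    rewrite ge0_integralZl_EFin//; last 2 first.
    - by move=> x _; rewrite lee_fin sqr_ge0.
    - exact/measurable_EFinP.
    apply: (@le_trans _ _ ((2 ^+ j)%:E * (4^-1 ^+ j)%:E)%E).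
      by apply: lee_wpmul2l => //; rewrite lee_fin p2.
    rewrite -EFinM lee_fin -exprMn addn1 natrX exprS invfM mulrA divff// mul1r -exprVn.
    by rewrite (_ : 2 * 4^-1 = 2^-1 :> R)//; lra.
  by have /cvg_lim -> := @cvg_geometric_eseries_half R 2 0; rewrite ?ltry.
have ss0 x : (0 <= \sum_(0 <= j <oo) s j x)%E by exact: nneseries_ge0.
move=> soo.
have : mu.-integrable D (fun x => \sum_(0 <= j <oo) s j x)%E.
  apply/integrableP; split; first exact: ge0_emeasurable_sum.
  by under eq_integral do rewrite gee0_abs//.
move=> /(integrable_ae mD); apply: filterS => x + Dx => /(_ Dx) sfin.
have gE : g ^~ x = fun n => g 0%N x + \sum_(j < n) (g j.+1 x - g j x).
  apply/funext => n; rewrite -(big_mkord xpredT (fun j => g j.+1 x - g j x)).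
  by rewrite telescope_sumr// addrC subrK.
rewrite gE; apply: is_cvgD; first exact: is_cvg_cst.
rewrite (_ : (fun n => _) = series (fun j => g j.+1 x - g j x)); last first.
  by apply/funext => n; rewrite /series /= big_mkord.
apply: normed_cvg; apply: nondecreasing_is_cvgn.
  by apply: nondecreasing_series => j _ _; exact: normr_ge0.
exists (2 + fine (\sum_(0 <= j <oo) s j x)%E) => _ [n _ <-].
apply: (@le_trans _ _ (\sum_(0 <= j < n) (geometric 1 2^-1 j +
    2 ^+ j * (g j.+1 x - g j x) ^+ 2))).
  apply: ler_sum => j _; rewrite /geometric /= mul1r exprVn.
  have p0 : 0 < 2 ^+ j :> R by rewrite exprn_gt0.
  have q0 : 0 < (2 ^+ j)^-1 :> R by rewrite invr_gt0.
  have pq : 2 ^+ j * (2 ^+ j)^-1 = 1 :> R by rewrite divff// gt_eqF.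
  set z := g _ x - _; rewrite -(ler_pM2l p0) mulrDr pq.
  rewrite -(real_normK (num_real z)) mulrA -expr2 -exprMn.
  have := sqr_ge0 (2 ^+ j * `|z| - 2^-1); lra.
rewrite big_split /= lerD//.
  have := @geometric_le_lim R n 1 2^-1 ler01.
  rewrite /series /=; under eq_bigr do rewrite mul1r; move=> /(_ _ _)/le_trans; apply.
  - lra.
  - by rewrite ger0_norm; lra.
  - by rewrite ler_pdivrMr; lra.
rewrite -lee_fin fineK// -sumEFin.
by apply: (@nneseries_lim_ge _ (fun j => s j x) xpredT 0%N n) => j _ _.
Qed.

End ae_convergence.

(** * The space L^2 *)

Section L2_space.
Context {R : realType} {n : nat} (Om : set 'rV[R]_n) (mOm : measurable Om).
Local Notation mu := (lebesgue_rV n : {measure set 'rV[R]_n -> \bar R}).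
Implicit Types f g : 'rV[R]_n -> R.

Lemma inL2_integrable f g : inL2 Om f -> inL2 Om g ->
  mu.-integrable Om (EFin \o (fun x => f x * g x)).
Proof.
move=> [mf if2] [mg ig2].
apply: (le_integrable mOm _ _ (integrableD mOm if2 ig2)).
  by apply/measurable_EFinP; exact: measurable_funM.
move=> x _ /=; rewrite lee_fin [leRHS]ger0_norm ?addr_ge0 ?sqr_ge0//.
rewrite normrM -(real_normK (num_real (f x))) -(real_normK (num_real (g x))).
by have := normr_ge0 (f x); have := normr_ge0 (g x); nra.
Qed.

Lemma inL2_closed a f g : inL2 Om f -> inL2 Om g ->
  inL2 Om (fun x => a * f x + g x).
Proof.
move=> f2 g2; have [mf if2] := f2; have [mg ig2] := g2.
have mafg : measurable_fun Om (fun x => a * f x + g x).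
  by apply: measurable_funD => //; exact: measurable_funM.
split => //.
have ifg := inL2_integrable f2 g2.
have := integrableD mOm (integrableD mOm (integrableZl mOm (a ^+ 2) if2)
  (integrableZl mOm (2 * a) ifg)) ig2.
apply: eq_integrable => // x _ /=; rewrite -!EFinM -!EFinD; congr EFin; ring.
Qed.

Lemma inL2_semi_inner : semi_inner (inL2 Om) (inner Om).
Proof.
split.
- exact: inL2_closed.
- by move=> f g _ _; apply: eq_Rintegral => x _; rewrite mulrC.
- move=> a f g h f2 g2 h2; rewrite /inner.
  under eq_Rintegral do rewrite mulrDl -mulrA.
  rewrite RintegralD//; last exact: inL2_integrable.
    by rewrite RintegralZl//; exact: inL2_integrable.
  have := integrableZl mOm a (inL2_integrable f2 h2).
  by apply: eq_integrable => // x _ /=; rewrite -EFinM.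
- by move=> f f2; apply: Rintegral_ge0 => x _; exact: sqr_ge0.
Qed.

Lemma inL2_inner_EFin f : inL2 Om f ->
  (\int[mu]_(x in Om) (f x ^+ 2)%:E)%E = (inner Om f f)%:E.
Proof.
by move=> [mf if2]; rewrite /inner /Rintegral fineK ?integrable_fin_num.
Qed.

Lemma inL2_le f c : measurable_fun Om f ->
  (\int[mu]_(x in Om) (f x ^+ 2)%:E <= c%:E)%E ->
  inL2 Om f /\ inner Om f f <= c.
Proof.
move=> mf fc; have f2 : inL2 Om f.
  split => //; apply/integrableP; split.
    by apply/measurable_EFinP; exact: measurable_funX.
  under eq_integral do rewrite /= ger0_norm ?sqr_ge0//.
  by rewrite (le_lt_trans fc)// ltry.
by split => //; rewrite -lee_fin -inL2_inner_EFin.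
Qed.

Lemma eq_inner_ae f f' g : ae_eq mu Om f f' -> inner Om f g = inner Om f' g.
Proof.
move=> ff; congr fine; apply: ae_eq_integral_nonmeasurable.
by move: ff; apply: filterS => x /[apply] ->.
Qed.

Lemma eq_L2norm_ae f f' : ae_eq mu Om f f' -> L2norm Om f = L2norm Om f'.
Proof.
move=> ff; congr Num.sqrt; congr fine; apply: ae_eq_integral_nonmeasurable.
by move: ff; apply: filterS => x /[apply] ->.
Qed.

Lemma inner_eq0_ae f : inL2 Om f -> inner Om f f = 0 -> ae_eq mu Om f (cst 0).
Proof.
move=> f2 f0; have [mf if2] := f2.
have mf2 : measurable_fun Om (fun x => (f x ^+ 2)%:E).
  by apply/measurable_EFinP; exact: measurable_funX.
have [+ _] := ae_eq_integral_abs mu mOm mf2.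
under eq_integral do rewrite gee0_abs ?lee_fin ?sqr_ge0//.
rewrite inL2_inner_EFin// f0 => /(_ erefl).
apply: filterS => x /[apply] /= /eqP; rewrite eqe sqrf_eq0 => /eqP.
by [].
Qed.

(** Riesz-Fischer: a rapidly Cauchy subsequence converges almost everywhere, Fatou's lemma turns
    this into L^2 convergence with a rate, and the Cauchy property carries it over to the full
    sequence. *)
Lemma L2_complete (f_ : nat -> 'rV[R]_n -> R) : (forall k, inL2 Om (f_ k)) ->
  (forall eps, 0 < eps ->
    exists N, forall j k, (N <= j)%N -> (N <= k)%N ->
      inner Om (f_ j \- f_ k) (f_ j \- f_ k) <= eps) ->
  exists w, inL2 Om w /\ L2norm Om (w \- f_ k) @[k --> \oo] --> (0 : R).
Proof.
move=> f2 fC; have LS := inL2_semi_inner.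
have e0 j : 0 < 4^-1 ^+ j :> R by rewrite exprn_gt0.
have [phi phiP] := choice (fun j => fC _ (e0 j)).
(* The maximum makes [psi] strictly increasing, hence [psi j >= j], while keeping it beyond the
   index [phi j] that guarantees distance 4^-j. *)
pose psi := fix psi j := if j is j'.+1 then maxn (psi j').+1 (phi j) else phi 0%N.
have phipsi j : (phi j <= psi j)%N by case: j => //= j; rewrite leq_maxr.
have psind i j : (i <= j)%N -> (psi i <= psi j)%N.
  elim: j => [|j IH]; first by rewrite leqn0 => /eqP ->.
  rewrite leq_eqVlt => /orP[/eqP -> //|]; rewrite ltnS => /IH /leq_trans; apply.
  by rewrite /= leq_max leqnSn.
have jpsi j : (j <= psi j)%N.
  by elim: j => // j IH; rewrite /= leq_max ltnS IH.
pose g j := f_ (psi j).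
have g2 j : inL2 Om (g j) by exact: f2.
have gC j k : (j <= k)%N -> inner Om (g k \- g j) (g k \- g j) <= 4^-1 ^+ j.
  move=> jk; apply: phiP; last exact: phipsi.
  by rewrite (leq_trans (phipsi j))// psind.
have mg k : measurable_fun Om (g k) by have [] := g2 k.
have gcv : {ae mu, forall x, Om x -> cvgn (g ^~ x)}.
  apply: (ae_cvg_fast mOm mg) => j.
  rewrite (inL2_inner_EFin (semi_inner_subV LS (g2 j.+1) (g2 j))) lee_fin.
  exact: gC.
have glim : {ae mu, forall x, Om x -> g k x @[k --> \oo] --> limn (g ^~ x)}.
  by move: gcv; apply: filterS => x /[apply].
have [w mw wlim] := ae_cvg_measurable mg glim.
have gw : {ae mu, forall x, Om x -> g k x @[k --> \oo] --> w x}.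
  by apply: filterS2 glim wlim => x gx wx Dx; rewrite -wx//; exact: gx.
have wg j : inL2 Om (w \- g j) /\ inner Om (w \- g j) (w \- g j) <= 4^-1 ^+ j.
  apply: inL2_le; first exact: measurable_funB.
  pose h k x := ((g k x - g j x) ^+ 2)%:E : \bar R.
  have mh k : measurable_fun Om (h k).
    by apply/measurable_EFinP; apply: measurable_funX; exact: measurable_funB.
  have h0 k x : Om x -> (0 <= h k x)%E by rewrite lee_fin sqr_ge0.
  rewrite (_ : integral _ _ _ = \int[mu]_(x in Om) limn_einf (h ^~ x))%E; last first.
    apply: ae_eq_integral_nonmeasurable; move: gw; apply: filterS => x gx Dx.
    have : h ^~ x @ \oo --> ((w x - g j x) ^+ 2)%:E.
      apply: cvg_EFin; first exact: nearW.
      rewrite expr2 (_ : fine \o _ = fun k => (g k x - g j x) * (g k x - g j x)).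
        by apply: cvgM; apply: cvgB => //; (exact: gx || exact: cvg_cst).
      by apply/funext => k; rewrite /= expr2.
    by move=> /[dup] /cvg_lim hl /cvgP /is_cvg_limn_einfE ->; rewrite hl.
  apply: (le_trans (fatou mu mOm mh h0)).
  rewrite limn_einf_lim; apply: lime_le; first exact: is_cvg_einfs.
  near=> k; apply: (@le_trans _ _ (\int[mu]_(x in Om) h k x)%E).
    by apply: ereal_inf_lbound; exists k => /=.
  rewrite (inL2_inner_EFin (semi_inner_subV LS (g2 k) (g2 j))) lee_fin gC//.
  by near: k; exact: nbhs_infty_ge.
have w2 : inL2 Om w.
  have [w0 _] := wg 0%N; have := inL2_closed 1 w0 (g2 0%N).
  rewrite (_ : (fun x => _) = w)//; apply/funext => x /=; ring.
exists w; split => //; apply/cvgrPdist_le => eps eps0.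
have e20 : 0 < (eps / 2) ^+ 2 by rewrite exprn_gt0// divr_gt0.
have [N NP] := fC _ e20.
have [j [Nj je]] : exists j, (N <= psi j)%N /\ 4^-1 ^+ j <= (eps / 2) ^+ 2.
  have : 4^-1 ^+ j @[j --> \oo] --> (0 : R).
    have := @cvg_geometric R 1 4^-1; rewrite /geometric /=.
    by under eq_fun do rewrite mul1r; apply; rewrite ger0_norm; lra.
  move=> /cvgrPdist_le/(_ _ e20)[j0 _ jP]; exists (maxn N j0); split.
    by rewrite (leq_trans _ (jpsi _))// leq_maxl.
  have := jP (maxn N j0) (leq_maxr _ _).
  by rewrite sub0r normrN ger0_norm// exprn_ge0.
near=> k; rewrite sub0r normrN ger0_norm ?sqrtr_ge0//.
have Nk : (N <= k)%N by near: k; exact: nbhs_infty_ge.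
have V1 : inL2 Om (w \- f_ k) by exact: (semi_inner_subV LS).
have [V2 W2] := wg j.
have := semi_norm_triangle LS V1 V2; move=> /le_trans; apply.
rewrite (_ : eps = eps / 2 + eps / 2); last by field.
have sq2 c : 0 <= c -> c <= (eps / 2) ^+ 2 -> Num.sqrt c <= eps / 2.
  move=> c0 ce; rewrite (_ : eps / 2 = Num.sqrt ((eps / 2) ^+ 2)).
    exact: ler_wsqrtr.
  by rewrite sqrtr_sqr ger0_norm// divr_ge0// ltW.
rewrite lerD// sq2//.
- exact: (semi_inner_ge0 LS).
- exact: le_trans W2 je.
- by apply: (semi_inner_ge0 LS); exact: (semi_inner_subV LS).
- rewrite (_ : _ \- _ \- _ = g j \- f_ k); last by apply/funext => x /=; ring.
  exact: NP.
Unshelve. all: by end_near. Qed.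
End L2_space.

(** * Borel sets and boxes in R^n *)

Section lebesgue_rV_theory.
Context {R : realType}.

Lemma measurable_box n (c : 'rV[R]_n) (r : R) :
  measurable [set x : 'rV[R]_n | forall i, `|x ord0 i - c ord0 i| < r].
Proof.
rewrite (_ : [set _ | _] = \bigcap_(i in [set: 'I_n])
    ((fun x : 'rV[R]_n => x ord0 i) @^-1` `]c ord0 i - r, c ord0 i + r[)).
  apply: fin_bigcap_measurable => // i _.
  by rewrite -[X in measurable X]setTI; exact: measurable_coord.
by apply/seteqP; split => x /= H i; have := H i; rewrite /= in_itv /= => h;
  rewrite ?ltr_distl; [rewrite -ltr_distl| rewrite h].
Qed.

(** The sigma-algebra is generated by coordinates, so an open set is exhibited as a countable union
    of boxes with rational centres and radii 1/(m+1). A point whose ball of radius e lies in [U] is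
    caught by a box with 1/(m+1) < e/2. *)
Lemma open_measurable_rV n (U : set 'rV[R]_n) : open U -> measurable U.
Proof.
move=> oU.
pose box (qm : 'rV[rat]_n * nat) : set 'rV[R]_n :=
  [set x | forall i, `|x ord0 i - (map_mx ratr qm.1 : 'rV[R]_n) ord0 i| < qm.2.+1%:R^-1].
pose F k := if unpickle k is Some qm then
  (if asbool (box qm `<=` U) then box qm else set0) else set0.
have -> : U = \bigcup_k F k.
  apply/seteqP; split => [x Ux|x [k _]]; last first.
    by rewrite /F; case: (unpickle k) => // qm; case: asboolP => // qmU; exact: qmU.
  have /nbhs_ballP[e /= e0 eU] : nbhs x U by apply: open_nbhs_nbhs.
  have [m me] : exists m : nat, m.+1%:R^-1 < e / 2.
    have e2 : 0 < e / 2 by rewrite divr_gt0.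
    by have /cvgrPdist_lt/(_ _ e2)[m _ /(_ m (leqnn m))] := @cvg_harmonic R;
      rewrite sub0r normrN ger0_norm ?invr_ge0// => ?; exists m.
  have m0 : 0 < m.+1%:R^-1 :> R by rewrite invr_gt0.
  have /choice[q qx] : forall i, exists q : rat, `|x ord0 i - ratr q| < m.+1%:R^-1.
    move=> i; have [|q] := @rat_in_itvoo R (x ord0 i) (x ord0 i + m.+1%:R^-1).
      by rewrite ltrDl.
    rewrite in_itv /= => /andP[q1 q2]; exists q.
    by rewrite ltr_distlC q2 andbT ltrBlDr (lt_trans q1)// ltrDl.
  exists (pickle (\row_i q i, m)) => //; rewrite /F pickleK.
  have xbox : box (\row_i q i, m) x by move=> i; rewrite !mxE.
  case: asboolP => // -[] y ybox; apply: eU; split => // i j; rewrite (ord1 i) /ball /=.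
  have := xbox j; have := ybox j; rewrite !mxE /= => h1 h2.
  rewrite (_ : x ord0 j - y ord0 j = (x ord0 j - ratr (q j)) - (y ord0 j - ratr (q j))); last by ring.
  by rewrite (le_lt_trans (ler_normB _ _))// (splitr e) ltrD// (lt_trans _ me).
apply: bigcupT_measurable => k; rewrite /F; case: (unpickle k) => // qm.
by case: asboolP => // _; exact: measurable_box.
Qed.

Lemma continuous_measurable_rV n (f : 'rV[R]_n -> R) :
  continuous f -> measurable_fun setT f.
Proof.
move=> /continuousP cf; apply: (measurability _ (RGenOpens.measurableE R)).
move=> _ [_ [a [b ->] <-]]; rewrite setTI; apply: open_measurable_rV.
exact/cf/interval_open.
Qed.

Lemma cons_rVl n (y : R) (v : 'rV[R]_n) (j : 'I_1) :
  cons_rV (y, v) ord0 (lshift n j) = y.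
Proof.
by apply: etrans (row_mxEl _ _ _ _) _; rewrite mxE (ord1 j) eqxx mulr1n.
Qed.

Lemma cons_rVr n (y : R) (v : 'rV[R]_n) (j : 'I_n) :
  cons_rV (y, v) ord0 (rshift 1 j) = v ord0 j.
Proof. exact: row_mxEr. Qed.

Lemma measurable_closed_box n (M : R) :
  measurable [set x : 'rV[R]_n | forall i, `|x ord0 i| <= M].
Proof.
rewrite (_ : [set _ | _] = \bigcap_(i in [set: 'I_n])
    ((fun x : 'rV[R]_n => x ord0 i) @^-1` `[- M, M])).
  apply: fin_bigcap_measurable => // i _.
  by rewrite -[X in measurable X]setTI; exact: measurable_coord.
apply/seteqP; split => x /= H i; have := H i; rewrite /= in_itv /= ler_norml//.
by move=> /(_ Logic.I).
Qed.

Lemma lebesgue_rV_box n (M : R) :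
  (lebesgue_rV n [set x : 'rV[R]_n | forall i, (`|x ord0 i| <= M)%R] < +oo)%E.
Proof.
elim: n => [|n IH] /=; first by rewrite diracE ltry.
rewrite /lebesgue_cons /pushforward.
set A := [set x | _]; set A' := [set x | _] in IH.
rewrite (_ : _ @^-1` A = `[- M, M]%classic `*` A'); last first.
  apply/seteqP; split => -[y v] /=.
    move=> H; split.
      by have := H (@lshift 1 n ord0); rewrite cons_rVl in_itv /= ler_norml.
    by move=> i; have := H (rshift 1 i); rewrite cons_rVr.
  move=> [yM vM] i; case: (split_ordP (i : 'I_(1 + n))) => j ->.
    by rewrite cons_rVl ler_norml; move: yM; rewrite in_itv.
  by rewrite cons_rVr; exact: vM.
have mA' : measurable A' by exact: measurable_closed_box.
rewrite product_measure1E//= lte_mul_pinfty//.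
  by rewrite ge0_fin_numE// lebesgue_measure_itv /=; case: ifP => _; rewrite ?ltry// -EFinB ltry.
Qed.

End lebesgue_rV_theory.

(** * Integration by parts for test functions *)

Section partial_integration.
Context {R : realType}.
Local Notation leb := (@lebesgue_measure R).

Lemma continuous_cons_rVr n (y : R) : continuous (fun v : 'rV[R]_n => cons_rV (y, v)).
Proof.
move=> v; apply/(@cvg_ballP R _ _ _ (nbhs_filter v)) => eps eps0.
apply/nbhs_ballP; exists eps => // w [_ vw]; split => // i j; rewrite (ord1 i).
case: (split_ordP (j : 'I_(1 + n))) => k ->.
  by rewrite !cons_rVl; exact: ballxx.
by rewrite !cons_rVr; exact: vw.
Qed.

Lemma continuous_cons_rVl n (v : 'rV[R]_n) : continuous (fun y : R => cons_rV (y, v)).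
Proof.
move=> y; apply/(@cvg_ballP R _ _ _ (nbhs_filter y)) => eps eps0.
apply/nbhs_ballP; exists eps => // w vw; split => // i j; rewrite (ord1 i).
case: (split_ordP (j : 'I_(1 + n))) => k ->.
  by rewrite !cons_rVl; exact: vw.
by rewrite !cons_rVr; exact: ballxx.
Qed.

Lemma shift_rVE n (h : R) (w : 'rV[R]_n) (k l : 'I_n) :
  (h *: delta_mx ord0 k + w) ord0 l = h * (l == k)%:R + w ord0 l.
Proof. by rewrite !mxE eqxx. Qed.

Lemma shift_cons_rVr n (y h : R) (v : 'rV[R]_n) (j : 'I_n) :
  h *: delta_mx ord0 (rshift 1 j : 'I_n.+1) + cons_rV (y, v) =
  cons_rV (y, h *: delta_mx ord0 j + v).
Proof.
apply/rowP => k; rewrite shift_rVE.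
case: (split_ordP (k : 'I_(1 + n))) => l ->.
  rewrite !cons_rVl (_ : (_ == _) = false) ?mulr0 ?add0r//.
  by apply/negbTE/eqP => /(congr1 val) /=; case: l => [[]].
apply/esym; apply: etrans (cons_rVr _ _ _) _; rewrite shift_rVE.
have -> : (rshift 1 l == rshift 1 j) = (l == j) by exact: inj_eq (@rshift_inj 1 n) _ _.
by congr (_ + _); apply/esym; exact: cons_rVr.
Qed.

Lemma shift_cons_rVl n (y h : R) (v : 'rV[R]_n) :
  h *: delta_mx ord0 (@lshift 1 n ord0 : 'I_n.+1) + cons_rV (y, v) =
  cons_rV (h + y, v).
Proof.
apply/rowP => k; rewrite shift_rVE.
case: (split_ordP (k : 'I_(1 + n))) => l ->.
  by rewrite !cons_rVl (ord1 l) eqxx mulr1.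
rewrite (_ : (_ == _) = false) ?mulr0 ?add0r.
  by apply: etrans (cons_rVr _ _ _) _; apply/esym; exact: cons_rVr.
by apply/negbTE/eqP => /(congr1 val) /=.
Qed.

Lemma derivable_cons_rVr n (G : 'rV[R]_n.+1 -> R) y v (j : 'I_n) :
  derivable G (cons_rV (y, v)) (delta_mx ord0 (rshift 1 j)) ->
  derivable (fun v => G (cons_rV (y, v))) v (delta_mx ord0 j) /\
  'D_(delta_mx ord0 j) (fun v => G (cons_rV (y, v))) v =
  'D_(delta_mx ord0 (rshift 1 j)) G (cons_rV (y, v)).
Proof.
rewrite /derivable /derive.
set f := fun h => _; set g := fun h => _.
suff -> : f = g by [].
by apply/funext => h; rewrite /f /g /= shift_cons_rVr.
Qed.

Lemma derivable_cons_rVl n (G : 'rV[R]_n.+1 -> R) y v :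
  derivable G (cons_rV (y, v)) (delta_mx ord0 (@lshift 1 n ord0)) ->
  derivable (fun y => G (cons_rV (y, v))) y 1 /\
  'D_1 (fun y => G (cons_rV (y, v))) y =
  'D_(delta_mx ord0 (@lshift 1 n ord0)) G (cons_rV (y, v)).
Proof.
rewrite /derivable /derive.
set f := fun h => _; set g := fun h => _.
suff -> : f = g by [].
by apply/funext => h; rewrite /f /g /= shift_cons_rVl [h%:A]mulr1.
Qed.

Lemma bounded_support_integrable n (G : 'rV[R]_n -> R) (M C : R) :
  measurable_fun setT G -> (forall x, `|G x| <= C) ->
  (forall (x : 'rV[R]_n) j, M < `|x ord0 j| -> G x = 0) ->
  (lebesgue_rV n).-integrable setT (EFin \o G).
Proof.
move=> mG GC G0; apply/integrableP; split; first exact/measurable_EFinP.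
set B := [set x : 'rV[R]_n | forall i, `|x ord0 i| <= M].
have mB : measurable B by exact: measurable_closed_box.
apply: (@le_lt_trans _ _ (\int[lebesgue_rV n]_x (C%:E * (\1_B x)%:E))%E).
  apply: ae_le_integral_ge0 => //.
    by move=> x _; rewrite -EFinM lee_fin mulr_ge0// (le_trans _ (GC x)).
  apply: aeW => x _; rewrite -EFinM lee_fin indicE.
  have [xB|xB] := boolP (x \in B); first by rewrite mulr1.
  rewrite mulr0 /=; suff -> : G x = 0 by rewrite normr0.
  move: xB; rewrite notin_setE /B /= => /existsNP[j /negP]; rewrite -ltNge.
  exact: G0.
rewrite integralZl//.
  by rewrite integral_indic// setIT lte_mul_pinfty//; [rewrite lee_fin; exact: le_trans (GC 0)|exact: lebesgue_rV_box].
apply/integrableP; split; first by apply/measurable_EFinP; exact: measurable_indic.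
under eq_integral do rewrite gee0_abs ?lee_fin//.
by rewrite integral_indic// setIT; exact: lebesgue_rV_box.
Qed.

Lemma ge0_integral_lebesgue_cons n (f : 'rV[R]_n.+1 -> \bar R) :
  measurable_fun setT f -> (forall x, 0 <= f x)%E ->
  (\int[lebesgue_rV n.+1]_x f x =
   \int[leb \x lebesgue_rV n]_z f (cons_rV z))%E.
Proof.
move=> mf f0.
transitivity (\int[pushforward (leb \x lebesgue_rV n) (@cons_rV R n)]_x f x)%E => //.
have mc : measurable_fun [set: measurableTypeR R * 'rV[R]_n] (@cons_rV R n).
  exact: measurable_cons_rV.
by rewrite (ge0_integral_pushforward mc).
Qed.

Lemma integral_lebesgue_cons n (f : 'rV[R]_n.+1 -> \bar R) :
  measurable_fun setT f ->
  (leb \x lebesgue_rV n)%E.-integrable setT (f \o @cons_rV R n) ->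
  (\int[lebesgue_rV n.+1]_x f x =
   \int[leb \x lebesgue_rV n]_z f (cons_rV z))%E.
Proof.
move=> mf intf.
transitivity (\int[pushforward (leb \x lebesgue_rV n) (@cons_rV R n)]_x f x)%E => //.
have mc : measurable_fun [set: measurableTypeR R * 'rV[R]_n] (@cons_rV R n).
  exact: measurable_cons_rV.
by rewrite (integral_pushforward mc).
Qed.

(** Induction on the dimension with Fubini. In the first coordinate the inner integral is a
    difference of boundary values beyond [M], hence 0; for another coordinate the first one is
    frozen and the induction hypothesis applies, the bounds [M] and [C] being inherited by
    slices. *)
Lemma integral_partial n (G : 'rV[R]_n -> R) (i : 'I_n) (M C : R) :
  (forall x, derivable G x (delta_mx ord0 i)) ->
  continuous (fun x => 'D_(delta_mx ord0 i) G x) ->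
  (forall x, `|'D_(delta_mx ord0 i) G x| <= C) ->
  (forall (x : 'rV[R]_n) j, M < `|x ord0 j| -> G x = 0 /\ 'D_(delta_mx ord0 i) G x = 0) ->
  (\int[lebesgue_rV n]_x ('D_(delta_mx ord0 i) G x)%:E = 0)%E.
Proof.
elim: n G i => [|n IH] G i; first by case: i.
move=> dG cG GC G0; pose f (x : 'rV[R]_n.+1) : \bar R := ('D_(delta_mx ord0 i) G x)%:E.
rewrite -/(integral _ _ f).
have mDG := continuous_measurable_rV cG.
have mf : measurable_fun setT f by exact/measurable_EFinP.
have intf : (lebesgue_rV n.+1).-integrable setT f.
  by apply: (bounded_support_integrable mDG GC) => x j /G0 [].
have intfc : (leb \x lebesgue_rV n)%E.-integrable setT (f \o @cons_rV R n).
  apply/integrableP; split; first by apply: (measurableT_comp mf); exact: measurable_cons_rV.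
  have /integrableP[_] := intf; apply: le_lt_trans.
  by rewrite ge0_integral_lebesgue_cons//; exact: measurableT_comp.
transitivity (\int[leb \x lebesgue_rV n]_z (f \o @cons_rV R n) z)%E.
  exact: integral_lebesgue_cons.
case: (split_ordP (i : 'I_(1 + n))) => j ij.
  have {j}ij : i = @lshift 1 n ord0 by rewrite ij (ord1 j).
  subst i.
  rewrite -integral21_prod_meas1//=; apply: integral0_eq => v _.
  rewrite /fubini_G /f /=.
  pose b : R := `|M| + 1; have Mb : M < b by rewrite (le_lt_trans (ler_norm M))// ltrDl.
  have b0 : 0 < b by rewrite ltr_wpDl.
  have out y : b <= `|y| -> G (cons_rV (y, v)) = 0 /\
      'D_(delta_mx ord0 (@lshift 1 n ord0)) G (cons_rV (y, v)) = 0.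
    move=> yb; apply: (G0 _ (@lshift 1 n ord0)); rewrite cons_rVl.
    exact: lt_le_trans Mb yb.
  have dv y := derivable_cons_rVl (dG (cons_rV (y, v))).
  have ab : - b < b by rewrite gtrN.
  have b_norm : `|b| = b by rewrite ger0_norm// ltW.
  rewrite (_ : integral _ _ _ = \int[leb]_(y in `[(- b)%R, b])
      ('D_(delta_mx ord0 (@lshift 1 n ord0)) G (cons_rV (y, v)))%:E)%E; last first.
    rewrite [RHS]integral_mkcond; apply: eq_integral => y _.
    rewrite /patch; case: ifPn => //; rewrite notin_setE /= in_itv /= -ler_norml.
    by move=> /negP; rewrite -ltNge => /ltW /out[_ ->].
  rewrite (@continuous_FTC2 _ _ (fun y => G (cons_rV (y, v))))//.
  - by rewrite (out b _).1 ?b_norm// (out (- b) _).1 ?normrN ?b_norm// subee.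
  - apply: continuous_subspaceT => y.
    exact: (continuous_comp (@continuous_cons_rVl n v y) (cG _)).
  - have cF y : {for y, continuous (fun y => G (cons_rV (y, v)))}.
      by apply: differentiable_continuous; apply/derivable1_diffP; exact: (dv y).1.
    split.
    + by move=> y _; exact: (dv y).1.
    + by apply: cvg_at_right_filter; exact: cF.
    + by apply: cvg_at_left_filter; exact: cF.
  - by move=> y _; rewrite derive1E; exact: (dv y).2.
subst i; rewrite -integral12_prod_meas1//=; apply: integral0_eq => y _.
rewrite /fubini_F /f /=.
have dv v := derivable_cons_rVr (dG (cons_rV (y, v))).
under eq_integral do rewrite -(dv _).2.
apply: IH.
- by move=> v; exact: (dv v).1.
- under eq_fun do rewrite (dv _).2.
  by move=> v; exact: (continuous_comp (@continuous_cons_rVr n y v) (cG _)).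
- by move=> v; rewrite (dv v).2.
- by move=> v k vk; rewrite (dv v).2; apply: (G0 _ (rshift 1 k)); rewrite cons_rVr.
Qed.
End partial_integration.

(** * Test functions and their classical gradients *)

Section test_functions.
Context {R : realType} {n : nat}.
Implicit Types phi psi : 'rV[R]_n -> R.
Local Notation supp phi := (closure [set x | phi x != 0]).

Lemma compact_support_bounds (K : set 'rV[R]_n) psi : compact K ->
  continuous psi -> (forall x, ~ K x -> psi x = 0) ->
  exists M C : R, (forall (x : 'rV[R]_n) j, M < `|x ord0 j| -> psi x = 0) /\
    forall x, `|psi x| <= C.
Proof.
move=> cK cpsi psi0.
have [M [_ KM]] := compact_bounded cK.
have [C [_ KC]] : bounded_set (psi @` K).
  by apply: compact_bounded; apply: continuous_compact => //; exact: continuous_subspaceT.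
exists (M + 1), (`|C| + 1); split.
  move=> x j Mx; apply: psi0 => Kx.
  have := KM (M + 1); rewrite ltrDl ltr01 => /(_ isT x Kx).
  apply/negP; rewrite -ltNge (lt_le_trans Mx)//.
  rewrite [leRHS]/Num.norm /= mx_normrE; apply/bigmax_geP; right => /=.
  by exists (ord0, j).
move=> x; have [Kx|/psi0 ->] := pselect (K x).
  apply: KC; last by exists x.
  by rewrite (le_lt_trans (ler_norm C))// ltrDl.
by rewrite normr0 addr_ge0.
Qed.

Lemma off_supp phi x : ~ supp phi x -> phi x = 0.
Proof.
by move=> nx; apply/eqP; apply: contra_notT nx => /= px; exact: subset_closure.
Qed.

Lemma off_supp_derive phi v x : ~ supp phi x -> 'D_v phi x = 0.
Proof.
move=> nx; rewrite (@near_eq_derive _ _ _ _ (cst 0)) ?derive_cst//.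
have : open (~` supp phi) by apply: closed_openC; exact: closed_closure.
rewrite openE => /(_ x nx); rewrite /interior; apply: filterS => y ny.
exact: off_supp.
Qed.

Variables (Om : set 'rV[R]_n) (oOm : open Om).
Let mOm := open_measurable_rV oOm.
Local Notation test := (test_function Om).
Local Notation mu := (lebesgue_rV n : {measure set 'rV[R]_n -> \bar R}).
Local Notation dlt i := (delta_mx ord0 i : 'rV[R]_n).

Lemma test_continuous phi : test phi -> continuous phi.
Proof. by move=> [/(_ 0%N)[]]. Qed.

Lemma test_derivable phi i x : test phi -> derivable phi x (dlt i).
Proof. by move=> [/(_ 1%N)[_ /(_ i)[]]]. Qed.

Lemma test_continuous_derive phi i : test phi ->
  continuous (fun x => 'D_(dlt i) phi x).
Proof. by move=> [/(_ 1%N)[_ /(_ i)[_ []]]]. Qed.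

Lemma compact_support_inL2 (K : set 'rV[R]_n) psi : compact K ->
  continuous psi -> (forall x, ~ K x -> psi x = 0) -> inL2 Om psi.
Proof.
move=> cK cpsi psi0; have mpsi := continuous_measurable_rV cpsi.
split; first exact: measurable_funS mpsi.
have [M [C [psiM psiC]]] := compact_support_bounds cK cpsi psi0.
have : mu.-integrable setT (EFin \o (fun x => psi x ^+ 2)).
  apply: (@bounded_support_integrable _ _ _ M (C ^+ 2)).
  - exact: measurable_funX.
  - move=> x; rewrite normrX lerXn2r// nnegrE//.
    exact: le_trans (psiC x).
  - by move=> x j /psiM ->; rewrite expr0n.
by apply: integrableS.
Qed.

Lemma test_inL2 phi : test phi -> inL2 Om phi.
Proof.
move=> tphi; have [_ cphi _] := tphi.
apply: (compact_support_inL2 cphi (test_continuous tphi)) => x.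
exact: off_supp.
Qed.

Lemma test_derive_inL2 phi i : test phi -> inL2 Om (fun x => 'D_(dlt i) phi x).
Proof.
move=> tphi; have [_ cphi _] := tphi.
apply: (compact_support_inL2 cphi (@test_continuous_derive _ i tphi)) => x.
exact: off_supp_derive.
Qed.

(** The derivative of the product of the two test functions has integral 0 over R^n; as [phi] is
    supported in [Om], this is also its integral over [Om]. *)
Lemma test_weak_grad phi : test phi ->
  is_weak_grad Om phi (fun i x => 'D_(dlt i) phi x).
Proof.
move=> tphi; split => [i|i psi tpsi]; first exact: test_derive_inL2.
have ip := inL2_integrable mOm (test_inL2 tphi) (@test_derive_inL2 psi i tpsi).
have iq := inL2_integrable mOm (@test_derive_inL2 phi i tphi) (test_inL2 tpsi).
apply/eqP; rewrite -subr_eq0 opprK /inner -RintegralD//; apply/eqP.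
have [_ cphi sphi] := tphi.
have dM x : 'D_(dlt i) (phi * psi) x =
    phi x * 'D_(dlt i) psi x + 'D_(dlt i) phi x * psi x.
  rewrite deriveM; [|exact: test_derivable|exact: test_derivable].
  by congr (_ + _); rewrite mulrC.
rewrite Rintegral_mkcond.
rewrite (_ : (_ \_ Om) = (fun x => 'D_(dlt i) (phi * psi) x)); last first.
  apply/funext => x; rewrite /patch; case: ifPn => [xO|xO]; first by rewrite dM.
  have nx : ~ supp phi x by move=> /sphi /mem_set; apply/negP.
  by rewrite dM (off_supp nx) (off_supp_derive _ nx) !mul0r addr0.
have cd : continuous (fun x => 'D_(dlt i) (phi * psi) x).
  under eq_fun do rewrite dM; move=> x.
  exact: (cvgD
    (cvgM (test_continuous tphi (x := x)) (@test_continuous_derive psi i tpsi x))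
    (cvgM (@test_continuous_derive phi i tphi x) (test_continuous tpsi (x := x)))).
have d0 x : ~ supp phi x -> 'D_(dlt i) (phi * psi) x = 0.
  by move=> nx; rewrite dM (off_supp nx) (off_supp_derive _ nx) !mul0r addr0.
have [M [_ [phiM _]]] := compact_support_bounds cphi (test_continuous tphi) (@off_supp phi).
have [M' [C [dM' dC]]] := compact_support_bounds cphi cd d0.
rewrite /Rintegral (@integral_partial _ _ _ i (Num.max M M') C)//.
- by move=> x; apply: derivableM; exact: test_derivable.
- move=> x j; rewrite gt_max => /andP[/phiM px /dM' dx]; split => //.
  by rewrite /= /GRing.mul /= px mul0r.
Qed.

Lemma Ck_closed k a phi psi : Ck k phi -> Ck k psi ->
  Ck k (fun x => a * phi x + psi x).
Proof.
elim: k phi psi => [|k IH] phi psi [cphi dphi] [cpsi dpsi].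
  by split => // x; exact: (cvgD (cvgM (cvg_cst a) (cphi x)) (cpsi x)).
split => [x|i].
  exact: (cvgD (cvgM (cvg_cst a) (cphi x)) (cpsi x)).
have [dphi1 dphi2] := dphi i; have [dpsi1 dpsi2] := dpsi i.
have -> : (fun x => a * phi x + psi x) = a \*: phi + psi by [].
have da x : derivable (a \*: phi) x (dlt i) by exact: derivableZ.
split => [x|]; first exact: derivableD.
rewrite (_ : (fun x => _) = (fun x => a * 'D_(dlt i) phi x + 'D_(dlt i) psi x)).
  exact: IH.
by apply/funext => x; rewrite deriveD// deriveZ.
Qed.

Lemma test_closed a phi psi : test phi -> test psi ->
  test (fun x => a * phi x + psi x).
Proof.
move=> [kphi cphi sphi] [kpsi cpsi spsi].
have sub : supp (fun x => a * phi x + psi x) `<=` supp phi `|` supp psi.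
  rewrite -closureU; apply: closureS => x /= apx.
  have [px|px] := eqVneq (phi x) 0; [right|by left].
  by apply: contra apx => /eqP psx; rewrite px psx mulr0 addr0.
split.
- by move=> k; exact: Ck_closed.
- apply: (@subclosed_compact _ _ (supp phi `|` supp psi)) => //.
    exact: closed_closure.
  exact: compactU.
- by apply: subset_trans sub _ => x []; [exact: sphi|exact: spsi].
Qed.

End test_functions.

Lemma cvg_sqr (R : realType) (U : Type) (F : set_system U) {FF : Filter F} (u : U -> R) (l : R) :
  u s @[s --> F] --> l -> u s ^+ 2 @[s --> F] --> l ^+ 2.
Proof. move=> ul; exact: (cvgM ul ul). Qed.

(** * The spaces H^1 and H^1_0 *)

Section sobolev_space.
Context {R : realType} {n : nat} (Om : set 'rV[R]_n) (oOm : open Om).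
Let mOm := open_measurable_rV oOm.
Local Notation mu := (lebesgue_rV n : {measure set 'rV[R]_n -> \bar R}).
Variables (lam : nat -> R) (e : nat -> 'rV[R]_n -> R).
Hypothesis eigen : dirichlet_eigenpairs Om lam e.
Let LS := inL2_semi_inner mOm.
Implicit Types v w f h : 'rV[R]_n -> R.
Implicit Types g : 'I_n -> 'rV[R]_n -> R.

Lemma eigenfunction_L2 k : inL2 Om (e k).
Proof. by have [[]] := eigenfunction_H10 eigen k. Qed.

Lemma L2norm_le_H1norm v : L2norm Om v <= H1norm Om v.
Proof.
rewrite -[leLHS]ger0_norm ?sqrtr_ge0// -sqrtr_sqr ler_wsqrtr// lerDl.
exact: sqr_ge0.
Qed.

(* The eigenfunctions are limits of test functions and span L^2, so test
   functions are dense in L^2. *)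
Lemma test_function_dense h f : inL2 Om h -> inL2 Om f ->
  (forall phi, test_function Om phi -> inner Om h phi = 0) -> inner Om h f = 0.
Proof.
move=> h2 f2 hphi.
have he k : inner Om h (e k) = 0.
  have [_ [phi [tphi cphi]]] := eigenfunction_H10 eigen k.
  have phi2 j : inL2 Om (phi j) by exact: test_inL2.
  have e2 := eigenfunction_L2 k.
  have c0 : L2norm Om (phi j \- e k) @[j --> \oo] --> (0 : R).
    apply: squeeze_cvgr cphi; last exact: (@cvg_cst R 0).
    apply: nearW => j; rewrite sqrtr_ge0 /=.
    by rewrite [leLHS](semi_normBC LS (phi2 j) e2) L2norm_le_H1norm.
  have hc : L2norm Om (h \- h) @[_ --> \oo] --> (0 : R).
    rewrite /L2norm (_ : inner _ _ _ = 0) ?sqrtr0; first exact: cvg_cst.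
    by rewrite (semi_innerBl LS) ?subrr//; exact: (semi_inner_subV LS).
  have : inner Om h (phi j) @[j --> \oo] --> inner Om h (e k).
    by apply: (semi_inner_cvg LS) => //; exact: nearW.
  under eq_fun do rewrite hphi//.
  by move/cvg_lim => <- //; rewrite lim_cst.
have := eigenfunction_basis eigen h2.
(* All coefficients of [h] vanish, so its expansion error is [h] itself for every N, and the norm of
   [h] is the limit 0. *)
rewrite (_ : (fun N : nat => _) = (fun=> L2norm Om h)); last first.
  apply/funext => N; congr L2norm; apply/funext => x.
  by rewrite big1 ?subr0// => k _; rewrite he mul0r.
move/cvg_lim; rewrite lim_cst// => /(_ (@Rhausdorff R)) h0.
apply/eqP; rewrite -normr_le0 (le_trans (semi_inner_CS LS h2 f2))//.
by move: h0; rewrite /L2norm => ->; rewrite mul0r.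
Qed.

Lemma weak_gradP v : inH1 Om v -> is_weak_grad Om v (grad Om v).
Proof. by move=> [_ [g gv]]; exact: (getI gv). Qed.

Lemma inH1_L2 v : inH1 Om v -> inL2 Om v. Proof. by case. Qed.

Lemma grad_L2 v i : inH1 Om v -> inL2 Om (grad Om v i).
Proof. by move=> /weak_gradP[]. Qed.

(** The difference of two weak gradients is orthogonal to all test functions, hence to L^2.
    Uniqueness in this tested form suffices to compute with the representative chosen by [grad]. *)
Lemma weak_grad_unique v g g' i f : is_weak_grad Om v g ->
  is_weak_grad Om v g' -> inL2 Om f -> inner Om (g i) f = inner Om (g' i) f.
Proof.
move=> [g2 gv] [g'2 g'v] f2; apply/eqP; rewrite -subr_eq0 -(semi_innerBl LS)//.
apply/eqP; apply: test_function_dense => //; first exact: (semi_inner_subV LS).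
move=> phi tphi; have phi2 := test_inL2 oOm tphi.
rewrite (semi_innerBl LS)//; apply/eqP; rewrite subr_eq0 -eqr_opp.
by rewrite -gv// -g'v.
Qed.

Lemma weak_grad_closed a v w g g' : inL2 Om v -> inL2 Om w ->
  is_weak_grad Om v g -> is_weak_grad Om w g' ->
  is_weak_grad Om (fun x => a * v x + w x) (fun i x => a * g i x + g' i x).
Proof.
move=> v2 w2 [g2 gv] [h2 hw]; split=> [i|i phi tphi].
  exact: (semi_inner_closed LS).
have dphi2 := @test_derive_inL2 _ _ _ oOm phi i tphi.
rewrite !(semi_innerDl LS)//; last exact: test_inL2.
by rewrite gv// hw// mulrN opprD.
Qed.

Lemma inH1_closed a v w : inH1 Om v -> inH1 Om w ->
  inH1 Om (fun x => a * v x + w x).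
Proof.
move=> v1 w1; split.
  by apply: (semi_inner_closed LS); exact: inH1_L2.
exists (fun i x => a * grad Om v i x + grad Om w i x).
by apply: weak_grad_closed; (exact: inH1_L2 || exact: weak_gradP).
Qed.

Lemma inner_grad_closed a v w i f : inH1 Om v -> inH1 Om w -> inL2 Om f ->
  inner Om (grad Om (fun x => a * v x + w x) i) f =
  a * inner Om (grad Om v i) f + inner Om (grad Om w i) f.
Proof.
move=> v1 w1 f2.
rewrite (@weak_grad_unique _ _ (fun i x => a * grad Om v i x + grad Om w i x) i f
  (weak_gradP (inH1_closed a v1 w1)))//.
  by rewrite (semi_innerDl LS)//; exact: grad_L2.
by apply: weak_grad_closed; (exact: inH1_L2 || exact: weak_gradP).
Qed.

Lemma grad_semi_inner : semi_inner (inH1 Om) (grad_inner Om).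
Proof.
split.
- exact: inH1_closed.
- move=> v w v1 w1; apply: eq_bigr => i _.
  by rewrite (semi_innerC LS)//; exact: grad_L2.
- move=> a v w f v1 w1 f1; rewrite mulr_sumr -big_split /=; apply: eq_bigr => i _.
  by rewrite inner_grad_closed//; exact: grad_L2.
- by move=> v v1; apply: sumr_ge0 => i _; apply: (semi_inner_ge0 LS); exact: grad_L2.
Qed.

Definition H1inner v w := inner Om v w + grad_inner Om v w.

Lemma H1_semi_inner : semi_inner (inH1 Om) H1inner.
Proof.
have GS := grad_semi_inner; split.
- exact: inH1_closed.
- move=> v w v1 w1; rewrite /H1inner (semi_innerC GS v1 w1).
  by rewrite (semi_innerC LS (inH1_L2 v1) (inH1_L2 w1)).
- move=> a v w f v1 w1 f1; rewrite /H1inner (semi_innerDl GS)//.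
  rewrite (semi_innerDl LS a (inH1_L2 v1) (inH1_L2 w1) (inH1_L2 f1)).
  by rewrite mulrDr addrACA.
- move=> v v1; rewrite addr_ge0//; first exact: (semi_inner_ge0 LS (inH1_L2 v1)).
  exact: (semi_inner_ge0 GS).
Qed.

Lemma H1normE v : inH1 Om v -> H1norm Om v = Num.sqrt (H1inner v v).
Proof.
move=> v1; rewrite /H1norm [L2norm _ _ ^+ 2](semi_norm_sqr LS (inH1_L2 v1)).
by rewrite [grad_norm _ _ ^+ 2](semi_norm_sqr grad_semi_inner v1).
Qed.

Lemma test_inH1 phi : test_function Om phi -> inH1 Om phi.
Proof.
move=> tphi; split; first exact: test_inL2.
by eexists; exact: test_weak_grad.
Qed.

Lemma inH10_closed a v w : inH10 Om v -> inH10 Om w ->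
  inH10 Om (fun x => a * v x + w x).
Proof.
move=> [v1 [phi [tphi cphi]]] [w1 [psi [tpsi cpsi]]].
split; first exact: inH1_closed.
exists (fun k x => a * phi k x + psi k x); split.
  by move=> k; exact: test_closed.
have HS := H1_semi_inner.
have vk k : inH1 Om (v \- phi k).
  by apply: (semi_inner_subV HS) => //; exact: test_inH1.
have wk k : inH1 Om (w \- psi k).
  by apply: (semi_inner_subV HS) => //; exact: test_inH1.
apply: (@squeeze_cvgr _ _ _ _ (fun=> 0)
    (fun k => `|a| * H1norm Om (v \- phi k) + H1norm Om (w \- psi k))).
- apply: nearW => k; rewrite sqrtr_ge0 /=.
  rewrite (_ : _ \- _ = fun x => a * (v \- phi k) x + (w \- psi k) x); last first.
    by apply/funext => x /=; ring.
  set f := fun x => _; have f1 : inH1 Om f by exact: inH1_closed.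
  rewrite !H1normE//; have := semi_norm_triangle HS f1 (wk k).
  move=> /le_trans; apply; rewrite addrC lerD2r.
  rewrite (_ : f \- _ = fun x => a * (v \- phi k) x); last first.
    by apply/funext => x; rewrite /f /= addrK.
  by rewrite (semi_innerZZ HS)// sqrtrM ?sqr_ge0// sqrtr_sqr.
- exact: cvg_cst.
- rewrite [X in _ --> X](_ : _ = `|a| * 0 + 0); last by rewrite mulr0 addr0.
  exact: (cvgD (cvgM (cvg_cst `|a|) cphi) cpsi).
Qed.

Lemma inH10_H1 v : inH10 Om v -> inH1 Om v. Proof. by case. Qed.

Lemma H10_semi_inner : semi_inner (inH10 Om) H1inner.
Proof.
have HS := H1_semi_inner; split.
- exact: inH10_closed.
- by move=> v w /inH10_H1 v1 /inH10_H1 w1; exact: (semi_innerC HS).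
- move=> a v w f /inH10_H1 v1 /inH10_H1 w1 /inH10_H1 f1.
  exact: (semi_innerDl HS).
- by move=> v /inH10_H1 v1; exact: (semi_inner_ge0 HS).
Qed.

Lemma eq_grad_ae v w : ae_eq mu Om v w -> grad Om v = grad Om w.
Proof.
move=> vw; rewrite /grad; congr get; apply/seteqP.
by split => g [g2 gv]; split => // i phi tphi; rewrite -gv//;
  [apply/esym|]; exact: eq_inner_ae.
Qed.

Lemma eigenvalue_ge k : lam 0%N <= lam k.
Proof.
by elim: k => // k /le_trans; apply; exact: (eigenvalue_nd eigen).
Qed.

Lemma eigenvalue_pos k : 0 < lam k.
Proof. by rewrite (lt_le_trans (eigenvalue_gt0 eigen) (eigenvalue_ge k)). Qed.

Lemma parseval v : inL2 Om v ->
  (fun N : nat => \sum_(k < N) inner Om v (e k) ^+ 2) @ \oo --> inner Om v v.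
Proof.
move=> v2; have e2 := eigenfunction_L2.
have := eigenfunction_basis eigen v2 => cv.
have : (fun N : nat => L2norm Om (fun x => v x - \sum_(k < N) inner Om v (e k) * e k x)
    ^+ 2) @ \oo --> (0 : R).
  by have := cvg_sqr cv; rewrite expr0n /=; apply; exact: eventually_filter.

rewrite (_ : (fun N : nat => _) = (fun N : nat =>
    inner Om v v - \sum_(k < N) inner Om v (e k) ^+ 2)); last first.
  apply/funext => N; pose c k := inner Om v (e k).
  have cV : inL2 Om (fun x => \sum_(k < N) c k * e k x) by exact: (semi_inner_sumV LS).
  rewrite [LHS](semi_norm_sqr LS (semi_inner_subV LS v2 cV)).
  rewrite (@semi_inner_residual _ _ _ _ LS N c (fun=> 1) e v)//.
  - by congr (_ - _); apply: eq_bigr => k _; rewrite mul1r.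
  - by move=> k; rewrite mul1r /c (semi_innerC LS).
  - by move=> j k; rewrite mul1r (eigenfunction_orthonormal eigen).
move=> c0; rewrite -(subr0 (inner Om v v)).
rewrite (_ : (fun N : nat => \sum_(k < N) _) = (fun N : nat => inner Om v v -
    (inner Om v v - \sum_(k < N) inner Om v (e k) ^+ 2))); last first.
  by apply/funext => N; rewrite subKr.
exact: (cvgB (cvg_cst (inner Om v v)) c0).
Qed.

(** Bessel's inequality for the gradient form: the weak eigenvalue equation, tested with
    eigenfunctions and with [v], shows that the [e k] are orthogonal there with squares [lam k]. *)
Lemma grad_bessel v N : inH10 Om v ->
  \sum_(k < N) lam k * inner Om v (e k) ^+ 2 <= grad_inner Om v v.
Proof.
move=> v0; have v1 := inH10_H1 v0; have v2 := inH1_L2 v1.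
have e0 k : inH10 Om (e k) := eigenfunction_H10 eigen k.
have e1 k : inH1 Om (e k) := inH10_H1 (e0 k).
apply: (@semi_inner_bessel _ _ _ _ grad_semi_inner N (fun k => inner Om v (e k)) lam e v e1 v1).
- move=> k; rewrite (eigenfunctionP eigen k v0) (semi_innerC LS (eigenfunction_L2 k) v2)//.
- move=> j k; rewrite (eigenfunctionP eigen j (e0 k)) (eigenfunction_orthonormal eigen).
  by have [->//|] := eqVneq j k; rewrite !mulr0.
Qed.

(** Parseval on the left, the gradient Bessel inequality on the right, and [lam 0 <= lam k] in
    between. It serves to show that a function of H^1_0 with zero gradient vanishes almost
    everywhere. *)
Lemma poincare v : inH10 Om v -> lam 0%N * inner Om v v <= grad_inner Om v v.
Proof.
move=> v0; have v2 := inH1_L2 (inH10_H1 v0).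
have cv : (fun N : nat => lam 0%N * \sum_(k < N) inner Om v (e k) ^+ 2) @ \oo
    --> lam 0%N * inner Om v v.
  exact: (cvgM (cvg_cst (lam 0%N)) (parseval v2)).
rewrite -(cvg_lim _ cv)//.
apply: limr_le; first by apply/cvg_ex; eexists; exact: cv.
apply: nearW => N; apply: le_trans (grad_bessel N v0).
rewrite [leLHS]mulr_sumr; apply: ler_sum => k _.
by rewrite ler_wpM2r ?sqr_ge0// eigenvalue_ge.
Qed.

End sobolev_space.

(** * Fractional powers of the Dirichlet Laplacian *)

Section fractional_power.
Context {R : realType} {n : nat} (Om : set 'rV[R]_n) (oOm : open Om).
Let mOm := open_measurable_rV oOm.
Variables (lam : nat -> R) (e : nat -> 'rV[R]_n -> R).
Hypothesis eigen : dirichlet_eigenpairs Om lam e.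
Let LS := inL2_semi_inner mOm.
Let e2 := eigenfunction_L2 eigen.
Implicit Types v w f g : 'rV[R]_n -> R.

Lemma inner_series f g : inL2 Om f -> inL2 Om g ->
  (fun N : nat => \sum_(k < N) inner Om f (e k) * inner Om g (e k)) @ \oo
    --> inner Om f g.
Proof.
move=> f2 g2; pose c k := inner Om f (e k).
rewrite (_ : (fun N : nat => _) =
    (fun N : nat => inner Om (fun x => \sum_(k < N) c k * e k x) g)); last first.
  apply/funext => N; rewrite (semi_inner_suml LS)//; apply: eq_bigr => k _.
  by rewrite (semi_innerC LS g2 (e2 k)).
have V N : inL2 Om (fun x => \sum_(k < N) c k * e k x) by exact: (semi_inner_sumV LS).
apply: (semi_inner_cvg LS (nearW _ V) (nearW _ (fun=> g2)) f2 g2).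
  have := eigenfunction_basis eigen f2; rewrite /L2norm => cf.
  under eq_fun do rewrite (semi_normBC LS (V _) f2); exact: cf.
rewrite (_ : (fun _ => _) = fun=> 0); first exact: cvg_cst.
apply/funext => _; rewrite (semi_innerBl LS g2 g2 (semi_inner_subV LS g2 g2)).
by rewrite subrr sqrtr0.
Qed.

Lemma eq_inner_coef f g h : inL2 Om f -> inL2 Om g -> inL2 Om h ->
  (forall k, inner Om f (e k) = inner Om g (e k)) -> inner Om f h = inner Om g h.
Proof.
move=> f2 g2 h2 fg; rewrite -(cvg_lim _ (inner_series f2 h2))//.
rewrite -(cvg_lim _ (inner_series g2 h2))//.
by under eq_fun do under eq_bigr do rewrite fg.
Qed.

Variable s : R.
Local Notation As := (Apow Om lam e s).
Local Notation c v := (fun k => lam k `^ s * inner Om v (e k)).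

Lemma eigenvalue_powRM k (x y : R) :
  (lam k `^ s * x) * (lam k `^ s * y) = lam k `^ (2 * s) * (x * y).
Proof.
rewrite mulrACA -powRD; last by rewrite (gt_eqF (eigenvalue_pos eigen k)) implybT.
by rewrite mulrDl !mul1r.
Qed.

Lemma in_domA_cvg v : in_domA Om lam e s v ->
  cvgn (fun N : nat => \sum_(k < N) lam k `^ (2 * s) * inner Om v (e k) ^+ 2).
Proof.
move=> [v2 soo]; set u := fun k => lam k `^ (2 * s) * inner Om v (e k) ^+ 2.
have u0 k : 0 <= u k by rewrite mulr_ge0 ?powR_ge0 ?sqr_ge0.
rewrite (_ : (fun N : nat => _) = series u); last first.
  by apply/funext => N; rewrite /series /= big_mkord.
apply: nondecreasing_is_cvgn; first by apply: nondecreasing_series => k _ _.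
exists (fine (\sum_(0 <= k <oo) (u k)%:E)%E) => _ [N _ <-].
rewrite -lee_fin fineK; last first.
  by rewrite ge0_fin_numE//; apply: nneseries_ge0 => k _ _; rewrite lee_fin.
rewrite /series /= -sumEFin.
by apply: (@nneseries_lim_ge _ (fun k => (u k)%:E) xpredT 0%N N) => k _ _; rewrite lee_fin.
Qed.

(** The squared distance of two partial sums is a block of the convergent series defining the
    domain, so the partial sums are Cauchy and completeness of L^2 applies. *)
Lemma Apow_exists v : in_domA Om lam e s v ->
  exists w, inL2 Om w /\ (fun N : nat =>
       L2norm Om (fun x => w x - \sum_(k < N) lam k `^ s * inner Om v (e k) * e k x))
    @ \oo --> (0 : R).
Proof.
move=> dv; have cS := in_domA_cvg dv.
pose f (N : nat) x := \sum_(k < N) c v k * e k x.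
have f2 N : inL2 Om (f N) by exact: (semi_inner_sumV LS N (c v) e2).
pose S (N : nat) := \sum_(k < N) lam k `^ (2 * s) * inner Om v (e k) ^+ 2.
have fE (N M : nat) : (N <= M)%N ->
    inner Om (f M \- f N) (f M \- f N) = S M - S N.
  move=> NM; pose d k := if (N <= k)%N then c v k else 0.
  have cut (F : nat -> R) : \sum_(k < M) (if (N <= k)%N then F k else 0) =
      \sum_(k < M) F k - \sum_(k < N) F k.
    rewrite -(big_mkord xpredT (fun k => if (N <= k)%N then F k else 0)).
    rewrite -!(big_mkord xpredT F) (big_cat_nat (leq0n N) NM) /=.
    rewrite [in RHS](big_cat_nat (leq0n N) NM) /=.
    rewrite big_nat_cond big1 ?add0r; last first.
      by move=> k /andP[/andP[_ kN] _]; rewrite leqNgt kN.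
    rewrite [RHS]addrAC subrr add0r big_nat_cond [RHS]big_nat_cond.
    by apply: eq_bigr => k /andP[/andP[-> _] _].
  rewrite (_ : f M \- f N = fun x => \sum_(k < M) d k * e k x).
    rewrite (semi_inner_sum_sqr LS (w := fun=> 1) M d e2).
      rewrite /S -(cut (fun k => lam k `^ (2 * s) * inner Om v (e k) ^+ 2)).
      apply: eq_bigr => k _; rewrite mul1r /d.
      by case: ifP => _; rewrite ?expr0n// expr2 eigenvalue_powRM -expr2.
    by move=> j k; rewrite mul1r (eigenfunction_orthonormal eigen).
  apply/funext => x; rewrite /= /f -(cut (fun k => c v k * e k x)).
  apply: eq_bigr => k _; rewrite /d.
  by case: ifP => _; rewrite ?mul0r.
have fC : forall eps, 0 < eps -> exists N, forall j k, (N <= j)%N -> (N <= k)%N ->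
    inner Om (f j \- f k) (f j \- f k) <= eps.
  move=> eps eps0; have e20 : 0 < eps / 2 by rewrite divr_gt0.
  have /cvgrPdist_le/(_ _ e20)[N _ NP] := cS; exists N => j k Nj Nk.
  wlog jk : j k Nj Nk / (k <= j)%N.
    move=> H; case: (leqP k j) => [|/ltnW] kj; first exact: H.
    have := H _ _ Nk Nj kj.
    rewrite -(semi_norm_sqr LS (semi_inner_subV LS (f2 k) (f2 j))).
    rewrite -(semi_norm_sqr LS (semi_inner_subV LS (f2 j) (f2 k))).
    by rewrite (semi_normBC LS (f2 k) (f2 j)).
  rewrite fE//; have := NP _ Nj; have := NP _ Nk; rewrite /= -/(S j) -/(S k).
  by rewrite !ler_norml => /andP[? ?] /andP[? ?]; lra.
by have [w [w2 wf]] := L2_complete mOm f2 fC; exists w.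
Qed.

(** The coefficient of the N-th partial sum along [e k] is constant as soon as N > k, so it survives
    in the L^2 limit. *)
Lemma ApowP v : in_domA Om lam e s v -> inL2 Om (As v) /\
  forall k, inner Om (As v) (e k) = lam k `^ s * inner Om v (e k).
Proof.
move=> /Apow_exists[w wP].
have [A2 cA] : [set w | inL2 Om w /\ (fun N : nat =>
    L2norm Om (fun x => w x - \sum_(k < N) lam k `^ s * inner Om v (e k) * e k x))
    @ \oo --> (0 : R)] (As v) by exact: (getI wP).
split; first exact: A2.
move=> k; pose f (N : nat) x := \sum_(k < N) c v k * e k x.
have f2 N : inL2 Om (f N) by exact: (semi_inner_sumV LS N (c v) e2).
have H : inner Om (f N) (e k) @[N --> \oo] --> inner Om (As v) (e k).
  apply: (semi_inner_cvg LS (nearW _ f2) (nearW _ (fun=> e2 k)) A2 (e2 k)).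
    under eq_fun do rewrite (semi_normBC LS (f2 _) A2); exact: cA.
  rewrite (_ : (fun _ => _) = fun=> 0); first exact: cvg_cst.
  apply/funext => _.
  rewrite (semi_innerBl LS (e2 k) (e2 k) (semi_inner_subV LS (e2 k) (e2 k))).
  by rewrite subrr sqrtr0.
rewrite -(cvg_lim _ H)//; apply: lim_near_cst => //.
exists k.+1 => // N /= kN; rewrite (semi_inner_suml LS)//.
rewrite (bigD1 (Ordinal kN))//= big1 ?addr0.
  by rewrite (eigenfunction_orthonormal eigen) eqxx mulr1.
move=> j jk; rewrite (eigenfunction_orthonormal eigen).
by rewrite (_ : (_ == _) = false) ?mulr0//; apply/negbTE: jk.
Qed.

(* Keeps unification from unfolding integrals and choice operators. *)
Local Opaque Apow inner grad_inner.

Lemma inner_Apow_series v w : in_domA Om lam e s v -> in_domA Om lam e s w ->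
  (fun N : nat => \sum_(k < N) lam k `^ (2 * s) * (inner Om v (e k) * inner Om w (e k)))
    @ \oo --> inner Om (As v) (As w).
Proof.
move=> /ApowP[v2 vE] /ApowP[w2 wE].
rewrite (_ : (fun N : nat => _) = (fun N : nat =>
    \sum_(k < N) inner Om (As v) (e k) * inner Om (As w) (e k))).
  exact: inner_series.
apply/funext => N; apply: eq_bigr => k _.
exact: etrans (esym (eigenvalue_powRM _ _ _)) (esym (congr2 *%R (vE k) (wE k))).
Qed.

Hypothesis s01 : 0 <= 2 * s <= 1.

(** For an exponent in [0, 1] the power is at most 1 or at most [lam k], according to whether
    [lam k] lies below or above 1. This is what embeds H^1_0 in the domain of the fractional
    power. *)
Lemma eigenvalue_powR_le k : lam k `^ (2 * s) <= 1 + lam k.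
Proof.
have [s0 s1] := andP s01; have l0 := ltW (eigenvalue_pos eigen k).
have [l1|/ltW l1] := leP (lam k) 1.
  rewrite -[leLHS]addr0 lerD//.
  have : lam k `^ (2 * s) <= 1 `^ (2 * s) by apply: ge0_ler_powR; rewrite ?nnegrE.
  by rewrite powR1.
by rewrite -[leLHS]add0r lerD// -[leRHS]powRr1// ler_powR.
Qed.

Lemma fractional_bessel v N : inH10 Om v ->
  \sum_(k < N) lam k `^ (2 * s) * inner Om v (e k) ^+ 2 <= H1inner Om v v.
Proof.
move=> v0; have v2 := inH1_L2 (inH10_H1 v0).
apply: (@le_trans _ _ (\sum_(k < N) inner Om v (e k) ^+ 2 +
    \sum_(k < N) lam k * inner Om v (e k) ^+ 2)).
  rewrite -big_split /=; apply: ler_sum => k _.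
  by rewrite -[X in X + _]mul1r -mulrDl ler_wpM2r ?sqr_ge0// eigenvalue_powR_le.
rewrite lerD//; last exact: (grad_bessel oOm eigen N v0).
have := @semi_inner_bessel _ _ _ _ LS N (fun k => inner Om v (e k)) (fun=> 1) e v e2 v2.
under eq_bigr do rewrite mul1r; apply.
- by move=> k; rewrite mul1r (semi_innerC LS (e2 k) v2).
- by move=> j k; rewrite mul1r (eigenfunction_orthonormal eigen).
Qed.

Lemma inH10_domA v : inH10 Om v -> in_domA Om lam e s v.
Proof.
move=> v0; split; first exact: inH1_L2 (inH10_H1 v0).
apply: (@le_lt_trans _ _ (H1inner Om v v)%:E); last exact: ltry.
apply: lime_le.
  by apply: is_cvg_nneseries => k _ _; rewrite lee_fin mulr_ge0 ?powR_ge0 ?sqr_ge0.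
apply: nearW => N; rewrite sumEFin lee_fin big_mkord.
exact: fractional_bessel.
Qed.

Lemma Apow_L2 v : inH10 Om v -> inL2 Om (As v).
Proof. by move=> /inH10_domA/ApowP[]. Qed.

(** [Apow] returns chosen representatives, so linearity is expressed by coefficients: [As v \- As w]
    and [As (v \- w)] have the same ones, hence the same inner products, and the norm is bounded by
    [fractional_bessel]. *)
Lemma Apow_dist v w : inH10 Om v -> inH10 Om w ->
  L2norm Om (As v \- As w) <= H1norm Om (v \- w).
Proof.
move=> v0 w0; have HS := H10_semi_inner oOm eigen.
have vw0 := semi_inner_subV HS v0 w0.
have v2 := inH1_L2 (inH10_H1 v0); have w2 := inH1_L2 (inH10_H1 w0).
have [Av2 Av] := ApowP (inH10_domA v0); have [Aw2 Aw] := ApowP (inH10_domA w0).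
have [Avw2 Avw] := ApowP (inH10_domA vw0).
have B2 := semi_inner_subV LS Av2 Aw2.
have coef k : inner Om (As v \- As w) (e k) = inner Om (As (v \- w)) (e k).
  rewrite (semi_innerBl LS Av2 Aw2 (e2 k)).
  apply/esym; apply: etrans (Avw k) _.
  rewrite (semi_innerBl LS v2 w2 (e2 k)).
  rewrite mulrBr.
  exact: (congr2 (fun x y => x - y) (esym (Av k)) (esym (Aw k))).
rewrite (H1normE oOm eigen (inH10_H1 vw0)) /L2norm ler_wsqrtr//.
rewrite (eq_inner_coef B2 Avw2 B2 coef) (semi_innerC LS Avw2 B2).
rewrite (eq_inner_coef B2 Avw2 Avw2 coef).
have H := inner_Apow_series (inH10_domA vw0) (inH10_domA vw0).
rewrite -(cvg_lim _ H)//; apply: limr_le; first by apply/cvg_ex; eexists; exact: H.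
apply: nearW => N; under eq_bigr do rewrite -expr2.
exact: fractional_bessel.
Qed.

End fractional_power.

(** * Recovering increments from weak time derivatives *)

Section smooth_functions.
Context {R : realType}.
Implicit Types f g : R -> R.
Local Notation leb := (@lebesgue_measure R).

(** The recursion passes to the derivative of the function, so that sums, products and affine
    substitutions go by induction; [smooth_upto_derive1n] translates back to iterated
    derivatives. *)
Fixpoint smooth_upto (k : nat) f : Prop :=
  (forall t, derivable f t 1) /\ if k is l.+1 then smooth_upto l (derive1 f) else True.

Lemma smooth_upto_derive1n f k : smooth_upto k f ->
  forall t, derivable (derive1n k f) t 1.
Proof.
by elim: k f => [f [] //|k IH f [_ /IH H]] t; rewrite derive1Sn; exact: H.
Qed.

Lemma smooth_uptoS k f : smooth_upto k.+1 f -> smooth_upto k f.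
Proof.
elim: k f => [f [df _]|k IH f [df H]]; first exact: conj df I.
by split; [exact: df|exact: IH H].
Qed.

Lemma smooth_uptoD k f g : smooth_upto k f -> smooth_upto k g ->
  smooth_upto k (f \+ g).
Proof.
elim: k f g => [|k IH] f g [df f'] [dg g'].
  by split; [move=> t; exact: (derivableD (df t) (dg t))|exact: I].
split=> [t|]; first exact: (derivableD (df t) (dg t)).
rewrite (_ : derive1 _ = (derive1 f) \+ (derive1 g)); first exact: IH.
by apply/funext => t; rewrite /= !derive1E -deriveD.
Qed.

Lemma smooth_uptoM k f g : smooth_upto k f -> smooth_upto k g ->
  smooth_upto k (f \* g).
Proof.
elim: k f g => [|k IH] f g sf sg.
  by split; [move=> t; exact: (derivableM (sf.1 t) (sg.1 t))|exact: I].
have [df f'] := sf; have [dg g'] := sg.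
split=> [t|]; first exact: (derivableM (df t) (dg t)).
rewrite (_ : derive1 _ = (f \* (derive1 g)) \+ (g \* (derive1 f))); last first.
  apply/funext => t; rewrite derive1E (_ : f \* g = f * g)// (deriveM (df t) (dg t)).
  by rewrite /= !derive1E.
by apply: smooth_uptoD; apply: IH => //; exact: smooth_uptoS.
Qed.

Lemma smooth_upto_cst k (c : R) : smooth_upto k (cst c).
Proof.
elim: k c => [|k IH] c; first by split => // t; exact: derivable_cst.
split=> [t|]; first exact: derivable_cst.
rewrite (_ : derive1 _ = cst 0) //.
by apply/funext => t; rewrite derive1E derive_cst.
Qed.

Lemma is_derive_affine f (a b t : R) : derivable f (a * (t - b)) 1 ->
  is_derive t 1 (fun t => f (a * (t - b))) (a * (derive1 f) (a * (t - b))).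
Proof.
move=> df; have Hf : is_derive (a * (t - b)) 1 f ((derive1 f) (a * (t - b))).
  by rewrite derive1E; apply: DeriveDef.
have Hg : is_derive t 1 (fun t : R => a * (t - b)) a.
  apply: is_derive_eq; rewrite !(scaler0, subr0, addr0).
  by rewrite /GRing.scale /= mulr1.
have := @is_derive1_comp R f (fun t : R => a * (t - b)) t _ _ Hf Hg.
by move=> H; apply: is_derive_eq H _; rewrite mulrC.
Qed.

Lemma smooth_upto_affine k f (a b : R) : smooth_upto k f ->
  smooth_upto k (fun t => f (a * (t - b))).
Proof.
elim: k f => [|k IH] f [df f'].
  split; last exact: I.
  by move=> t; have [H _] := is_derive_affine (df (a * (t - b))); exact: H.
split=> [t|]; first by have [H _] := is_derive_affine (df (a * (t - b))); exact: H.
rewrite (_ : derive1 _ = cst a \* (fun t => (derive1 f) (a * (t - b)))).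
  by apply: smooth_uptoM; [exact: smooth_upto_cst|exact: IH].
apply/funext => t; rewrite derive1E /=.
by have [_ ->] := is_derive_affine (df (a * (t - b))).
Qed.

Lemma smooth_upto_continuous f : smooth_upto 0 f -> continuous f.
Proof.
by move=> [df _] t; apply: differentiable_continuous; exact/derivable1_diffP.
Qed.

(* Normalized primitive of the square of a bump function. *)
Lemma smooth_step f (L : R) : (forall k, smooth_upto k f) -> f 0 != 0 ->
  0 < L -> (forall t, L < `|t| -> f t = 0) ->
  exists (chi : R -> R) (C : R), [/\ forall k, smooth_upto k chi,
    (forall t, t <= - L -> chi t = 0) /\ (forall t, L <= t -> chi t = 1),
    forall t, 0 <= chi t <= 1,
    (forall t, `|derive1 chi t| <= C) & (forall t, L < `|t| -> derive1 chi t = 0)].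
Proof.
move=> sf f0 L0 fL; pose rho := f \* f.
have srho k : smooth_upto k rho by exact: smooth_uptoM.
have crho : continuous rho by exact: smooth_upto_continuous.
have rho_ge0 t : 0 <= rho t by rewrite /rho /= -expr2 sqr_ge0.
have rhoL t : L < `|t| -> rho t = 0 by move=> /fL ft; rewrite /rho /= ft mul0r.
have [C rhoC] : exists C, forall t, `|rho t| <= C.
  have : compact (rho @` `[- L, L]).
    by apply: continuous_compact; [exact: continuous_subspaceT|exact: segment_compact].
  move=> /compact_bounded[M [_ /(_ (`|M| + 1))]].
  rewrite (le_lt_trans (ler_norm M)) ?ltrDl// => /(_ isT) HM.
  exists (`|M| + 1) => t; have [tL|/rhoL ->] := leP `|t| L.
    by apply: HM; exists t => //=; rewrite in_itv /= -ler_norml.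
  by rewrite normr0 addr_ge0.
have mrho : measurable_fun setT rho by exact: continuous_measurable_fun.
have irho : leb.-integrable setT (EFin \o rho).
  apply/integrableP; split; first exact/measurable_EFinP.
  rewrite (_ : integral _ _ _ = \int[leb]_(t in `[(- L)%R, L]) (rho t)%:E)%E; last first.
    rewrite [RHS]integral_mkcond; apply: eq_integral => t _.
    rewrite /patch /= ger0_norm//; case: ifPn => //.
    by rewrite notin_setE /= in_itv /= -ler_norml => /negP; rewrite -ltNge => /rhoL ->.
  have : leb.-integrable `[- L, L] (EFin \o rho).
    apply: continuous_compact_integrable; first exact: segment_compact.
    exact: continuous_subspaceT.
  by move=> /integrable_fin_num; rewrite fin_numElt => /(_ _)/andP[].
have irhoS A : measurable A -> leb.-integrable A (EFin \o rho).
  by move=> mA; apply: integrableS irho.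
pose F t := \int[leb]_(x in `]-oo, t]) rho x.
pose c := \int[leb]_x rho x.
have dF t : derivable F t 1 /\ derive1 F t = rho t.
  apply: (@continuous_FTC1 _ rho -oo%O t (t + 1)) => //.
  - by rewrite ltrDl.
  - exact: irhoS.
  - exact: ltNyr.
  - exact: crho.
have F0 t : 0 <= F t by apply: Rintegral_ge0.
have Fc t : F t <= c.
  rewrite /F Rintegral_mkcond; apply: le_Rintegral => //.
    rewrite -restrict_EFin; apply/integrable_restrict => //.
    by apply: irhoS; apply: measurableI.
  by move=> x _; rewrite /patch; case: ifP.
have FL t : t <= - L -> F t = 0.
  move=> tL; rewrite /F; have rho00 x : x < - L -> rho x = 0.
    move=> xL; apply: rhoL; rewrite ltr0_norm; first by rewrite ltrNr.
    by rewrite (lt_trans xL)// oppr_lt0.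
  rewrite -Rintegral_itv_bndo_bndc//; last exact: irhoS.
  rewrite (@eq_Rintegral _ _ _ _ _ (cst 0)); first by rewrite Rintegral_cst// mul0r.
  by move=> x; rewrite inE /= in_itv /= => xt; apply: rho00; exact: lt_le_trans tL.
have FL' t : L <= t -> F t = c.
  move=> Lt; rewrite /F Rintegral_mkcond; apply: eq_Rintegral => x _.
  rewrite /patch; case: ifPn => //; rewrite notin_setE /= in_itv /=.
  move=> /negP; rewrite -ltNge => tx; rewrite rhoL//.
  by rewrite (le_lt_trans Lt)// (lt_le_trans tx)// ler_norm.
(* If the total mass were 0, the primitive [F] would vanish identically, and so would its derivative
   at 0, which is the square of [f 0]. *)
have c0 : 0 < c.
  rewrite lt_neqAle (le_trans (F0 0) (Fc 0)) andbT eq_sym; apply/negP => /eqP c0.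
  have F00 : F = cst 0.
    by apply/funext => t; apply/eqP; rewrite eq_le F0 andbT -[leRHS]c0 Fc.
  have := (dF 0).2; rewrite F00 derive1E derive_cst => /esym/eqP.
  by rewrite /rho /= mulf_eq0 (negbTE f0).
pose chi (t : R) := c^-1 * F t.
have dchi (t : R) : is_derive t (1 : R) chi (c^-1 * rho t).
  have Hf : is_derive t 1 F (rho t).
    by apply: DeriveDef; [exact: (dF t).1|rewrite -derive1E (dF t).2].
  have := is_deriveM (is_derive_cst c^-1 t 1) Hf.
  by move=> H; apply: is_derive_eq H _; rewrite scaler0 addr0.
have chi' : derive1 chi = cst c^-1 \* rho.
  by apply/funext => t; rewrite derive1E /=; have [_ ->] := dchi t.
exists chi, (c^-1 * C); split.
- elim=> [|k _]; first by split; [move=> t; have [H _] := dchi t; exact: H|exact: I].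
  split=> [t|]; first by have [H _] := dchi t; exact: H.
  by rewrite chi'; apply: smooth_uptoM; [exact: smooth_upto_cst|exact: srho].
- split=> t; rewrite /chi; first by move=> /FL ->; rewrite mulr0.
  by move=> /FL' ->; rewrite mulVf// gt_eqF.
- move=> t; rewrite /chi mulr_ge0 ?F0 ?invr_ge0 ?(ltW c0)//=.
  by rewrite mulrC ler_pdivrMr// mul1r.
- move=> t; rewrite chi' /= normrM (ger0_norm (_ : 0 <= c^-1)) ?invr_ge0 ?(ltW c0)//.
  by rewrite ler_wpM2l ?invr_ge0 ?(ltW c0).
- by move=> t /rhoL; rewrite chi' /= => ->; rewrite mulr0.
Qed.

End smooth_functions.

#[local] Instance ae_lebesgue_filter {R : realType} :
  Filter (almost_everywhere (@lebesgue_measure R)).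
Proof. exact: (ae_filter_ringOfSetsType (@lebesgue_measure R)). Qed.

Section real_integrable.
Context d (T : measurableType d) (R : realType) (mu : {measure set T -> \bar R}).
Variables (D : set T) (mD : measurable D).
Implicit Types f g : T -> R.

Lemma integrable_EFinZ k f : mu.-integrable D (EFin \o f) ->
  mu.-integrable D (EFin \o (fun x => k * f x)).
Proof.
move=> /(integrableZl mD k); exact: eq_integrable.
Qed.

Lemma integrable_EFinD f g : mu.-integrable D (EFin \o f) ->
  mu.-integrable D (EFin \o g) -> mu.-integrable D (EFin \o (fun x => f x + g x)).
Proof.
move=> if_ ig; by apply: eq_integrable (integrableD mD if_ ig).
Qed.

Lemma integrable_EFinB f g : mu.-integrable D (EFin \o f) ->
  mu.-integrable D (EFin \o g) -> mu.-integrable D (EFin \o (fun x => f x - g x)).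
Proof.
move=> if_ ig; by apply: eq_integrable (integrableB mD if_ ig).
Qed.

Lemma dominated_Rintegral (f_ : nat -> T -> R) f g :
  (forall k, measurable_fun D (f_ k)) -> measurable_fun D f ->
  {ae mu, forall x, D x -> f_ k x @[k --> \oo] --> f x} ->
  mu.-integrable D (EFin \o g) ->
  {ae mu, forall x k, D x -> `|f_ k x| <= g x} ->
  mu.-integrable D (EFin \o f) /\
  \int[mu]_(x in D) f_ k x @[k --> \oo] --> \int[mu]_(x in D) f x.
Proof.
move=> mf_ mf ff ig fg.
have [] := @dominated_convergence _ _ _ mu D mD (fun k => EFin \o f_ k) (EFin \o f)
  (EFin \o g).
- by move=> k; exact/measurable_EFinP.
- exact/measurable_EFinP.
- by move: ff; apply: filterS => x ffx Dx; apply: cvg_EFin; [exact: nearW|exact: ffx].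
- exact: ig.
- by move: fg; apply: filterS => x fgx k Dx; rewrite lee_fin; exact: fgx.
move=> if_ _ cf; split => //; apply: fine_cvg.
by rewrite fineK//; exact: integrable_fin_num.
Qed.

End real_integrable.

Lemma dominated_lebesgue (R : realType) (D : set R) (f_ : nat -> R -> R)
    (f g : R -> R) : measurable D ->
  (forall k, measurable_fun D (f_ k)) -> measurable_fun D f ->
  {ae (@lebesgue_measure R), forall x, D x -> f_ k x @[k --> \oo] --> f x} ->
  (@lebesgue_measure R).-integrable D (EFin \o g) ->
  {ae (@lebesgue_measure R), forall x k, D x -> `|f_ k x| <= g x} ->
  (@lebesgue_measure R).-integrable D (EFin \o f) /\
  \int[@lebesgue_measure R]_(x in D) f_ k x @[k --> \oo] -->
    \int[@lebesgue_measure R]_(x in D) f x.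
Proof.
move=> mD mf_ mf ff ig fg.
exact: (dominated_Rintegral (mu := lebesgue_measure) mD mf_ mf ff ig fg).
Qed.

Lemma lebesgue_integrableD (R : realType) (D : set R) (f g : R -> R) : measurable D ->
  (@lebesgue_measure R).-integrable D (EFin \o f) ->
  (@lebesgue_measure R).-integrable D (EFin \o g) ->
  (@lebesgue_measure R).-integrable D (EFin \o (fun x => f x + g x)).
Proof. move=> mD if_ ig; exact: integrable_EFinD. Qed.

(** * Mollification in time *)

Section weak_time_derivative.
Context {R : realType}.
Local Notation leb := (@lebesgue_measure R).
Implicit Types g r chi phi : R -> R.

Lemma near_inv_lt (L eps : R) : 0 < L -> 0 < eps ->
  \forall k \near \oo, L / k.+1%:R < eps.
Proof.
move=> L0 e0; have eL : 0 < eps / L by rewrite divr_gt0.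
have /cvgrPdist_lt/(_ _ eL) := @cvg_harmonic R; apply: filterS => k /=.
rewrite sub0r normrN ger0_norm ?invr_ge0// => h.
by rewrite mulrC -ltr_pdivlMr.
Qed.

Lemma continuous_integrable_itv g (a b : R) :
  {within `[a, b], continuous g} -> leb.-integrable `[a, b] (EFin \o g).
Proof.
by move=> cg; apply: continuous_compact_integrable => //; exact: segment_compact.
Qed.

Section mollifier.
Variables (chi : R -> R) (L C : R).
Hypothesis L0 : 0 < L.
Hypothesis chiS : forall k, smooth_upto k chi.
Hypothesis chi0 : forall t, t <= - L -> chi t = 0.
Hypothesis chi1 : forall t, L <= t -> chi t = 1.
Hypothesis chi01 : forall t, 0 <= chi t <= 1.
Hypothesis chiC : forall t, `|derive1 chi t| <= C.
Hypothesis chiL : forall t, L < `|t| -> derive1 chi t = 0.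

Let C0 : 0 <= C. Proof. exact: le_trans (chiC 0). Qed.

Lemma is_derive_step (m x t : R) :
  is_derive t (1 : R) (fun t => chi (m * (t - x))) (m * derive1 chi (m * (t - x))).
Proof. by apply: is_derive_affine; exact: (chiS 0).1. Qed.

Lemma continuous_derive_step (m x : R) :
  continuous (fun t : R => m * derive1 chi (m * (t - x))).
Proof.
have s1 := chiS 1; have : smooth_upto 0 (cst m \* (fun t => derive1 chi (m * (t - x)))).
  apply: smooth_uptoM; first exact: smooth_upto_cst.
  by apply: (@smooth_upto_affine _ 0); exact: s1.2.
exact: smooth_upto_continuous.
Qed.

(** The kernels are the derivatives of rescaled steps: mass 1 by the fundamental theorem of calculus
    once L/m fits inside the interval, and support in [[x - L/m, x + L/m]]. *)
Lemma mollify_cvg g (x a b : R) : a < x < b ->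
  {within `[a, b], continuous g} -> {for x, continuous g} ->
  \int[leb]_(t in `[a, b]) (g t * (k.+1%:R * derive1 chi (k.+1%:R * (t - x))))
    @[k --> \oo] --> g x.
Proof.
move=> /andP[ax xb] cg cgx; have ab : a < b := lt_trans ax xb.
apply/cvgrPdist_le => eps eps0.
(* The kernel is at most m C on an interval of length 2 L / m, so its L^1 norm is at most 2 L C; the
   [+ 1] avoids a zero denominator. *)
pose eta := eps / (2 * L * C + 1).
have D0 : 0 < 2 * L * C + 1 by rewrite ltr_pwDr// !mulr_ge0// ltW.
have eta0 : 0 < eta by rewrite divr_gt0.
have /cvgrPdist_le/(_ _ eta0)/nbhs_ballP[d /= d0 dP] := cgx.
near=> k; have m0 : 0 < k.+1%:R :> R by rewrite ltr0n.
have Lma : L / k.+1%:R < x - a by near: k; apply: near_inv_lt; rewrite ?subr_gt0.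
have Lmb : L / k.+1%:R < b - x by near: k; apply: near_inv_lt; rewrite ?subr_gt0.
have Lmd : L / k.+1%:R < d by near: k; exact: near_inv_lt.
move: m0 Lma Lmb Lmd; move: (k.+1%:R : R) => m m0 Lma Lmb Lmd.
pose psi (t : R) := m * derive1 chi (m * (t - x)).
have cpsi : continuous psi by exact: continuous_derive_step.
have cpsiw : {within `[a, b], continuous psi} by exact: continuous_subspaceT.
have psi_int : \int[leb]_(t in `[a, b]) psi t = 1.
  rewrite /Rintegral (@continuous_FTC2 _ psi (fun t => chi (m * (t - x))))//.
  - rewrite chi1; last first.
      by rewrite mulrC -ler_pdivrMr// ltW.
    rewrite chi0 ?sube0//.
    by rewrite mulrC -ler_pdivlMr// mulNr lerNr opprB ltW.
  - have cs (t : R) : {for t, continuous (fun t => chi (m * (t - x)))}.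
      by apply: differentiable_continuous; apply/derivable1_diffP; case: (is_derive_step m x t).
    split.
    + by move=> t _; case: (is_derive_step m x t).
    + by apply: cvg_at_right_filter; exact: cs.
    + by apply: cvg_at_left_filter; exact: cs.
  - by move=> t _; rewrite derive1E; case: (is_derive_step m x t).
have ipsi := continuous_integrable_itv cpsiw.
have cgpsi : {within `[a, b], continuous (fun t => g t * psi t)}.
  by move=> t; apply: cvgM; [exact: cg|exact: cpsiw].
have igpsi := continuous_integrable_itv cgpsi.
have igxpsi : leb.-integrable `[a, b] (EFin \o (fun t => g x * psi t)).
  exact: integrable_EFinZ.
rewrite (_ : g x - _ = - \int[leb]_(t in `[a, b]) (g t * psi t - g x * psi t)); last first.
  by rewrite RintegralB// RintegralZl// psi_int mulr1 opprB.
rewrite normrN.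
have idiff : leb.-integrable `[a, b] (EFin \o (fun t => g t * psi t - g x * psi t)).
  exact: integrable_EFinB.
apply: le_trans (le_normr_Rintegral _ idiff) _ => //.
pose J := `[x - L / m, x + L / m]%classic.
have muJ : (leb J = (2 * (L / m))%:E)%E.
  have Lm : 0 < L / m by rewrite divr_gt0.
  rewrite /J lebesgue_measure_itv /= lte_fin ifT; last by lra.
  by rewrite -EFinB; congr EFin; ring.
have iJ : leb.-integrable `[a, b] (EFin \o (fun t => eta * (m * C) * \1_J t)).
  apply: integrable_EFinZ => //; apply: (@integrableS _ _ _ _ setT) => //.
  exact: integrable_indic_itv.
apply: (@le_trans _ _ (\int[leb]_(t in `[a, b]) (eta * (m * C) * \1_J t))).
  apply: le_Rintegral => //; first exact: integrable_norm.
  move=> t _; rewrite -mulrBl normrM /psi normrM (ger0_norm (ltW m0)) indicE.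
  have [tJ|tJ] := boolP (t \in J).
    rewrite mulr1; apply: ler_pM => //; first by rewrite mulr_ge0// ltW.
      rewrite distrC; apply: dP; move: tJ; rewrite inE /J /= in_itv /= => /andP[t1 t2].
      by rewrite /ball /= ltr_distl; lra.
    by rewrite ler_wpM2l// ltW.
  rewrite mulr0 chiL ?normr0 ?mulr0//.
  rewrite normrM (ger0_norm (ltW m0)) mulrC -ltr_pdivrMr// ltNge.
  by apply: contra tJ => tJ; rewrite inE /J /= in_itv /= -ler_distl.
rewrite RintegralZl//; last first.
  apply: (@integrableS _ _ _ _ setT) => //.
  exact: integrable_indic_itv.
have -> : \int[leb]_(t in `[a, b]) \1_J t = 2 * (L / m).
  rewrite /Rintegral integral_indic//; last exact: measurable_itv.
  have -> : J `&` `[a, b]%classic = J by apply/setIidPl => t;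
    rewrite /J /= !in_itv /= => /andP[t1 t2]; lra.
  exact: (congr1 fine muJ).
have Lm : L = L / m * m by rewrite divfK// gt_eqF.
have -> : eta * (m * C) * (2 * (L / m)) = eta * (2 * L * C).
  by rewrite [in RHS]Lm; ring.
by rewrite /eta mulrAC ler_pdivrMr// ler_wpM2l ?(ltW eps0)// lerDl.
Unshelve. all: by end_near. Qed.

Lemma time_test_step (T : \bar R) (a b m : R) : 0 < m -> a < b ->
  0 < a - L / m -> ((b + L / m)%:E < T)%E ->
  time_test_function T (fun t => chi (m * (t - a)) - chi (m * (t - b))).
Proof.
move=> m0 ab a0 bT; set phi := fun t => _.
have supp : closure [set t | phi t != 0] `<=` `[a - L / m, b + L / m].
  have cl : closed `[a - L / m, b + L / m]%classic by exact: interval_closed.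
  rewrite [X in _ `<=` X]((closure_id _).1 cl).
  apply: closureS => t /= pt; rewrite in_itv /=; apply/andP; split.
    rewrite leNgt; apply: contra pt => tl; rewrite /phi !chi0 ?subrr//.
    - rewrite mulrC -ler_pdivlMr// mulNr; lra.
    - rewrite mulrC -ler_pdivlMr// mulNr; lra.
  rewrite leNgt; apply: contra pt => tl; rewrite /phi !chi1 ?subrr//.
  - rewrite mulrC -ler_pdivrMr//; lra.
  - rewrite mulrC -ler_pdivrMr//; lra.
split.
- move=> k; apply: smooth_upto_derive1n.
  rewrite (_ : phi = (fun t => chi (m * (t - a))) \+
      (cst (-1) \* (fun t => chi (m * (t - b))))); last first.
    by apply/funext => t; rewrite /phi /= mulN1r.
  apply: smooth_uptoD; first exact: smooth_upto_affine.
  by apply: smooth_uptoM; [exact: smooth_upto_cst|exact: smooth_upto_affine].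
- apply: (subclosed_compact _ (@segment_compact R (a - L / m) (b + L / m))) => //.
  exact: closed_closure.
- move=> t /supp /=; rewrite in_itv /= => /andP[t1 t2]; split.
    exact: lt_le_trans t1.
  by rewrite (le_lt_trans _ bT)// lee_fin.
Qed.

End mollifier.

(* The weak identity is tested with mollified indicators of [a, b]. *)
Lemma weak_derivative_integral (f : R -> R) (L : R) (T : \bar R) g r (a b tau : R) :
  (forall k, smooth_upto k f) -> f 0 != 0 -> 0 < L ->
  (forall t, L < `|t| -> f t = 0) ->
  (forall t, 0 < t -> (t%:E < T)%E -> {for t, continuous g}) ->
  leb.-integrable `]0, tau[ (EFin \o r) ->
  (forall phi, time_test_function T phi ->
    \int[leb]_(t in oitv0T T) (g t * derive1 phi t) =
    - \int[leb]_(t in oitv0T T) (r t * phi t)) ->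
  0 < a -> a < b -> b < tau -> (tau%:E < T)%E ->
  g b - g a = \int[leb]_(t in `[a, b]) r t.
Proof.
move=> sf f0 L0 fL cg ir weak a0 ab btau tauT.
have [chi [C [chiS [chi0 chi1] chi01 chiC chiL]]] := smooth_step sf f0 L0 fL.
(* [a'] and [b'] leave a margin around [[a, b]] that contains the supports of the mollified
   indicators for large k, still inside (0, tau) where [r] is integrable. *)
have [a' a'0 a'a] : exists2 a', 0 < a' & a' < a by exists (a / 2); lra.
have [b' bb' b'tau] : exists2 b', b < b' & b' < tau by exists ((b + tau) / 2); lra.
pose I := `[a', b']%classic.
have IT : I `<=` oitv0T T.
  move=> t; rewrite /I /= in_itv /= => /andP[t1 t2]; split; first exact: lt_le_trans t1.
  by rewrite (lt_trans _ tauT)// lte_fin (le_lt_trans t2).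
have I0 : I `<=` `]0, tau[.
  move=> t; rewrite /I /= !in_itv /= => /andP[t1 t2].
  by rewrite (lt_le_trans a'0 t1) (le_lt_trans t2 b'tau).
have irI : leb.-integrable I (EFin \o r)
  by apply: integrableS ir => //; exact: measurable_itv.
have cgI : {within I, continuous g}.
  apply: continuous_in_subspaceT => t; rewrite inE => /IT[t0 tT].
  exact: cg.
pose m k : R := k.+1%:R; have m0 k : 0 < m k by rewrite ltr0n.
pose phi k t := chi (m k * (t - a)) - chi (m k * (t - b)).
have small : \forall k \near \oo, 0 < a - L / m k /\ b + L / m k < b' /\ a' < a - L / m k.
  have e1 : 0 < a - a' by rewrite subr_gt0.
  have e2 : 0 < b' - b by rewrite subr_gt0.
  apply: filterS2 (near_inv_lt L0 e1) (near_inv_lt L0 e2) => k; rewrite -/(m k).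
  by move: (L / m k) => q h1 h2; split; [lra|split; lra].
have phiI k t : 0 < a - L / m k /\ b + L / m k < b' /\ a' < a - L / m k -> ~ I t ->
    phi k t = 0 /\ derive1 (phi k) t = 0.
  move=> [h1 [h2 h3]] nI.
  have dphi : derive1 (phi k) t = m k * derive1 chi (m k * (t - a)) -
      m k * derive1 chi (m k * (t - b)).
    rewrite derive1E; have Ha := is_derive_step chiS (m k) a t.
    have Hb := is_derive_step chiS (m k) b t.
    by have [_ ->] := is_deriveB Ha Hb.
  have Lm : m k * (L / m k) = L by rewrite mulrC divfK// gt_eqF.
  move: h1 h2 h3 Lm; move: (L / m k) => q h1 h2 h3 Lm.
  have mm x y : x < y -> m k * x < m k * y by move=> xy; rewrite ltr_pM2l.
  have [ta|ta] := ltP t a'.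
    have h4 : m k * (t - a) < - L by rewrite -Lm -mulrN mm//; lra.
    have h5 : m k * (t - b) < - L by rewrite -Lm -mulrN mm//; lra.
    rewrite dphi /phi !chi0 ?ltW// !chiL; first by rewrite mulr0 subrr.
    - by rewrite ltr0_norm; lra.
    - by rewrite ltr0_norm; lra.
  have bt : b' < t.
    by rewrite ltNge; apply/negP => tb'; apply: nI; rewrite /I /= in_itv /= ta tb'.
  have h4 : L < m k * (t - a) by rewrite -[X in X < _]Lm mm//; lra.
  have h5 : L < m k * (t - b) by rewrite -[X in X < _]Lm mm//; lra.
  rewrite dphi /phi !chi1 ?ltW// !chiL; first by rewrite !mulr0 !subrr.
  - by rewrite gtr0_norm; lra.
  - by rewrite gtr0_norm; lra.
(* The weak identity integrates over all of (0, T), while integrability of [r] is known on (0, tau)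
   only; for large k both integrands vanish outside [I]. *)
have restr (h : R -> R) : (forall t, ~ I t -> h t = 0) ->
    \int[leb]_(t in oitv0T T) h t = \int[leb]_(t in I) h t.
  move=> h0; rewrite Rintegral_mkcond [RHS]Rintegral_mkcond.
  congr (Rintegral _ _ _); apply/funext => t; rewrite /patch.
  case: ifPn => tT; case: ifPn => //.
    by rewrite notin_setE => /h0.
  by rewrite inE => /IT /mem_set tT'; rewrite tT' in tT.
have A_cvg : \int[leb]_(t in I) (g t * derive1 (phi k) t) @[k --> \oo] --> g a - g b.
  have dphi k : derive1 (phi k) = (fun t => m k * derive1 chi (m k * (t - a))) \-
      (fun t => m k * derive1 chi (m k * (t - b))).
    apply/funext => t; rewrite derive1E; have Ha := is_derive_step chiS (m k) a t.
    have Hb := is_derive_step chiS (m k) b t.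
    by have [_ ->] := is_deriveB Ha Hb.
  pose J x k := \int[leb]_(t in I) (g t * (m k * derive1 chi (m k * (t - x)))).
  have JI x k : leb.-integrable I (EFin \o (fun t => g t * (m k * derive1 chi (m k * (t - x))))).
    have cw : {within I, continuous (fun t => m k * derive1 chi (m k * (t - x)))}.
      by apply: continuous_subspaceT; exact: continuous_derive_step.
    apply: continuous_integrable_itv => t.
    by apply: cvgM; [exact: cgI|exact: cw].
  rewrite (_ : (fun k => _) = (fun k => J a k - J b k)); last first.
    apply/funext => k; rewrite /J -RintegralB//; last exact: measurable_itv.
    by apply: eq_Rintegral => t _; rewrite dphi /= mulrBr.
  have JA : J a k @[k --> \oo] --> g a.
    apply: (mollify_cvg L0 chiS chi0 chi1 chiC chiL) => //.
    - by rewrite a'a (lt_trans ab bb').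
    - by apply: cg => //; rewrite (lt_trans _ tauT)// lte_fin (lt_trans ab).
  have JB : J b k @[k --> \oo] --> g b.
    apply: (mollify_cvg L0 chiS chi0 chi1 chiC chiL) => //.
    - by rewrite bb' (lt_trans a'a ab).
    - by apply: cg; rewrite ?(lt_trans a0 ab)// (lt_trans _ tauT)// lte_fin.
  exact: (cvgB JA JB).
have B_cvg : \int[leb]_(t in I) (r t * phi k t) @[k --> \oo] -->
    \int[leb]_(t in `[a, b]) r t.
  have mI : measurable I by exact: measurable_itv.
  have mr : measurable_fun I r by apply/measurable_EFinP; exact: measurable_int irI.
  have cphi k : continuous (phi k).
    have s1 : smooth_upto 0 (phi k).
      rewrite (_ : phi k = (fun t => chi (m k * (t - a))) \+
          (cst (-1) \* (fun t => chi (m k * (t - b))))); last first.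
        by apply/funext => t; rewrite /phi /= mulN1r.
      apply: smooth_uptoD; first exact: smooth_upto_affine.
      by apply: smooth_uptoM; [exact: smooth_upto_cst|exact: smooth_upto_affine].
    exact: smooth_upto_continuous.
  pose F k t := r t * phi k t.
  (* At [a] and [b] themselves the mollified indicators need not tend to 0 or 1, so these two points
     are discarded as a null set. *)
  pose F_lim t := r t * \1_(`]a, b[%classic : set R) t.
  have mF k : measurable_fun I (F k).
    apply: measurable_funM => //.
    exact: measurable_funS (continuous_measurable_fun (cphi k)).
  have mF_lim : measurable_fun I F_lim.
    by apply: measurable_funM.
  have ne (c : R) : {ae leb, forall t, t != c}.
    exists [set c]; split; [exact: measurable_set1|exact: lebesgue_measure_set1|].
    by move=> t /= /negP; rewrite negbK => /eqP.
  have F_cvg : {ae leb, forall t, I t -> F ^~ t @ \oo --> F_lim t}.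
    apply: filterS2 (ne a) (ne b) => t ta tb _.
    apply: cvgM; first exact: cvg_cst.
    have far (x y : R) : x < y -> \forall k \near \oo, L <= m k * (y - x).
      move=> xy; have d0 : 0 < y - x by rewrite subr_gt0.
      move: (near_inv_lt L0 d0); apply: filterS => k /ltW.
      by rewrite ler_pdivrMr ?m0// mulrC.
    have near0 (x y : R) : x < y -> \forall k \near \oo, chi (m k * (x - y)) = 0.
      move=> /far; apply: filterS => k h; apply: chi0.
      by rewrite -opprB mulrN lerN2.
    have near1 (x y : R) : x < y -> \forall k \near \oo, chi (m k * (y - x)) = 1.
      by move=> /far; apply: filterS => k h; exact: chi1.
    apply: cvg_near_cst; rewrite indicE.
    have [t_a|a_t|ta0] := ltgtP t a; last by rewrite ta0 eqxx in ta.
      have tlb : t < b := lt_trans t_a ab.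
      rewrite memNset; last by rewrite /= in_itv /= (ltNge a) (ltW t_a).
      by apply: filterS2 (near0 _ _ t_a) (near0 _ _ tlb) => k; rewrite /phi => -> ->; rewrite subrr.
    have [t_b|b_t|tb0] := ltgtP t b; last by rewrite tb0 eqxx in tb.
      rewrite mem_set; last by rewrite /= in_itv /= a_t.
      by apply: filterS2 (near1 _ _ a_t) (near0 _ _ t_b) => k; rewrite /phi => -> ->; rewrite subr0.
    rewrite memNset; last by rewrite /= in_itv /= a_t (ltNge t) (ltW b_t).
    by apply: filterS2 (near1 _ _ a_t) (near1 _ _ b_t) => k; rewrite /phi => -> ->; rewrite subrr.
  have F_dom : {ae leb, forall t k, I t -> `|F k t| <= `|r t|}.
    apply: aeW => t k _; rewrite /F normrM ler_piMr//.
    have /andP[c1 c2] := chi01 (m k * (t - a)).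
    have /andP[c3 c4] := chi01 (m k * (t - b)).
    by rewrite /phi ler_norml; apply/andP; split; lra.
  have inr : leb.-integrable I (EFin \o (fun t => `|r t|)) by exact: integrable_norm.
  have lim_eq : \int[leb]_(t in I) F_lim t = \int[leb]_(t in `[a, b]) r t.
    have abI : `[a, b] `<=` I.
      by move=> t; rewrite /I /= !in_itv /= => /andP[t1 t2]; lra.
    have irab : leb.-integrable `[a, b] (EFin \o r).
      by apply: integrableS irI => //; exact: measurable_itv.
    have abo : `]a, b[ `<=` I.
      by move=> t; rewrite /I /= !in_itv /= => /andP[t1 t2]; lra.
    have irabo : leb.-integrable `]a, b[ (EFin \o r).
      by apply: integrableS irI => //; exact: measurable_itv.
    have iraboc : leb.-integrable `]a, b] (EFin \o r).
      apply: integrableS irI => //.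
      by move=> t; rewrite /I /= !in_itv /= => /andP[t1 t2]; lra.
    rewrite -Rintegral_itv_obnd_cbnd// -Rintegral_itv_bndo_bndc//.
    rewrite -[in RHS](setIidr abo) Rintegral_mkcondr; apply: eq_Rintegral => t _.
    by rewrite /F_lim /patch indicE; case: ifP; rewrite ?mulr1 ?mulr0.
  by rewrite -lim_eq; exact: (dominated_lebesgue mI mF mF_lim F_cvg inr F_dom).2.
have AB : \forall k \near \oo, (- (\int[leb]_(t in I) (r t * phi k t))) =
    (\int[leb]_(t in I) (g t * derive1 (phi k) t)).
  move: small; apply: filterS => k sk; have [h1 [h2 h3]] := sk.
  rewrite -!restr//.
  - apply/esym; apply: weak; apply: (time_test_step chiS chi0 chi1) => //.
    by rewrite (lt_trans _ tauT)// lte_fin (lt_trans h2).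
  - by move=> t /(phiI _ _ sk)[_ ->]; rewrite mulr0.
  - by move=> t /(phiI _ _ sk)[-> _]; rewrite mulr0.
have NB_cvg : (- (\int[leb]_(t in I) (r t * phi k t))) @[k --> \oo] --> g a - g b.
  by apply: cvg_trans A_cvg; apply: near_eq_cvg; move: AB; apply: filterS => k ->.
have H : g a - g b = - (\int[leb]_(t in `[a, b]) r t).
  exact: (cvg_unique (@Rhausdorff R) NB_cvg (cvgN B_cvg)).
by rewrite -opprB H opprK.
Qed.

End weak_time_derivative.

(** * A bump function on the line *)

Section line_bump.
Context {R : realType} {n : nat}.
Local Notation dlt i := (delta_mx ord0 i : 'rV[R]_n).
Implicit Types psi : 'rV[R]_n -> R.

Let line_quotient psi (x v : 'rV[R]_n) (t : R) :
  (fun h : R => h^-1 *: (((fun t : R => psi (x + t *: v)) \o shift t) (h *: 1) -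
    psi (x + t *: v))) =
  (fun h : R => h^-1 *: ((psi \o shift (x + t *: v)) (h *: v) - psi (x + t *: v))).
Proof.
by apply/funext => h /=; rewrite [h *: 1]mulr1 scalerDl addrCA.
Qed.

Lemma derivable_line psi (x v : 'rV[R]_n) (t : R) :
  derivable psi (x + t *: v) v -> derivable (fun t : R => psi (x + t *: v)) t 1.
Proof. by rewrite /derivable line_quotient. Qed.

Lemma derive_line psi (x v : 'rV[R]_n) (t : R) :
  derive1 (fun t : R => psi (x + t *: v)) t = 'D_v psi (x + t *: v).
Proof. by rewrite derive1E /derive line_quotient. Qed.

Lemma Ck_smooth_line k psi i x : Ck k.+1 psi ->
  smooth_upto k (fun t : R => psi (x + t *: dlt i)).
Proof.
elim: k psi => [|k IH] psi [_ /(_ i)[dpsi Cpsi]].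
  by split=> // t; apply: derivable_line; exact: dpsi.
split; first by move=> t; apply: derivable_line; exact: dpsi.
have -> : derive1 (fun t : R => psi (x + t *: dlt i)) =
    (fun t : R => 'D_(dlt i) psi (x + t *: dlt i)).
  by apply/funext => t; exact: derive_line.
exact: (IH (fun y => 'D_(dlt i) psi y) Cpsi).
Qed.

(** Restriction of [phi] to the line through [x] in the first coordinate direction. The bound on [t]
    comes from |x_0 + t| >= |t| - |x_0|, which exceeds the bound [M] of the support. *)
Lemma bump_of_test_function (Om : set 'rV[R]_n) phi x : (0 < n)%N ->
  test_function Om phi -> phi x != 0 ->
  exists (f : R -> R) (L : R), [/\ forall k, smooth_upto k f, f 0 != 0, 0 < L &
    forall t, L < `|t| -> f t = 0].
Proof.
move=> n0 tphi px; pose i := Ordinal n0.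
have [Cphi cphi _] := tphi.
have [M [C [M0 _]]] := compact_support_bounds cphi (Cphi 0%N).1
  (fun y ny => off_supp ny).
exists (fun t : R => phi (x + t *: dlt i)), (`|M| + `|x ord0 i| + 1); split.
- by move=> k; exact: Ck_smooth_line.
- by rewrite scale0r addr0.
- by rewrite ltr_wpDl// addr_ge0.
move=> t Lt; apply: (M0 _ i); rewrite !mxE !eqxx mulr1.
have := ler_normB (x ord0 i + t) (x ord0 i); rewrite addrAC subrr add0r => h.
have := ler_norm M; lra.
Qed.

(** Some test function is nonzero: otherwise density of test functions would make the first
    eigenfunction orthogonal to itself, against its normalisation. *)
Lemma exists_bump (Om : set 'rV[R]_n) lam e : open Om -> (0 < n)%N ->
  dirichlet_eigenpairs Om lam e ->
  exists (f : R -> R) (L : R), [/\ forall k, smooth_upto k f, f 0 != 0, 0 < L &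
    forall t, L < `|t| -> f t = 0].
Proof.
move=> oOm n0 eigen.
have [[phi [x [tphi px]]]|no] := pselect
    (exists phi, exists x, test_function Om phi /\ phi x != 0).
  exact: bump_of_test_function tphi px.
have e2 := eigenfunction_L2 eigen 0%N.
suff : inner Om (e 0%N) (e 0%N) = 0.
  by rewrite (eigenfunction_orthonormal eigen) eqxx => /eqP; rewrite oner_eq0.
apply: (test_function_dense oOm eigen) => // phi tphi.
rewrite (_ : phi = cst 0).
  by rewrite /inner /Rintegral; under eq_integral do rewrite mulr0; rewrite integral0.
apply/funext => x; apply/eqP; apply: contra_notT no => px.
by exists phi, x.
Qed.

End line_bump.

(** * Functions of time with values in function spaces *)

Section continuity_in_time.
Context {R : realType} (T : \bar R).
Local Notation leb := (@lebesgue_measure R).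
Implicit Types (F : R -> R) (s t a b : R).

Lemma oitv0T_itv : oitv0T T = set0 \/ oitv0T T = `]0, +oo[%classic \/
  exists T0 : R, oitv0T T = `]0, T0[%classic.
Proof.
rewrite /oitv0T; case: T => [T0| |].
- right; right; exists T0; apply/seteqP; split=> t /=.
    by rewrite in_itv /= lte_fin => -[-> ->].
  by rewrite in_itv /= lte_fin => /andP[].
- right; left; apply/seteqP; split=> t /=; rewrite in_itv /= andbT ?ltry//.
  by move=> [].
- by left; apply/seteqP; split=> t //= [].
Qed.

Lemma oitv0T_open : open (oitv0T T).
Proof.
have [->|[->|[T0 ->]]] := oitv0T_itv; first exact: open0.
  exact: interval_open.
exact: interval_open.
Qed.

Lemma oitv0T_measurable : measurable (oitv0T T).
Proof.
have [->|[->|[T0 ->]]] := oitv0T_itv; first exact: measurable0.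
  exact: measurable_itv.
exact: measurable_itv.
Qed.

Lemma oitv0T_nbhs t : oitv0T T t -> nbhs t (oitv0T T).
Proof. by have := oitv0T_open; rewrite openE => + /[dup] Tt => /(_ t Tt). Qed.

Lemma oitv0TW t : oitv0T T t -> itv0T T t.
Proof. by move=> [/ltW]. Qed.

Lemma itv0T_nbhs t : oitv0T T t -> nbhs t (itv0T T).
Proof. by move=> /oitv0T_nbhs; apply: filterS => s; exact: oitv0TW. Qed.

Lemma itv0T_sub t a b : 0 <= a -> (b%:E < T)%E -> t \in `[a, b] -> itv0T T t.
Proof.
move=> a0 bT; rewrite in_itv /= => /andP[at_ tb]; split; first exact: le_trans at_.
by apply: le_lt_trans bT; rewrite lee_fin.
Qed.

Lemma oitv0T_sub t a b : 0 < a -> (b%:E < T)%E -> t \in `[a, b] -> oitv0T T t.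
Proof.
move=> a0 bT; rewrite in_itv /= => /andP[at_ tb]; split; first exact: lt_le_trans at_.
by apply: le_lt_trans bT; rewrite lee_fin.
Qed.

Lemma lt_real_between b : (b%:E < T)%E -> exists2 tau : R, b < tau & (tau%:E < T)%E.
Proof.
case: T => [T0| |//]; last by move=> _; exists (b + 1); rewrite ?ltrDl// ltry.
by rewrite lte_fin => bT; exists ((b + T0) / 2); rewrite ?lte_fin; lra.
Qed.

Definition cont0T F :=
  forall t, itv0T T t -> F s @[s --> within (itv0T T) (nbhs t)] --> F t.

Lemma cont0T_for F t : cont0T F -> oitv0T T t -> {for t, continuous F}.
Proof.
move=> cF Tt A /(cF t (oitv0TW Tt)) AF.
have {}AF : nbhs t [set s | itv0T T s -> A (F s)] := AF.
by apply: filterS2 (itv0T_nbhs Tt) AF => s Ts; exact.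
Qed.

Lemma cont0T_at F a b t : cont0T F -> 0 <= a -> (b%:E < T)%E -> t \in `[a, b] ->
  F s @[s --> within `[a, b] (nbhs t)] --> F t.
Proof.
move=> cF a0 bT tab A /(cF t (itv0T_sub a0 bT tab)) AF.
have {}AF : nbhs t [set s | itv0T T s -> A (F s)] := AF.
by apply: filterS AF => s + sab; apply; exact: itv0T_sub sab.
Qed.

Lemma cont0T_within F a b : cont0T F -> 0 <= a -> (b%:E < T)%E ->
  {within `[a, b], continuous F}.
Proof.
move=> cF a0 bT; apply/subspace_continuousP => t tab.
exact: cont0T_at.
Qed.

Lemma cont0T_integrable F a b : cont0T F -> 0 <= a -> (b%:E < T)%E ->
  leb.-integrable `[a, b] (EFin \o F).
Proof. by move=> cF a0 bT; apply: continuous_integrable_itv; exact: cont0T_within. Qed.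

Lemma cont0T_measurable F : cont0T F -> measurable_fun (oitv0T T) F.
Proof.
move=> cF; apply: open_continuous_measurable_fun; first exact: oitv0T_open.
by move=> t /set_mem Tt; exact: cont0T_for.
Qed.

Lemma cont0T_cst (k : R) : cont0T (fun=> k).
Proof. by move=> t _; exact: cvg_cst. Qed.

Lemma cont0T_id : cont0T (fun t => t).
Proof. by move=> t _ A At; apply: filterS At => s As _. Qed.

Lemma cont0TD F G : cont0T F -> cont0T G -> cont0T (fun t => F t + G t).
Proof. move=> cF cG t Tt; exact: (cvgD (cF t Tt) (cG t Tt)). Qed.

Lemma cont0TM F G : cont0T F -> cont0T G -> cont0T (fun t => F t * G t).
Proof. move=> cF cG t Tt; exact: (cvgM (cF t Tt) (cG t Tt)). Qed.

Lemma cont0TN F : cont0T F -> cont0T (fun t => - F t).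
Proof. move=> cF t Tt; exact: (cvgN (cF t Tt)). Qed.

Lemma cont0T_sum (N : nat) (F : nat -> R -> R) : (forall k, cont0T (F k)) ->
  cont0T (fun t => \sum_(k < N) F k t).
Proof.
move=> cF; elim: N => [|N IH].
  by under eq_fun do rewrite big_ord0; exact: cont0T_cst.
by under eq_fun do rewrite big_ord_recr; exact: cont0TD.
Qed.

Lemma near_itv0T t : \forall s \near within (itv0T T) (nbhs t), itv0T T s.
Proof. exact: withinT. Qed.

Lemma cont0T_inner (X : Type) (V : (X -> R) -> Prop) B (u v : R -> X -> R) :
  semi_inner V B ->
  continuous_into T V (fun f => Num.sqrt (B f f)) u ->
  continuous_into T V (fun f => Num.sqrt (B f f)) v ->
  cont0T (fun t => B (u t) (v t)).
Proof.
move=> VB [Vu cu] [Vv cv] t Tt; apply: (semi_inner_cvg VB) => //.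
- by apply: filterS (near_itv0T t) => s; exact: Vu.
- by apply: filterS (near_itv0T t) => s; exact: Vv.
- exact: Vu.
- exact: Vv.
- exact: cu.
- exact: cv.
Qed.

Lemma continuous_into_cst (X : Type) (V : (X -> R) -> Prop) B (v : X -> R) :
  semi_inner V B -> V v ->
  continuous_into T V (fun f => Num.sqrt (B f f)) (fun=> v).
Proof.
move=> VB Vv; split=> // t _.
have -> : v \- v = (fun=> 0) by apply/funext => x /=; rewrite subrr.
by rewrite (semi_inner0l VB Vv (semi_inner0V VB Vv)) sqrtr0; exact: cvg_cst.
Qed.

End continuity_in_time.

(** [h] may fail to be measurable, so it is replaced by the smallest function the pointwise bound
    allows, [m] = max(0, - Psi / eta). It is measurable and at most [h] almost everywhere, so its
    integral is at most [C] by monotonicity of lower integrals. *)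
Lemma lower_integral_bound (R : realType) (D : set R) (h Psi : R -> R) (eta C : R) :
  measurable D -> 0 < eta ->
  (@lebesgue_measure R).-integrable D (EFin \o Psi) -> (forall t, 0 <= h t) ->
  {ae (@lebesgue_measure R), forall t, D t -> - (eta * h t) <= Psi t} ->
  (\int[@lebesgue_measure R]_(t in D) (h t)%:E <= C%:E)%E ->
  - (eta * C) <= \int[@lebesgue_measure R]_(t in D) Psi t.
Proof.
move=> mD eta0 iPsi h0 hPsi hC.
pose m t := Num.max 0 (- (eta^-1 * Psi t)).
have imP : (@lebesgue_measure R).-integrable D (EFin \o (fun t => `|eta^-1 * Psi t|)).
  by apply: integrable_norm => //; exact: integrable_EFinZ.
have mPsi : measurable_fun D Psi by apply/measurable_EFinP; exact: measurable_int iPsi.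
have mm : measurable_fun D m.
  apply: measurable_maxr; first exact: measurable_cst.
  by apply: measurableT_comp => //; exact: measurable_funM.
have im : (@lebesgue_measure R).-integrable D (EFin \o m).
  apply: le_integrable imP => //; first exact/measurable_EFinP.
  move=> t _ /=; rewrite lee_fin normr_id /m; move: (eta^-1 * Psi t) => x.
  by rewrite ger0_norm ?le_max ?lexx// ge_max normr_ge0 /= -normrN ler_norm.
have mC : \int[@lebesgue_measure R]_(t in D) m t <= C.
  rewrite -lee_fin fineK; last exact: integrable_fin_num.
  apply: le_trans hC; apply: ae_le_integral_ge0.
  - by move=> t _; rewrite lee_fin le_max lexx.
  - by move=> t _; rewrite lee_fin.
  move: hPsi; apply: filterS => t ht Dt; rewrite lee_fin ge_max h0 /=.
  by rewrite lerNl -ler_pdivrMl ?invr_gt0// invrK mulrN ht.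
have : - eta * C <= \int[@lebesgue_measure R]_(t in D) (- eta * m t).
  by rewrite RintegralZl// !mulNr lerN2 ler_wpM2l// ltW.
rewrite mulNr => /le_trans; apply.
apply: le_Rintegral => //; first exact: integrable_EFinZ.
move=> t _; rewrite mulNr lerNl -ler_pdivrMl// mulrN.
by rewrite le_max lexx orbT.
Qed.

(** * Duality with H^{-1} *)

Section dual_space.
Context {R : realType} {n : nat} (Om : set 'rV[R]_n) (oOm : open Om).
Variables (lam : nat -> R) (e : nat -> 'rV[R]_n -> R).
Hypothesis eigen : dirichlet_eigenpairs Om lam e.
Local Notation leb := (@lebesgue_measure R).
Let HS := H10_semi_inner oOm eigen.
Implicit Types (F G : ('rV[R]_n -> R) -> R) (v w : 'rV[R]_n -> R).

Lemma inHm1_closed a F G : inHm1 Om F -> inHm1 Om G ->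
  inHm1 Om (fun v => a * F v + G v).
Proof.
move=> [lF [C FC]] [lG [C' GC]]; split=> [b v w v0 w0|].
  by rewrite lF// lG//; ring.
exists (`|a| * C + C') => v v0; apply: le_trans (ler_normD _ _) _.
by rewrite normrM mulrDl -mulrA lerD ?GC// ler_wpM2l ?FC.
Qed.

Lemma inHm1_sum (I : Type) (r : seq I) (a : I -> R) (c : I -> ('rV[R]_n -> R) -> R) :
  (forall i, inHm1 Om (c i)) -> inHm1 Om (fun v => \sum_(i <- r) a i * c i v).
Proof.
move=> cN; elim: r => [|i r IH].
  split=> [b v w _ _|]; first by rewrite !big_nil mulr0 addr0.
  by exists 0 => v _; rewrite big_nil normr0 mul0r.
under eq_fun do rewrite big_cons.
exact: inHm1_closed.
Qed.

Lemma Hm1_sub F v w : inHm1 Om F -> inH10 Om v -> inH10 Om w ->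
  F (v \- w) = F v - F w.
Proof.
move=> [lF _] v0 w0; have := lF (-1) w v w0 v0.
rewrite mulN1r [RHS]addrC => <-; congr F.
by apply/funext => x; rewrite mulN1r addrC.
Qed.

Let Hm1_ub F : inHm1 Om F ->
  exists C, ubound [set `|F v| | v in [set v | inH10 Om v /\ H1norm Om v <= 1]] C.
Proof.
move=> [_ [C FC]]; exists `|C| => _ [v [v0 v1] <-].
apply: le_trans (FC v v0) _; apply: le_trans (ler_norm _) _.
by rewrite normrM ler_piMr// ger0_norm ?sqrtr_ge0.
Qed.

(** On functions the H^1 norm is only a seminorm: a [v] of norm 0 is treated by the boundedness
    constant of [F], any other one is normalised so as to enter the supremum. *)
Lemma Hm1_bound F v : inHm1 Om F -> inH10 Om v ->
  `|F v| <= Hm1norm Om F * H1norm Om v.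
Proof.
move=> F1 v0; have [C' ubF] := Hm1_ub F1; have [lF [C FC]] := F1.
have N0 : 0 <= H1norm Om v by exact: sqrtr_ge0.
have [v_0|v_n0] := eqVneq (H1norm Om v) 0.
  by have := FC v v0; rewrite v_0 !mulr0.
have Npos : 0 < H1norm Om v by rewrite lt_neqAle eq_sym v_n0.
have z0 : inH10 Om (fun=> 0) := semi_inner0V HS v0.
have Fz : F (fun=> 0) = 0.
  by apply/eqP; rewrite -normr_le0; apply: le_trans (FC _ z0) _;
    rewrite (H1normE oOm eigen (inH10_H1 z0)) (semi_inner0l HS z0 z0) sqrtr0 mulr0.
pose k := (H1norm Om v)^-1.
have kv : inH10 Om (fun x => k * v x) := semi_innerZV HS k v0.
have Fk : F (fun x => k * v x) = k * F v.
  have := lF k v _ v0 z0; rewrite Fz addr0 => <-; congr F.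
  by apply/funext => x; rewrite addr0.
rewrite -ler_pdivrMr// mulrC -[X in X * _](ger0_norm (x := k)) ?invr_ge0//.
rewrite -normrM -Fk; apply: ub_le_sup; first by exists C'.
exists (fun x => k * v x) => //; split=> //.
rewrite (H1normE oOm eigen (inH10_H1 kv)) (semi_innerZZ HS k v0).
rewrite sqrtrM ?sqr_ge0// sqrtr_sqr ger0_norm ?invr_ge0//.
by rewrite -(H1normE oOm eigen (inH10_H1 v0)) mulVf.
Qed.

Lemma Hm1norm_ge0 F : inHm1 Om F -> 0 <= Hm1norm Om F.
Proof.
move=> F1; have [C' ubF] := Hm1_ub F1.
have z0 : inH10 Om (fun=> 0) := semi_inner0V HS (eigenfunction_H10 eigen 0%N).
apply: (@le_trans _ _ `|F (fun=> 0)|) => //; apply: ub_le_sup; first by exists C'.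
exists (fun=> 0) => //; split=> //.
by rewrite (H1normE oOm eigen (inH10_H1 z0)) (semi_inner0l HS z0 z0) sqrtr0.
Qed.

(** The pairing with a fixed [v] is an almost everywhere limit of pairings of simple functions,
    hence has a measurable representative. Its integrability follows from the square integrability
    of the dual norm by |x| <= 1 + x^2, after division by a positive majorant of the norm of [v]. *)
Lemma Hm1_pairing_measurable T (utt : R -> ('rV[R]_n -> R) -> R) v :
  L2loc T (inHm1 Om) (Hm1norm Om) utt -> inH10 Om v ->
  exists r : R -> R, [/\ measurable_fun (oitv0T T) r,
    {ae leb, forall t, oitv0T T t -> utt t v = r t} &
    forall tau, oitv0T T tau -> leb.-integrable `]0, tau[ (EFin \o r)].
Proof.
move=> [Vu [s [ss scv]] L2u] v0.
have s1 k t : inHm1 Om (s k t).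
  have [m [E [c [Ec ->]]]] := ss k.
  by apply: inHm1_sum => i; exact: (Ec _).2.
have [r mr rE] : exists2 r, measurable_fun (oitv0T T) r &
    {ae leb, forall t, oitv0T T t -> utt t v = r t}.
  apply: (ae_cvg_measurable (mu := leb) (g := fun k t => s k t v)).
    move=> k; have [m [E [c [Ec ->]]]] := ss k.
    apply: measurable_sum => i; apply: measurable_funM; last exact: measurable_cst.
    by apply: measurable_indic; exact: (Ec i).1.
  apply: filterS2 Vu scv => t Vt st Tt; have {}Vt := Vt Tt.
  have {}st := st Tt.
  apply/cvgrPdist_le => eps eps0.
  have e1 : 0 < eps / (H1norm Om v + 1) by rewrite divr_gt0// ltr_wpDl// sqrtr_ge0.
  have /cvgrPdist_le/(_ _ e1) := st; apply: filterS => k.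
  have d1 : inHm1 Om (utt t \- s k t).
    have := inHm1_closed (-1) (s1 k t) Vt; congr (inHm1 Om _).
    by apply/funext => w; rewrite mulN1r addrC.
  rewrite sub0r normrN ger0_norm ?Hm1norm_ge0// => h.
  apply: le_trans (Hm1_bound d1 v0) _.
  apply: (@le_trans _ _ (eps / (H1norm Om v + 1) * (H1norm Om v + 1))).
    by apply: ler_pM => //; rewrite ?Hm1norm_ge0 ?sqrtr_ge0 ?lerDl.
  by rewrite divfK// gt_eqF// ltr_wpDl// sqrtr_ge0.
exists r; split=> // tau Ttau.
have sub : `]0%R, tau[ `<=` oitv0T T.
  move=> t /=; rewrite in_itv /= => /andP[t0 tt]; split=> //.
  by apply: lt_trans Ttau.2; rewrite lte_fin.
have mr' : measurable_fun `]0%R, tau[ r := measurable_funS (oitv0T_measurable T) sub mr.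
pose K := H1norm Om v + 1.
have K0 : 0 < K by rewrite ltr_wpDl// sqrtr_ge0.
have L2r : leb.-integrable `]0%R, tau[ (EFin \o (fun t => (K^-1 * r t) ^+ 2)).
  apply/integrableP; split.
    by apply/measurable_EFinP; apply: measurable_funX; exact: measurable_funM.
  apply: le_lt_trans (L2u tau Ttau); apply: ae_le_integral_ge0.
  - by [].
  - by move=> t _; rewrite lee_fin sqr_ge0.
  apply: filterS2 Vu rE => t Vt rt tt; have Tt := sub _ tt.
  rewrite /= lee_fin normrX ler_sqr ?nnegrE ?Hm1norm_ge0//; last exact: Vt.
  rewrite -(rt Tt) normrM ger0_norm ?invr_ge0 ?(ltW K0)// ler_pdivrMl//.
  apply: le_trans (Hm1_bound (Vt Tt) v0) _.
  by rewrite mulrC ler_wpM2r ?Hm1norm_ge0 ?lerDl//; exact: Vt.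
have c1 : leb.-integrable `[0%R, tau] (EFin \o (fun=> 1 : R)).
  by apply: continuous_integrable_itv; apply: continuous_subspaceT => ?; exact: cvg_cst.
have c1o : leb.-integrable `]0%R, tau[ (EFin \o (fun=> 1 : R)).
  apply: integrableS c1 => //.
  by apply: subset_itv; rewrite !bnd_simp.
have i1 : leb.-integrable `]0%R, tau[ (EFin \o (fun t => 1 + (K^-1 * r t) ^+ 2)).
  exact: integrable_EFinD.
have iK : leb.-integrable `]0%R, tau[ (EFin \o (fun t => K * (1 + (K^-1 * r t) ^+ 2))).
  exact: integrable_EFinZ.
apply: le_integrable iK => //; first exact/measurable_EFinP.
move=> t _ /=; rewrite lee_fin.
have rE' : r t = K * (K^-1 * r t) by rewrite mulVKf// gt_eqF.
rewrite {1}rE'; move: (K^-1 * r t) => x; rewrite !normrM ler_wpM2l//.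
rewrite [leRHS]ger0_norm ?addr_ge0 ?sqr_ge0// -real_normK ?num_real//.
by move: `|x| (normr_ge0 x) => y y0; nra.
Qed.

End dual_space.

Lemma is_derive_of_quotient (R : realType) (f : R -> R) (t l : R) :
  (f s - f t) / (s - t) @[s --> t^'] --> l -> is_derive t (1 : R) f l.
Proof.
move=> fl.
have H : h^-1 *: ((f \o shift t) (h *: (1 : R)) - f t) @[h --> 0^'] --> l.
  apply/cvgrPdist_lt => eps eps0.
  have /cvgrPdist_lt/(_ _ eps0) := fl.
  rewrite /dnbhs /within /= => /nbhs_ballP[d /= d0 dP].
  apply/nbhs_ballP; exists d => //= h; rewrite /ball /= sub0r normrN => hd h0.
  have := dP (h + t); rewrite /ball /= opprD addrCA subrr addr0 normrN => /(_ hd).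
  rewrite -subr_eq0 addrK => /(_ h0).
  by rewrite [h *: 1]mulr1 [_ *: _]mulrC.
by apply: DeriveDef; [apply/cvg_ex; exists l; exact: H|exact: cvg_lim H].
Qed.

Lemma is_derive_increment (R : realType) (f : R -> R) (t l del : R) :
  is_derive t (1 : R) f l -> 0 < del ->
  exists2 d, 0 < d & forall s, t < s -> s < t + d ->
    f s - f t <= (l + del) * (s - t).
Proof.
move=> [df dl] del0.
have H : h^-1 *: ((f \o shift t) (h *: (1 : R)) - f t) @[h --> 0^'] --> l.
  by rewrite -dl; exact: df.
have /cvgrPdist_le/(_ _ del0)/within_nbhsP[d d0 dP] := H.
exists d => // s ts sd; have h0 : 0 < s - t by rewrite subr_gt0.
have hd : `|s - t - 0| < d by rewrite subr0 gtr0_norm// ltrBlDl.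
have := dP (s - t) hd; rewrite /= gt_eqF// => /(_ isT).
rewrite [(s - t) *: 1]mulr1 subrK ler_distlC => /andP[_].
by rewrite [_ *: _]mulrC ler_pdivrMr.
Qed.

(** * Energy solutions *)

Section solution.
Context {R : realType} {n : nat} (Om : set 'rV[R]_n) (oOm : open Om).
Variables (lam : nat -> R) (e : nat -> 'rV[R]_n -> R).
Hypothesis eigen : dirichlet_eigenpairs Om lam e.
Variables (theta : R) (theta01 : 0 <= theta <= 1) (p : R).
Variables (u0 u1 : 'rV[R]_n -> R) (T : \bar R) (u ut : R -> 'rV[R]_n -> R).
Variables (utt : R -> ('rV[R]_n -> R) -> R).
Hypothesis sol : energy_solution_with Om lam e theta p u0 u1 T u ut utt.
Local Notation leb := (@lebesgue_measure R).
Local Notation Ath := (Apow Om lam e (theta / 2)).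
Local Notation wt k := (lam k `^ (2 * (theta / 2))).
Let mOm := open_measurable_rV oOm.
Let LS := inL2_semi_inner mOm.
Let HS := H10_semi_inner oOm eigen.
Let e2 := eigenfunction_L2 eigen.
Implicit Types (s t : R) (v : 'rV[R]_n -> R).

Lemma theta_half01 : 0 <= 2 * (theta / 2) <= 1.
Proof. by rewrite mulrC divfK// pnatr_eq0. Qed.

Lemma sol_H10 t : itv0T T t -> inH10 Om (u t).
Proof. exact: (sol_u_cont sol).1. Qed.

Lemma sol_L2 t : itv0T T t -> inL2 Om (u t).
Proof. by move=> Tt; exact: inH1_L2 (inH10_H1 (sol_H10 Tt)). Qed.

Lemma sol_t_L2 t : itv0T T t -> inL2 Om (ut t).
Proof. exact: (sol_ut_cont sol).1. Qed.

Lemma sol_Apow_L2 t : itv0T T t -> inL2 Om (Ath (u t)).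
Proof. by move=> Tt; exact: (Apow_L2 oOm eigen theta_half01 (sol_H10 Tt)). Qed.

Lemma sol_cont_H1 :
  continuous_into T (inH10 Om) (fun f => Num.sqrt (H1inner Om f f)) u.
Proof.
split=> t Tt; first exact: sol_H10.
have c := (sol_u_cont sol).2 t Tt.
apply: cvg_trans c; apply: near_eq_cvg.
apply: filterS (near_itv0T T t) => s Ts.
apply: (H1normE oOm eigen); apply: inH10_H1.
exact: (semi_inner_subV HS (sol_H10 Ts) (sol_H10 Tt)).
Qed.

Lemma sol_cont_L2 : continuous_into T (inL2 Om) (L2norm Om) u.
Proof.
split=> t Tt; first exact: sol_L2.
apply: squeeze_cvgr ((sol_u_cont sol).2 t Tt); last exact: (@cvg_cst R 0).
by apply: nearW => s; rewrite sqrtr_ge0 L2norm_le_H1norm.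
Qed.

Lemma sol_cont_Apow : continuous_into T (inL2 Om) (L2norm Om) (fun t => Ath (u t)).
Proof.
split=> t Tt; first exact: sol_Apow_L2.
apply: squeeze_cvgr ((sol_u_cont sol).2 t Tt); last exact: (@cvg_cst R 0).
apply: filterS (near_itv0T T t) => s Ts; rewrite sqrtr_ge0 /=.
exact: (Apow_dist oOm eigen theta_half01 (sol_H10 Ts) (sol_H10 Tt)).
Qed.

Lemma cont_norm : cont0T T (fun t => inner Om (u t) (u t)).
Proof. exact: (cont0T_inner LS sol_cont_L2 sol_cont_L2). Qed.

Lemma cont_norm_t : cont0T T (fun t => inner Om (ut t) (ut t)).
Proof. exact: (cont0T_inner LS (sol_ut_cont sol) (sol_ut_cont sol)). Qed.

Lemma cont_moment : cont0T T (fun t => inner Om (ut t) (u t)).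
Proof. exact: (cont0T_inner LS (sol_ut_cont sol) sol_cont_L2). Qed.

Lemma cont_Apow : cont0T T (fun t => inner Om (Ath (u t)) (Ath (u t))).
Proof. exact: (cont0T_inner LS sol_cont_Apow sol_cont_Apow). Qed.

Lemma cont_grad : cont0T T (fun t => grad_inner Om (u t) (u t)).
Proof.
have := cont0TD (cont0T_inner HS sol_cont_H1 sol_cont_H1) (cont0TN cont_norm).
congr (cont0T T _); apply/funext => t.
by rewrite /H1inner addrAC subrr add0r.
Qed.

Lemma cont_inner v : inL2 Om v -> cont0T T (fun t => inner Om (u t) v).
Proof.
by move=> v2; exact: (cont0T_inner LS sol_cont_L2 (continuous_into_cst T LS v2)).
Qed.

Lemma cont_inner_t v : inL2 Om v -> cont0T T (fun t => inner Om (ut t) v).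
Proof.
by move=> v2; exact: (cont0T_inner LS (sol_ut_cont sol) (continuous_into_cst T LS v2)).
Qed.

Definition quotient t s : 'rV[R]_n -> R := fun x => (u s x - u t x) / (s - t).

Lemma quotientE t s : quotient t s = (fun x => (s - t)^-1 * (u s \- u t) x).
Proof. by apply/funext => x; rewrite /quotient mulrC. Qed.

Lemma quotient_L2 t s : itv0T T t -> itv0T T s -> inL2 Om (quotient t s).
Proof.
move=> Tt Ts; rewrite quotientE; apply: (semi_innerZV LS).
exact: (semi_inner_subV LS (sol_L2 Ts) (sol_L2 Tt)).
Qed.

Lemma inner_quotient t s v : itv0T T t -> itv0T T s -> inL2 Om v ->
  inner Om (quotient t s) v = (inner Om (u s) v - inner Om (u t) v) / (s - t).
Proof.
move=> Tt Ts v2; rewrite quotientE.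
have d2 := semi_inner_subV LS (sol_L2 Ts) (sol_L2 Tt).
by rewrite (semi_innerZl LS _ d2 v2) (semi_innerBl LS (sol_L2 Ts) (sol_L2 Tt) v2) mulrC.
Qed.

Lemma near_dnbhs t : oitv0T T t -> \forall s \near t^', itv0T T s.
Proof. by move=> /itv0T_nbhs; apply: cvg_within. Qed.

(** A product-rule step. The second factor may move with [s]: it is taken fixed, equal to u(s), or
    equal to u_t(s) in the three uses. *)
Lemma quotient_cvg t (z : R -> 'rV[R]_n -> R) z0 : oitv0T T t ->
  (\forall s \near t^', inL2 Om (z s)) -> inL2 Om z0 ->
  L2norm Om (z s \- z0) @[s --> t^'] --> (0 : R) ->
  inner Om (quotient t s) (z s) @[s --> t^'] --> inner Om (ut t) z0.
Proof.
move=> Tt z2 z02 cz; have Tt' := oitv0TW Tt.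
have cq : L2norm Om (quotient t s \- ut t) @[s --> t^'] --> (0 : R).
  have c := sol_ut_derivative sol Tt'.
  apply: cvg_trans c => A AF.
  by apply: filterS2 (near_dnbhs Tt) AF => s Ts; exact.
apply: (semi_inner_cvg LS _ z2 (sol_t_L2 Tt') z02 cq cz).
by apply: filterS (near_dnbhs Tt) => s Ts; exact: quotient_L2.
Qed.

Lemma within_dnbhs t (V : ('rV[R]_n -> R) -> Prop) N (z : R -> 'rV[R]_n -> R) :
  oitv0T T t -> continuous_into T V N z -> N (z s \- z t) @[s --> t^'] --> (0 : R).
Proof.
move=> Tt [_ /(_ t (oitv0TW Tt)) c]; apply: cvg_trans c => A AF.
have {}AF : nbhs t [set s | itv0T T s -> A (N (z s \- z t))] := AF.
apply: (cvg_within (F := nbhs t)).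
by apply: filterS2 (itv0T_nbhs Tt) AF => s Ts; exact.
Qed.

Lemma cvg_L2norm_sub (F : set_system R) {FF : Filter F} v : inL2 Om v ->
  L2norm Om (v \- v) @[_ --> F] --> (0 : R).
Proof.
move=> v2; rewrite (_ : L2norm Om (v \- v) = 0); first exact: cvg_cst.
rewrite (_ : v \- v = (fun=> 0)); last by apply/funext => x /=; rewrite subrr.
by rewrite /L2norm (semi_inner0l LS v2 (semi_inner0V LS v2)) sqrtr0.
Qed.

Lemma is_derive_inner t v : oitv0T T t -> inL2 Om v ->
  is_derive t (1 : R) (fun t => inner Om (u t) v) (inner Om (ut t) v).
Proof.
move=> Tt v2; apply: is_derive_of_quotient.
have c : inner Om (quotient t s) v @[s --> t^'] --> inner Om (ut t) v.
  by apply: (quotient_cvg (z := fun=> v) Tt _ v2); [exact: nearW|exact: cvg_L2norm_sub].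
apply: cvg_trans c; apply: near_eq_cvg.
by apply: filterS (near_dnbhs Tt) => s Ts; rewrite inner_quotient//; exact: oitv0TW.
Qed.

Lemma is_derive_norm t : oitv0T T t ->
  is_derive t (1 : R) (fun t => inner Om (u t) (u t)) (2 * inner Om (ut t) (u t)).
Proof.
move=> Tt; apply: is_derive_of_quotient; have Tt' := oitv0TW Tt.
have cu := within_dnbhs Tt sol_cont_L2.
have u2 : \forall s \near t^', inL2 Om (u s).
  by apply: filterS (near_dnbhs Tt) => s; exact: sol_L2.
have c : inner Om (quotient t s) (u s) @[s --> t^'] --> inner Om (ut t) (u t).
  exact: (quotient_cvg Tt u2 (sol_L2 Tt') cu).
have c0 : inner Om (quotient t s) (u t) @[s --> t^'] --> inner Om (ut t) (u t).
  by apply: (quotient_cvg (z := fun=> u t) Tt _ (sol_L2 Tt'));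
    [apply: nearW => _; exact: sol_L2|exact: cvg_L2norm_sub (sol_L2 Tt')].
rewrite mulr2n mulrDl !mul1r.
apply: cvg_trans (cvgD c c0); apply: near_eq_cvg.
apply: filterS (near_dnbhs Tt) => s Ts.
have [ut2 us2] := (sol_L2 Tt', sol_L2 Ts).
transitivity (inner Om (quotient t s) (u s) + inner Om (quotient t s) (u t)) => //.
rewrite !inner_quotient//.
rewrite -mulrDl; congr (_ / _).
by rewrite (semi_innerC LS ut2 us2); ring.
Qed.

(** Spectral truncations of |A^{theta/2} u|^2, |A^{theta/2} u_t|^2 and (A^{theta/2} u_t, A^{theta/2}
    u). They make sense and are continuous at every time, although u_t(t) is known to lie in the
    domain only almost everywhere, and [aN] is differentiable with derivative twice [dN]. *)
Local Notation aN N := (fun t => \sum_(k < N) wt k * inner Om (u t) (e k) ^+ 2).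
Local Notation bN N := (fun t => \sum_(k < N) wt k * inner Om (ut t) (e k) ^+ 2).
Local Notation dN N :=
  (fun t => \sum_(k < N) wt k * (inner Om (ut t) (e k) * inner Om (u t) (e k))).

Lemma cont_aN N : cont0T T (aN N).
Proof.
apply: (cont0T_sum (F := fun k t => wt k * inner Om (u t) (e k) ^+ 2)) => k.
apply: cont0TM; first exact: cont0T_cst.
by apply: cont0TM; apply: cont_inner.
Qed.

Lemma cont_bN N : cont0T T (bN N).
Proof.
apply: (cont0T_sum (F := fun k t => wt k * inner Om (ut t) (e k) ^+ 2)) => k.
apply: cont0TM; first exact: cont0T_cst.
by apply: cont0TM; apply: cont_inner_t.
Qed.

Lemma cont_dN N : cont0T T (dN N).
Proof.
apply: (cont0T_sum
  (F := fun k t => wt k * (inner Om (ut t) (e k) * inner Om (u t) (e k)))) => k.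
apply: cont0TM; first exact: cont0T_cst.
by apply: cont0TM; [exact: cont_inner_t|exact: cont_inner].
Qed.

Lemma is_derive_aN N t : oitv0T T t -> is_derive t (1 : R) (aN N) (2 * dN N t).
Proof.
move=> Tt; elim: N => [|N IH].
  under eq_fun do rewrite big_ord0.
  by rewrite big_ord0 mulr0; exact: is_derive_cst.
under eq_fun do rewrite big_ord_recr.
rewrite big_ord_recr /= mulrDr.
have H := is_derive_inner Tt (e2 N).
have HX := is_deriveX 2 H; have HZ := is_deriveZ (wt N) HX.
have HD := is_deriveD IH HZ.
apply: is_derive_eq HD _; congr (_ + _).
by rewrite /GRing.scale /= expr1; ring.
Qed.

Lemma integral_dN N a b : 0 <= a -> a < b -> (b%:E < T)%E ->
  \int[leb]_(t in `[a, b]) (2 * dN N t) = aN N b - aN N a.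
Proof.
move=> a0 ab bT.
have cd : {within `[a, b], continuous (fun t => 2 * dN N t)}.
  apply: cont0T_within a0 bT; apply: cont0TM; first exact: cont0T_cst.
  exact: cont_dN.
have ca : cont0T T (aN N) by exact: cont_aN.
have oT t : t \in `]a, b[ -> oitv0T T t.
  rewrite in_itv /= => /andP[at_ tb]; split; first exact: le_lt_trans at_.
  by apply: lt_trans bT; rewrite lte_fin.
rewrite /Rintegral (@continuous_FTC2 _ (fun t => 2 * dN N t) (aN N))//.
- split.
  + by move=> t /oT Tt; case: (is_derive_aN N Tt).
  + have h : a \in `[a, b] by rewrite in_itv /= lexx ltW.
    have c := cont0T_at ca a0 bT h; apply: cvg_trans c => A AF.
    have {}AF : nbhs a [set s | s \in `[a, b] -> A (aN N s)] := AF.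
    have nb : nbhs a [set s | s < b] by exact: lt_nbhsl.
    apply: filterS2 AF nb => s sA sb /= sa; apply: sA.
    by rewrite in_itv /= (ltW sa) (ltW sb).
  + have h : b \in `[a, b] by rewrite in_itv /= lexx ltW.
    have c := cont0T_at ca a0 bT h; apply: cvg_trans c => A AF.
    have {}AF : nbhs b [set s | s \in `[a, b] -> A (aN N s)] := AF.
    have nb : nbhs b [set s | a < s] by exact: lt_nbhsr.
    apply: filterS2 AF nb => s sA sa /= sb; apply: sA.
    by rewrite in_itv /= (ltW sa) (ltW sb).
- by move=> t /oT Tt; rewrite derive1E; case: (is_derive_aN N Tt).
Qed.

Lemma aN_ge0 N t : 0 <= aN N t.
Proof. by apply: sumr_ge0 => k _; rewrite mulr_ge0 ?powR_ge0 ?sqr_ge0. Qed.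

Lemma Apow_sqr_cvg v : in_domA Om lam e (theta / 2) v ->
  (fun N : nat => \sum_(k < N) wt k * inner Om v (e k) ^+ 2) @ \oo -->
  inner Om (Ath v) (Ath v).
Proof.
move=> vd; have c := inner_Apow_series oOm eigen vd vd.
by under eq_fun do under eq_bigr do rewrite expr2.
Qed.

Lemma aN_cvg t : itv0T T t -> (fun N => aN N t) @ \oo -->
  inner Om (Ath (u t)) (Ath (u t)).
Proof.
move=> Tt; apply: (Apow_sqr_cvg (v := u t)).
exact: (inH10_domA oOm eigen theta_half01 (sol_H10 Tt)).
Qed.

Lemma sum_le_inner_Apow v N : in_domA Om lam e (theta / 2) v ->
  \sum_(k < N) wt k * inner Om v (e k) ^+ 2 <= inner Om (Ath v) (Ath v).
Proof.
move=> vd; have c := Apow_sqr_cvg vd.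
have nd : nondecreasing_seq
    (fun N : nat => \sum_(k < N) wt k * inner Om v (e k) ^+ 2).
  apply/nondecreasing_seqP => M; rewrite big_ord_recr lerDl.
  by rewrite mulr_ge0 ?powR_ge0 ?sqr_ge0.
rewrite -(cvg_lim _ c)//; apply: (nondecreasing_cvgn_le nd).
by apply/cvg_ex; eexists; exact: c.
Qed.

Lemma aN_le N t : itv0T T t -> aN N t <= inner Om (Ath (u t)) (Ath (u t)).
Proof.
move=> Tt; apply: sum_le_inner_Apow.
exact: (inH10_domA oOm eigen theta_half01 (sol_H10 Tt)).
Qed.

Lemma sol_in_domA : {ae leb, forall t, oitv0T T t -> in_domA Om lam e (theta / 2) (ut t)}.
Proof. by have [] := sol_ut_L2loc sol. Qed.

Definition dissipation t : R :=
  fine (\int[leb]_(s in `[0%R, t]) (L2norm Om (Ath (ut s)) ^+ 2)%:E).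

(** Finiteness comes from the energy inequality itself, whose right side is a real number; so [fine]
    loses nothing. *)
Lemma dissipation_EFin t : itv0T T t ->
  (\int[leb]_(s in `[0%R, t]) (L2norm Om (Ath (ut s)) ^+ 2)%:E)%E = (dissipation t)%:E.
Proof.
move=> Tt; have := sol_energy sol Tt; rewrite /dissipation.
have : (0 <= \int[leb]_(s in `[0%R, t]) (L2norm Om (Ath (ut s)) ^+ 2)%:E)%E.
  by apply: integral_ge0 => s _; rewrite lee_fin sqr_ge0.
by case: (\int[leb]_(s in _) _)%E.
Qed.

Lemma dissipation_ge0 t : itv0T T t -> 0 <= dissipation t.
Proof.
move=> Tt; rewrite -lee_fin -dissipation_EFin//.
by apply: integral_ge0 => s _; rewrite lee_fin sqr_ge0.
Qed.

Lemma dissipation_nd s t : itv0T T t -> s <= t -> 0 <= s -> dissipation s <= dissipation t.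
Proof.
move=> Tt st s0; have Ts : itv0T T s.
  by split=> //; apply: le_lt_trans Tt.2; rewrite lee_fin.
rewrite -lee_fin -!dissipation_EFin//.
have := @integral_superadditive _ _ _ leb `[0%R, t]%classic `[0%R, s]%classic set0
  (fun s => (L2norm Om (Ath (ut s)) ^+ 2)%:E).
rewrite integral_set0 adde0; apply.
- by move=> r _; rewrite lee_fin sqr_ge0.
- by apply: subset_itvl; rewrite bnd_simp.
- by [].
- by rewrite disj_set2E setI0.
Qed.

Lemma energy_dissipation t : itv0T T t ->
  energy Om p (u t) (ut t) + dissipation t <= energy Om p (u 0) (ut 0).
Proof.
by move=> Tt; have := sol_energy sol Tt; rewrite dissipation_EFin// -EFinD lee_fin.
Qed.

(* Applied for all l, this is the Cauchy-Schwarz inequality for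
   (a t - a 0) / 2 = int_0^t (A^{theta/2} u_t, A^{theta/2} u). *)
Lemma dissipation_bound l t : itv0T T t ->
  l * (inner Om (Ath (u t)) (Ath (u t)) - inner Om (Ath (u 0)) (Ath (u 0))) <=
  \int[leb]_(s in `[0, t]) inner Om (Ath (u s)) (Ath (u s)) + l ^+ 2 * dissipation t.
Proof.
move=> Tt; have [t0 tT] := Tt.
have T0 : itv0T T 0 by split=> //; apply: le_lt_trans tT; rewrite lee_fin.
have [t_0|t_n0] := eqVneq t 0.
  rewrite t_0 subrr mulr0; apply: addr_ge0.
    apply: Rintegral_ge0 => s; rewrite /= in_itv /= => /le_anti <-.
    exact: (semi_inner_ge0 LS (sol_Apow_L2 T0)).
  by apply: mulr_ge0; [exact: sqr_ge0|exact: dissipation_ge0].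
have tpos : 0 < t by rewrite lt_neqAle eq_sym t_n0.
(* The bound is proved for each truncation, where increments are integrals of [dN]; its right side
   does not depend on N, so only the left side passes to the limit. *)
have c : (fun N => l * (aN N t - aN N 0)) @ \oo -->
    l * (inner Om (Ath (u t)) (Ath (u t)) - inner Om (Ath (u 0)) (Ath (u 0))).
  exact: (cvgM (cvg_cst l) (cvgB (aN_cvg Tt) (aN_cvg T0))).
rewrite -(cvg_lim _ c)//.
apply: limr_le; first by apply/cvg_ex; eexists; exact: c.
apply: nearW => N; rewrite -integral_dN//.
have m01 : measurable `[0, t]%classic by exact: measurable_itv.
have id : leb.-integrable `[0, t] (EFin \o (fun s => 2 * dN N s)).
  by apply: cont0T_integrable tT => //; apply: cont0TM; [exact: cont0T_cst|exact: cont_dN].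
have ib : leb.-integrable `[0, t] (EFin \o bN N).
  by apply: cont0T_integrable tT => //; exact: cont_bN.
have ia : leb.-integrable `[0, t]
    (EFin \o (fun s => inner Om (Ath (u s)) (Ath (u s)))).
  by apply: cont0T_integrable tT => //; exact: cont_Apow.
rewrite -RintegralZl//.
have iB : leb.-integrable `[0, t] (EFin \o (fun s => l ^+ 2 * bN N s)).
  exact: integrable_EFinZ.
apply: (@le_trans _ _ (\int[leb]_(s in `[0, t])
   (inner Om (Ath (u s)) (Ath (u s)) + l ^+ 2 * bN N s))).
  apply: le_Rintegral => //.
  - exact: integrable_EFinZ.
  - exact: integrable_EFinD.
  move=> s st; have Ts : itv0T T s := itv0T_sub (lexx _) tT st.
  apply: (@le_trans _ _ (aN N s + l ^+ 2 * bN N s)); last by rewrite lerD2r aN_le.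
  rewrite !mulr_sumr -big_split /=; apply: ler_sum => k _.
  have w0 : 0 <= wt k by exact: powR_ge0.
  move: (inner Om (u s) (e k)) (inner Om (ut s) (e k)) => x y.
  have := mulr_ge0 w0 (sqr_ge0 (x - l * y)); lra.
rewrite RintegralD// RintegralZl// lerD2l ler_wpM2l ?sqr_ge0//.
rewrite -lee_fin fineK; last exact: integrable_fin_num.
rewrite -dissipation_EFin//; apply: ae_le_integral_ge0.
- by move=> s _; rewrite lee_fin sumr_ge0// => k _; rewrite mulr_ge0 ?powR_ge0 ?sqr_ge0.
- by move=> s _; rewrite lee_fin sqr_ge0.
have ae0 : {ae leb, forall s, s <> 0}.
  exists [set 0 : R]; split.
  - exact: measurable_set1.
  - by rewrite lebesgue_measure_set1.
  - by move=> s /= /contrapT.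
apply: filterS2 sol_in_domA ae0 => s sd s0 st.
have [_ sT] := itv0T_sub (lexx _) tT st.
have os : oitv0T T s.
  split=> //; rewrite lt_neqAle eq_sym; apply/andP; split; first exact/eqP.
  by move: st; rewrite /= in_itv /= => /andP[].
rewrite lee_fin; apply: le_trans (sum_le_inner_Apow _ (sd os)) _.
by rewrite (semi_norm_sqr LS (ApowP oOm eigen (sd os)).1).
Qed.

(** * Increments of (u_t, u) + a/2 *)

Hypotheses (n_ge1 : (1 <= n)%N) (p_gt1 : 1 < p).

(** The two integrands agree pointwise, so the identity holds whether or not the integral is finite.
    Zeros of [v] are treated apart because powers add up only for a nonzero base. *)
Lemma Lqnorm_pairing v :
  Lqnorm Om (p + 1) v `^ (p + 1) = nonlinear_pairing Om p v v.
Proof.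
have p0 : p + 1 != 0 by rewrite gt_eqF//; have := p_gt1; lra.
rewrite /Lqnorm /nonlinear_pairing -powRrM mulVf// powRr1; last first.
  by apply: Rintegral_ge0 => x _; exact: powR_ge0.
apply: eq_Rintegral => x _; rewrite -mulrA -expr2 -[in RHS]real_normK ?num_real//.
have -> : p + 1 = (p - 1) + 2%:R by rewrite -addrA; congr (_ + _); ring.
have [->|v0] := eqVneq (v x) 0.
  by rewrite normr0 expr0n mulr0 powR0// gt_eqF//; have := p_gt1; lra.
by rewrite powRD ?powR_mulrn// normr_eq0 v0 implybT.
Qed.

(** For a fixed [v] the distributional derivative becomes a scalar one, and the mollification
    argument applies to the measurable representative [r] of the pairing. *)
Lemma moment_increment v : inH10 Om v -> exists r : R -> R, [/\
    {ae leb, forall t, oitv0T T t -> utt t v = r t},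
    forall tau, oitv0T T tau -> leb.-integrable `]0, tau[ (EFin \o r) &
    forall a b, 0 < a -> a < b -> (b%:E < T)%E ->
      inner Om (ut b) v - inner Om (ut a) v = \int[leb]_(t in `[a, b]) r t].
Proof.
move=> v0; have v2 := inH1_L2 (inH10_H1 v0).
have [r [mr rE ir]] := Hm1_pairing_measurable oOm eigen (sol_utt_L2loc sol) v0.
exists r; split=> // a b a0 ab bT.
have [tau btau tauT] := lt_real_between bT.
have [f [L [sf f0 L0 fL]]] := exists_bump oOm n_ge1 eigen.
have Ttau : oitv0T T tau by split=> //; lra.
have cg t : 0 < t -> (t%:E < T)%E -> {for t, continuous (fun t => inner Om (ut t) v)}.
  by move=> t0 tT; apply: (cont0T_for (cont_inner_t v2)).
apply: (weak_derivative_integral sf f0 L0 fL cg (ir tau Ttau) _ a0 ab btau tauT).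
move=> phi tphi; rewrite (sol_utt_derivative sol v0 tphi); congr (- _).
rewrite /Rintegral; congr fine; apply: ae_eq_integral_nonmeasurable.
by apply: filterS rE => t rt Tt; rewrite rt.
Qed.

(** Young's inequality on the modes beyond N only: each mode contributes a nonnegative square to eta
    x^2 + y^2/(4 eta) - x y, so the first N contributions are at most the full sum. The low modes
    stay exact, and for fixed [eta] the tail of [w] vanishes as N grows. *)
Lemma inner_Apow_le v w N eta : in_domA Om lam e (theta / 2) v ->
  in_domA Om lam e (theta / 2) w -> 0 < eta ->
  inner Om (Ath v) (Ath w) <= eta * inner Om (Ath v) (Ath v) +
    (4 * eta)^-1 * (inner Om (Ath w) (Ath w) -
      \sum_(k < N) wt k * inner Om w (e k) ^+ 2) +
    \sum_(k < N) wt k * (inner Om v (e k) * inner Om w (e k)).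
Proof.
move=> vd wd eta0.
pose f k : R := eta * (wt k * inner Om v (e k) ^+ 2) +
  (4 * eta)^-1 * (wt k * inner Om w (e k) ^+ 2) -
  wt k * (inner Om v (e k) * inner Om w (e k)).
have f0 k : 0 <= f k.
  rewrite /f; have : 0 <= wt k by exact: powR_ge0.
  move: (wt k) (inner Om v (e k)) (inner Om w (e k)) => q x y q0.
  have -> : eta * (q * x ^+ 2) + (4 * eta)^-1 * (q * y ^+ 2) - q * (x * y) =
      eta * q * (x - (2 * eta)^-1 * y) ^+ 2 by field; rewrite gt_eqF.
  by apply: mulr_ge0; [apply: mulr_ge0 => //; exact: ltW|exact: sqr_ge0].
have sumE M : \sum_(k < M) f k =
    eta * (\sum_(k < M) wt k * inner Om v (e k) ^+ 2) +
    (4 * eta)^-1 * (\sum_(k < M) wt k * inner Om w (e k) ^+ 2) -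
    \sum_(k < M) wt k * (inner Om v (e k) * inner Om w (e k)).
  by rewrite !mulr_sumr -big_split -sumrB; apply: eq_bigr.
have c : (fun M : nat => \sum_(k < M) f k) @ \oo -->
    eta * inner Om (Ath v) (Ath v) + (4 * eta)^-1 * inner Om (Ath w) (Ath w) -
    inner Om (Ath v) (Ath w).
  under eq_fun do rewrite sumE.
  exact: (cvgB (cvgD (cvgM (cvg_cst eta) (Apow_sqr_cvg vd))
    (cvgM (cvg_cst _) (Apow_sqr_cvg wd))) (inner_Apow_series oOm eigen vd wd)).
have nd : nondecreasing_seq (fun M : nat => \sum_(k < M) f k).
  by apply/nondecreasing_seqP => M; rewrite big_ord_recr lerDl.
have : \sum_(k < N) f k <= eta * inner Om (Ath v) (Ath v) +
    (4 * eta)^-1 * inner Om (Ath w) (Ath w) - inner Om (Ath v) (Ath w).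
  rewrite -(cvg_lim _ c)//; apply: (nondecreasing_cvgn_le nd).
  by apply/cvg_ex; eexists; exact: c.
rewrite sumE; have : 0 <= eta * (\sum_(k < N) wt k * inner Om v (e k) ^+ 2).
  by rewrite mulr_ge0 ?(ltW eta0)// sumr_ge0// => k _; rewrite mulr_ge0 ?powR_ge0 ?sqr_ge0.
rewrite mulrBr; move: (_ * \sum_(k < N) _) => x; move: (_ * \sum_(k < N) _) => y.
move: (\sum_(k < N) _) => z; move: (_ * inner _ _ _) (_ * inner _ _ _) => a b.
lra.
Qed.

Let le_sqrD1 (x : R) : x <= 1 + x ^+ 2.
Proof. have := sqr_ge0 (x - 2^-1); lra. Qed.

Let virial_arith (eta k0 r C D A B h g F : R) : C <= eta * B + A + D ->
  k0 <= - (g - (F + C + g)) -> - (eta * (1 + h)) <= r - F ->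
  - (eta * h) <= r + D + A + eta * B + (eta - k0).
Proof. move=> h1 h2 h3; lra. Qed.

Let cvg_affine2 (f g : nat -> R) (k1 k2 k3 k4 k5 l m : R) :
  f @ \oo --> l -> g @ \oo --> m ->
  (fun N => k1 + k2 * f N + k3 * g N + k4 + k5) @ \oo -->
  k1 + k2 * l + k3 * m + k4 + k5.
Proof.
move=> fl gm; exact: (cvgD (cvgD (cvgD (cvgD (cvg_cst k1) (cvgM (cvg_cst k2) fl))
  (cvgM (cvg_cst k3) gm)) (cvg_cst k4)) (cvg_cst k5)).
Qed.

Let virial_arith2 (X J A k eta k0 b h : R) :
  - X <= J + 2^-1 * A + k * 0 + b + (eta - k0) * h ->
  (k0 - eta) * h - b - X - 2^-1 * A <= J.
Proof. rewrite mulr0 addr0 => ?; lra. Qed.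

(* u_tt is tested with the frozen u t, compared with u r at the cost of
   eta * Hm1norm (utt r), and (A^{theta/2} u_t, A^{theta/2} u) is bounded by its
   N-th partial sum, whose integral is exact, plus a small remainder. *)
Lemma virial_local (Bt : R -> R) s t eta k0 C : 0 < eta -> 0 < t -> t < s ->
  (s%:E < T)%E ->
  (forall r, r \in `[t, s] -> H1norm Om (u t \- u r) <= eta) ->
  (forall r, r \in `[t, s] -> k0 <= - Ifun Om p (u r)) ->
  {ae leb, forall r, oitv0T T r -> inner Om (Ath (ut r)) (Ath (ut r)) = Bt r} ->
  leb.-integrable `[t, s] (EFin \o Bt) ->
  (\int[leb]_(r in `[t, s[) (Hm1norm Om (utt r) ^+ 2)%:E <= C%:E)%E ->
  (k0 - eta) * (s - t) - eta * (\int[leb]_(r in `[t, s]) Bt r) - eta * C -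
    2^-1 * (inner Om (Ath (u s)) (Ath (u s)) - inner Om (Ath (u t)) (Ath (u t))) <=
  inner Om (ut s) (u t) - inner Om (ut t) (u t).
Proof.
move=> eta0 t0 ts sT uts kI BtE iB hC.
have Ts r : r \in `[t, s] -> oitv0T T r := oitv0T_sub t0 sT.
have Tt : oitv0T T t by apply: Ts; rewrite in_itv /= lexx ltW.
have Tss : oitv0T T s by apply: Ts; rewrite in_itv /= lexx ltW.
have ut0 := sol_H10 (oitv0TW Tt).
have [r [rE ir incr]] := moment_increment ut0.
rewrite incr// {incr}.
have [tau stau tauT] := lt_real_between sT.
have Ttau : oitv0T T tau by split=> //; lra.
have mts : measurable `[t, s]%classic by exact: measurable_itv.
have {}ir : leb.-integrable `[t, s] (EFin \o r).
  apply: integrableS (ir _ Ttau) => // q /=; rewrite !in_itv /= => /andP[q1 q2].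
  by rewrite (lt_le_trans t0 q1) (le_lt_trans q2 stau).
pose a q := inner Om (Ath (u q)) (Ath (u q)).
have ca : cont0T T a := cont_Apow.
have ia : leb.-integrable `[t, s] (EFin \o a) by exact: (cont0T_integrable ca (ltW t0) sT).
have iaN N : leb.-integrable `[t, s] (EFin \o (fun q => a q - aN N q)).
  by apply: (cont0T_integrable _ (ltW t0) sT); apply: cont0TD ca (cont0TN _); exact: cont_aN.
have id N : leb.-integrable `[t, s] (EFin \o (fun q => 2 * dN N q)).
  apply: (cont0T_integrable _ (ltW t0) sT).
  by apply: cont0TM; [exact: cont0T_cst|exact: cont_dN].
have ic : leb.-integrable `[t, s] (EFin \o (fun=> eta - k0)).
  by apply: (cont0T_integrable _ (ltW t0) sT); exact: cont0T_cst.
(* At fixed N all terms on the right are gathered in one integral, whose integrand is at least - eta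
   times the squared dual norm almost everywhere. N tends to infinity with [eta] fixed, so the
   factor 1/(4 eta) does no harm. *)
have key N : - (eta * C) <= \int[leb]_(q in `[t, s]) r q +
    2^-1 * (aN N s - aN N t) +
    (4 * eta)^-1 * (\int[leb]_(q in `[t, s]) (a q - aN N q)) +
    eta * (\int[leb]_(q in `[t, s]) Bt q) + (eta - k0) * (s - t).
  rewrite -integral_dN ?(ltW t0)//.
  have i1 : leb.-integrable `[t, s] (EFin \o (fun q => 2^-1 * (2 * dN N q))).
    exact: integrable_EFinZ.
  have i2 : leb.-integrable `[t, s] (EFin \o (fun q => (4 * eta)^-1 * (a q - aN N q))).
    exact: integrable_EFinZ.
  have i3 : leb.-integrable `[t, s] (EFin \o (fun q => eta * Bt q)).
    exact: integrable_EFinZ.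
  have j1 := lebesgue_integrableD mts ir i1.
  have j2 := lebesgue_integrableD mts j1 i2.
  have j3 := lebesgue_integrableD mts j2 i3.
  have j4 := lebesgue_integrableD mts j3 ic.
  have -> : (eta - k0) * (s - t) = \int[leb]_(q in `[t, s]) (eta - k0).
    rewrite /Rintegral integral_cst//= lebesgue_measure_itv /= lte_fin ts.
    by rewrite -EFinB.
  rewrite -RintegralZl// -RintegralZl// -RintegralZl//.
  rewrite -RintegralD// -RintegralD// -RintegralD// -RintegralD//.
  (* The right endpoint is dropped to match the half-open domain in [hC]. *)
  rewrite -Rintegral_itv_bndo_bndc; last first.
    apply: integrableS j4 => //.
    by apply: subset_itvl; rewrite bnd_simp.
  have mo : measurable `[t, s[%classic by exact: measurable_itv.
  apply: (lower_integral_bound mo eta0 _ _ _ hC).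
  - apply: integrableS j4 => //.
    by apply: subset_itvl; rewrite bnd_simp.
  - by move=> q; exact: sqr_ge0.
  have [utt1 _ _] := sol_utt_L2loc sol.
  have eqn := sol_equation sol.
  apply: filterS2 (filterI rE BtE) (filterI (filterI utt1 eqn) sol_in_domA) =>
    q [rq Bq] [[uq eq] dq] qts.
  have qts' : q \in `[t, s].
    by move: qts; rewrite /= !in_itv /= => /andP[-> /ltW ->].
  have Tq := Ts q qts'.
  have {}rq := rq Tq; have {}Bq := Bq Tq; have {}uq := uq Tq; have {}dq := dq Tq.
  have uq0 := sol_H10 (oitv0TW Tq).
  have {}eq := eq Tq (u q) uq0.
  have ud := inH10_domA oOm eigen theta_half01 uq0.
  have hA := inner_Apow_le N dq ud eta0.
  have hd := Hm1_bound oOm eigen uq (semi_inner_subV HS ut0 uq0).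
  rewrite (Hm1_sub uq ut0 uq0) rq in hd.
  have hI := kI q qts'; rewrite /Ifun Lqnorm_pairing -eq in hI.
  have gE : grad_norm Om (u q) ^+ 2 = grad_inner Om (u q) (u q).
    exact: (semi_norm_sqr (grad_semi_inner oOm eigen) (inH10_H1 uq0)).
  rewrite gE in hI.
  have hu := uts q qts'.
  have h0 := Hm1norm_ge0 oOm eigen uq.
  have h1 : Hm1norm Om (utt q) * H1norm Om (u t \- u q) <=
      eta * (1 + Hm1norm Om (utt q) ^+ 2).
    apply: (@le_trans _ _ (Hm1norm Om (utt q) * eta)); first by rewrite ler_wpM2l.
    by rewrite mulrC ler_wpM2l ?(ltW eta0)// le_sqrD1.
  have h3 : - (eta * (1 + Hm1norm Om (utt q) ^+ 2)) <= r q - utt q (u q).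
    by rewrite lerNl; apply: le_trans (le_trans hd h1); rewrite -normrN ler_norm.
  rewrite -Bq mulKf ?pnatr_eq0//.
  exact: (virial_arith hA hI h3).
(* Dominated convergence with majorant [a], since 0 <= aN <= a. *)
have lim0 : \int[leb]_(q in `[t, s]) (a q - aN N q) @[N --> \oo] --> (0 : R).
  have Z : \int[leb]_(q in `[t, s]) 0 = 0 :> R by rewrite /Rintegral integral0.
  rewrite -[X in _ --> X]Z.
  apply: (dominated_lebesgue (g := a) mts _ _ _ ia _).2.
  - by move=> N; apply/measurable_EFinP; exact: (measurable_int _ (iaN N)).
  - exact: measurable_cst.
  - apply: aeW => q qts; have Tq := oitv0TW (Ts q qts).
    have c0 : (fun N => a q - aN N q) @ \oo --> a q - a q.
      exact: (cvgB (cvg_cst (a q)) (aN_cvg Tq)).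
    by rewrite subrr in c0.
  apply: aeW => q N qts; have Tq := oitv0TW (Ts q qts).
  rewrite ger0_norm ?subr_ge0; last exact: aN_le.
  by rewrite gerBl aN_ge0.
have lim : \int[leb]_(q in `[t, s]) r q +
    2^-1 * (aN N s - aN N t) +
    (4 * eta)^-1 * (\int[leb]_(q in `[t, s]) (a q - aN N q)) +
    eta * (\int[leb]_(q in `[t, s]) Bt q) + (eta - k0) * (s - t) @[N --> \oo] -->
    \int[leb]_(q in `[t, s]) r q + 2^-1 * (a s - a t) + (4 * eta)^-1 * 0 +
    eta * (\int[leb]_(q in `[t, s]) Bt q) + (eta - k0) * (s - t).
  have c1 : (fun N => aN N s - aN N t) @ \oo --> a s - a t.
    exact: (cvgB (aN_cvg (oitv0TW Tss)) (aN_cvg (oitv0TW Tt))).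
  exact: cvg_affine2 c1 lim0.
have : - (eta * C) <= \int[leb]_(q in `[t, s]) r q + 2^-1 * (a s - a t) +
    (4 * eta)^-1 * 0 +
    eta * (\int[leb]_(q in `[t, s]) Bt q) + (eta - k0) * (s - t).
  rewrite -(cvg_lim _ lim)//; apply: limr_ge; last exact: nearW.
  by apply/cvg_ex; eexists; exact: lim.
exact: virial_arith2.
Qed.

(** |A^{theta/2} u_t|^2 is the almost everywhere limit of the continuous truncations [bN]. A
    measurable representative is needed because in [virial_local] it is added to other integrands,
    and lower integrals are not additive. *)
Lemma dissipation_density : exists Bt : R -> R, [/\ forall t, 0 <= Bt t,
    {ae leb, forall r, oitv0T T r -> inner Om (Ath (ut r)) (Ath (ut r)) = Bt r} &
    forall a b, 0 < a -> (b%:E < T)%E -> leb.-integrable `[a, b] (EFin \o Bt)].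
Proof.
have [B mB BE] : exists2 B, measurable_fun (oitv0T T) B &
    {ae leb, forall r, oitv0T T r -> inner Om (Ath (ut r)) (Ath (ut r)) = B r}.
  apply: (ae_cvg_measurable (mu := leb) (g := fun N => bN N)).
    by move=> N; apply: cont0T_measurable; exact: cont_bN.
  apply: filterS sol_in_domA => t dt Tt.
  exact: (Apow_sqr_cvg (dt Tt)).
have BE' : {ae leb, forall r, oitv0T T r ->
    inner Om (Ath (ut r)) (Ath (ut r)) = `|B r|}.
  apply: filterS2 BE sol_in_domA => r Br dr Tr; rewrite -Br// ger0_norm//.
  exact: (semi_inner_ge0 LS (ApowP oOm eigen (dr Tr)).1).
exists (fun r => `|B r|); split=> // a b a0 bT.
have sub : `[a, b] `<=` oitv0T T by move=> r; exact: oitv0T_sub.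
have mB' : measurable_fun `[a, b] B by exact: (measurable_funS (oitv0T_measurable T) sub mB).
apply/integrableP; split; first by apply/measurable_EFinP; exact: measurableT_comp.
have [ba|ab] := ltP b a.
  by rewrite set_itv_ge ?integral_set0// bnd_simp -ltNge.
have Tb : itv0T T b by split=> //; lra.
apply: (@le_lt_trans _ _ (dissipation b)%:E); last exact: ltry.
rewrite -dissipation_EFin//.
apply: (@le_trans _ _ (\int[leb]_(s in `[a, b]) (L2norm Om (Ath (ut s)) ^+ 2)%:E)%E).
  apply: ae_le_integral_ge0.
  - by [].
  - by move=> s _; rewrite lee_fin sqr_ge0.
  apply: filterS2 BE' sol_in_domA => r Br dr rab; have Tr := sub r rab.
  rewrite /= normr_id -Br// lee_fin.
  by rewrite (semi_norm_sqr LS (ApowP oOm eigen (dr Tr)).1).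
have := @integral_superadditive _ _ _ leb `[0%R, b]%classic `[a, b]%classic set0
  (fun s => (L2norm Om (Ath (ut s)) ^+ 2)%:E).
rewrite integral_set0 adde0; apply.
- by move=> r _; rewrite lee_fin sqr_ge0.
- by apply: subset_itvr; rewrite bnd_simp ltW.
- by [].
- by rewrite disj_set2E setI0.
Qed.

Definition dual_action t : R :=
  fine (\int[leb]_(r in `]0%R, t[) (Hm1norm Om (utt r) ^+ 2)%:E).

(** Superadditivity of the lower integral over the disjoint pieces []0, t[] and [[t, s[]; it gives
    an inequality, in the direction required of an error bound. *)
Lemma dual_action_le t s : 0 < t -> t <= s -> (s%:E < T)%E ->
  (\int[leb]_(r in `[t, s[) (Hm1norm Om (utt r) ^+ 2)%:E <=
   (dual_action s - dual_action t)%:E)%E.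
Proof.
move=> t0 ts sT; have [_ _ fin] := sol_utt_L2loc sol.
have finE r : 0 < r -> (r%:E < T)%E ->
    (\int[leb]_(q in `]0%R, r[) (Hm1norm Om (utt q) ^+ 2)%:E)%E = (dual_action r)%:E.
  move=> r0 rT; rewrite /dual_action fineK// ge0_fin_numE; first exact: fin.
  by apply: integral_ge0 => q _; rewrite lee_fin sqr_ge0.
rewrite EFinB -(finE t)//; last by apply: le_lt_trans sT; rewrite lee_fin.
rewrite -(finE s)//; last exact: lt_le_trans ts.
have := @integral_superadditive _ _ _ leb `]0%R, s[%classic `]0%R, t[%classic
  `[t, s[%classic (fun q => (Hm1norm Om (utt q) ^+ 2)%:E).
have tT : (t%:E < T)%E by apply: le_lt_trans sT; rewrite lee_fin.
have ft : (\int[leb]_(q in `]0%R, t[) (Hm1norm Om (utt q) ^+ 2)%:E)%E \is a fin_num.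
  by rewrite (finE t).
rewrite (leeBrDl _ _ ft); apply.
- by move=> r _; rewrite lee_fin sqr_ge0.
- by apply: subset_itvl; rewrite bnd_simp.
- by apply: subset_itvr; rewrite bnd_simp.
- rewrite disj_set2E; apply/eqP/seteqP; split=> // r [] /=.
  by rewrite !in_itv /= => /andP[_ rt] /andP[tr _]; move: tr; rewrite leNgt rt.
Qed.

Lemma quotient_cvg_norm_t t : oitv0T T t ->
  inner Om (quotient t s) (ut s) @[s --> t^'] --> inner Om (ut t) (ut t).
Proof.
move=> Tt; apply: quotient_cvg => //; last exact: within_dnbhs (sol_ut_cont sol).
- by apply: filterS (near_dnbhs Tt) => s; exact: sol_t_L2.
- exact: (sol_t_L2 (oitv0TW Tt)).
Qed.

Lemma cont0T_near F t eps : cont0T T F -> oitv0T T t -> 0 < eps ->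
  exists2 d, 0 < d & forall r, `|r - t| < d -> `|F r - F t| <= eps.
Proof.
move=> cF Tt eps0; have /cvgrPdist_le/(_ _ eps0)/nbhs_ballP[d /= d0 dP] := cont0T_for cF Tt.
by exists d => // r rt; rewrite distrC; apply: dP; rewrite /ball /= distrC.
Qed.

Lemma sol_near_H1 t eps : oitv0T T t -> 0 < eps ->
  exists2 d, 0 < d & forall r, `|r - t| < d -> itv0T T r ->
    H1norm Om (u t \- u r) <= eps.
Proof.
move=> Tt eps0; have Tt' := oitv0TW Tt.
have /cvgrPdist_le/(_ _ eps0) := (sol_u_cont sol).2 t Tt'.
move=> /within_nbhsP[d d0 dP]; exists d => // r rt Tr.
have [ut0 ur0] := (sol_H10 Tt', sol_H10 Tr).
have E : H1norm Om (u t \- u r) = H1norm Om (u r \- u t).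
  rewrite (H1normE oOm eigen (inH10_H1 (semi_inner_subV HS ur0 ut0))).
  rewrite (H1normE oOm eigen (inH10_H1 (semi_inner_subV HS ut0 ur0))).
  exact: (semi_normBC HS ut0 ur0).
have h0 : 0 <= H1norm Om (u r \- u t) := sqrtr_ge0 _.
by have := dP r rt Tr; rewrite sub0r normrN (ger0_norm h0) E.
Qed.

Let virial_sum (k y eta h IB C A m1 m2 q : R) : 0 <= h -> y - eta <= q ->
  (k - y - eta - eta) * h - eta * IB - eta * C - 2^-1 * A <= m1 ->
  m2 - m1 = q * h ->
  k * h - (m2 + 2^-1 * A) <= eta * (3 * h + IB + C).
Proof. move=> h0 yq h1 h2; have := ler_wpM2r h0 yq; lra. Qed.

Let virial_ring (k s t m m' a a' : R) :
  k * s - (m + 2^-1 * a) - (k * t - (m' + 2^-1 * a')) =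
  k * (s - t) - (m - m' + 2^-1 * (a - a')).
Proof. ring. Qed.

(** On short intervals [virial_local] gives the estimate up to eta times the increment of one
    nondecreasing function; [le_of_right_local] adds these errors over [[t, s]], and then eta tends
    to 0. *)
Lemma virial_increment t s k : 0 < t -> t < s -> (s%:E < T)%E ->
  (forall r, r \in `[t, s] -> k <= inner Om (ut r) (ut r) - Ifun Om p (u r)) ->
  k * (s - t) <=
  inner Om (ut s) (u s) - inner Om (ut t) (u t) +
  2^-1 * (inner Om (Ath (u s)) (Ath (u s)) - inner Om (Ath (u t)) (Ath (u t))).
Proof.
move=> t0 ts sT kI; have [Bt [Bt0 BtE iB]] := dissipation_density.
pose m r := inner Om (ut r) (u r).
pose a r := inner Om (Ath (u r)) (Ath (u r)).
pose y r := inner Om (ut r) (ut r).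
have [cm ca cy] : [/\ cont0T T m, cont0T T a & cont0T T y].
  by split; [exact: cont_moment|exact: cont_Apow|exact: cont_norm_t].
pose F r := k * r - (m r + 2^-1 * a r).
(* The 3 counts the errors linear in time: continuity of |u_t|^2, the loss inside [virial_local],
   and the difference quotient of u. *)
pose V r := 3 * r + (\int[leb]_(q in `[t, r]) Bt q) + dual_action r.
have Vinc x z : t <= x -> x <= z -> z <= s -> V z - V x =
    3 * (z - x) + \int[leb]_(q in `[x, z]) Bt q + (dual_action z - dual_action x).
  move=> tx xz zs; have zT : (z%:E < T)%E by apply: le_lt_trans sT; rewrite lee_fin.
  have iz := iB t z t0 zT.
  have ixz : leb.-integrable `[x, z] (EFin \o Bt) by apply: iB => //; lra.
  have ixo : leb.-integrable `]x, z] (EFin \o Bt).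
    by apply: integrableS ixz => //; apply: subset_itvr; rewrite bnd_simp.
  have := Rintegral_itvB (x := x) iz.
  rewrite !bnd_simp => /(_ tx xz); rewrite Rintegral_itv_obnd_cbnd// => E.
  rewrite -E /V; ring.
have hT x : t <= x -> x <= s -> oitv0T T x.
  move=> tx xs; apply: (oitv0T_sub t0 sT); first by rewrite in_itv /= tx xs.
have Vmono x z : t <= x -> x <= z -> z <= s -> V x <= V z.
  move=> tx xz zs; rewrite -subr_ge0 Vinc//.
  have d0 : 0 <= dual_action z - dual_action x.
    have zT := (hT z (le_trans tx xz) zs).2.
    rewrite -lee_fin; apply: le_trans (dual_action_le (lt_le_trans t0 tx) xz zT).
    by apply: integral_ge0 => q _; rewrite lee_fin sqr_ge0.
  have i0 : 0 <= \int[leb]_(q in `[x, z]) Bt q by apply: Rintegral_ge0.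
  by apply: addr_ge0 d0; apply: addr_ge0 i0; rewrite mulr_ge0// subr_ge0.
have cF : cont0T T F.
  apply: cont0TD; first by apply: cont0TM; [exact: cont0T_cst|exact: cont0T_id].
  by apply: cont0TN; apply: cont0TD cm _; apply: cont0TM ca; exact: cont0T_cst.
have FE x z : F z - F x = k * (z - x) - (m z - m x + 2^-1 * (a z - a x)).
  exact: virial_ring.
have step eta : 0 < eta -> F s - F t <= eta * (V s - V t).
  move=> eta0; rewrite mulrBr.
  apply: (le_of_right_local (M := fun r => eta * V r) (ltW ts)).
  - by move=> x z tx xz zs; rewrite ler_wpM2l ?(ltW eta0)// Vmono.
  - by move=> r rts; exact: (cont0T_at cF (ltW t0) sT rts).
  move=> t1 tt1 t1s; have Tt1 := hT t1 tt1 (ltW t1s).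
  have [d1 d10 D1] := sol_near_H1 Tt1 eta0.
  have [d2 d20 D2] := cont0T_near cy Tt1 eta0.
  have [d3 d30 D3] : exists2 d, 0 < d & forall r, t1 < r -> r < t1 + d ->
      y t1 - eta <= inner Om (quotient t1 r) (ut r).
    have /cvgrPdist_le/(_ _ eta0) := quotient_cvg_norm_t Tt1.
    move=> /within_nbhsP[d d0 dP]; exists d => // r t1r rd.
    have h1 : `|r - t1| < d by rewrite gtr0_norm ?subr_gt0// ltrBlDl.
    have h2 : r != t1 by rewrite gt_eqF.
    have := dP r h1 h2; rewrite ler_distlC => /andP[+ _].
    exact.
  exists (Num.min d1 (Num.min d2 d3)); first by rewrite !lt_min d10 d20 d30.
  move=> s1 t1s1 s1d s1s.
  have [e1 e2' e3] : [/\ s1 - t1 < d1, s1 - t1 < d2 & s1 < t1 + d3].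
    move: s1d; rewrite -ltrBlDl !lt_min => /and3P[-> -> h]; split=> //.
    by rewrite -ltrBlDl.
  have Ts1 := hT s1 (le_trans tt1 (ltW t1s1)) s1s.
  have t10 : 0 < t1 := lt_le_trans t0 tt1.
  have near r : r \in `[t1, s1] -> `|r - t1| <= s1 - t1 /\ oitv0T T r /\ r \in `[t, s].
    rewrite !in_itv /= => /andP[r1 r2]; split; first by rewrite ger0_norm ?subr_ge0// lerD2r.
    split; first by apply: hT; [exact: le_trans r1|exact: le_trans s1s].
    by rewrite (le_trans tt1 r1) (le_trans r2 s1s).
  have hC := dual_action_le t10 (ltW t1s1) Ts1.2.
  have hu r : r \in `[t1, s1] -> H1norm Om (u t1 \- u r) <= eta.
    by move=> /near[rd [Tr _]]; apply: D1; [exact: le_lt_trans rd _|exact: oitv0TW].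
  have hI r : r \in `[t1, s1] -> k - y t1 - eta <= - Ifun Om p (u r).
    move=> /near[rd [Tr /kI]]; rewrite -/(y r) => h.
    have := D2 r (le_lt_trans rd e2'); rewrite ler_distl => /andP[_ h'].
    move: (y r) (y t1) (Ifun _ _ _) h h' => ? ? ? ? ?; lra.
  have := virial_local eta0 t10 t1s1 Ts1.2 hu hI BtE (iB t1 s1 t10 Ts1.2) hC.
  rewrite -mulrBr Vinc//; last exact: ltW.
  have [Tt1' Ts1'] := (oitv0TW Tt1, oitv0TW Ts1).
  have hq := D3 s1 t1s1 e3.
  have h0 : 0 <= s1 - t1 by rewrite subr_ge0 ltW.
  (* Unfreezing u adds (u_t(s1), u(s1) - u(t1)), a difference quotient paired with u_t times the
     time step; this is the source of the term |u_t|^2. *)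
  move=> hv; have qE : (m s1 - m t1) - (inner Om (ut s1) (u t1) - inner Om (ut t1) (u t1)) =
      inner Om (quotient t1 s1) (ut s1) * (s1 - t1).
    rewrite inner_quotient//; last exact: sol_t_L2.
    rewrite divfK ?subr_eq0 ?gt_eqF// /m.
    rewrite (semi_innerC LS (sol_L2 Ts1') (sol_t_L2 Ts1')).
    rewrite (semi_innerC LS (sol_L2 Tt1') (sol_t_L2 Ts1')); ring.
  by rewrite FE; exact: (virial_sum h0 hq hv qE).
suff : F s - F t <= 0 by rewrite FE subr_le0.
apply/ler_addgt0Pr => eps eps0; rewrite add0r.
have W0 : 0 <= V s - V t by rewrite subr_ge0 Vmono ?(ltW ts).
have W1 : 0 < V s - V t + 1 by rewrite ltr_wpDl.
have eta0 : 0 < eps / (V s - V t + 1) by rewrite divr_gt0.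
apply: le_trans (step _ eta0) _.
by rewrite mulrAC ler_pdivrMr// ler_wpM2l ?(ltW eps0)// lerDl.
Qed.

(** * The potential well *)

Let well_coef_ge0 : 0 <= (p - 1) / (2 * (p + 1)).
Proof. by have := p_gt1 => h; rewrite divr_ge0//; lra. Qed.

Lemma JfunE v : inH1 Om v -> Jfun Om p v =
  (p - 1) / (2 * (p + 1)) * grad_inner Om v v + (p + 1)^-1 * Ifun Om p v.
Proof.
move=> v1; rewrite /Jfun /Ifun.
have -> : grad_norm Om v ^+ 2 = grad_inner Om v v.
  exact: (semi_norm_sqr (grad_semi_inner oOm eigen) v1).
move: (_ `^ _) (grad_inner _ _ _) => q g.
by field; have := p_gt1 => ?; apply/eqP; lra.
Qed.

(** An infinite integral has real value 0 by convention, so positivity of the norm certifies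
    integrability, which allows the factor to be pulled out. *)
Lemma Lqnorm_scale v (k : R) : inL2 Om v -> 0 <= k ->
  0 < Lqnorm Om (p + 1) v `^ (p + 1) ->
  Lqnorm Om (p + 1) (fun x => k * v x) `^ (p + 1) =
  k `^ (p + 1) * Lqnorm Om (p + 1) v `^ (p + 1).
Proof.
move=> [mv _] k0.
have p0 : p + 1 != 0 by rewrite gt_eqF//; have := p_gt1; lra.
have E w : Lqnorm Om (p + 1) w `^ (p + 1) =
    \int[lebesgue_rV n]_(x in Om) (`|w x| `^ (p + 1)).
  rewrite /Lqnorm -powRrM mulVf// powRr1//.
  by apply: Rintegral_ge0 => x _; exact: powR_ge0.
move=> q1; apply: etrans (E _) _; apply: etrans _ (congr1 (fun z => k `^ (p + 1) * z) (esym (E v))).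
have q0 : 0 < \int[lebesgue_rV n]_(x in Om) (`|v x| `^ (p + 1)).
  by have := q1; rewrite (E v).
have mf : measurable_fun Om (fun x => `|v x| `^ (p + 1)).
  by apply: measurableT_comp (measurable_powR _) _; exact: measurableT_comp.
have iv : (lebesgue_rV n).-integrable Om (EFin \o (fun x => `|v x| `^ (p + 1))).
  apply/integrableP; split; first exact/measurable_EFinP.
  rewrite (_ : integral _ _ _ = \int[lebesgue_rV n]_(x in Om) (`|v x| `^ (p + 1))%:E)%E.
    rewrite ltNge leye_eq; apply/negP => /eqP X_oo.
    by move: q0; rewrite /Rintegral X_oo ltxx.
  by apply: eq_integral => x _ /=; rewrite ger0_norm ?powR_ge0.
rewrite -RintegralZl//; apply: eq_Rintegral => x _.
by rewrite normrM ger0_norm// powRM.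
Qed.

Lemma well_depth_le v : inH10 Om v -> Ifun Om p v < 0 ->
  well_depth Om p <= (p - 1) / (2 * (p + 1)) * grad_inner Om v v.
Proof.
move=> v0 Iv; have v1 := inH10_H1 v0; have v2 := inH1_L2 v1.
have GS := grad_semi_inner oOm eigen.
have p1 := p_gt1.
have gE w : inH1 Om w -> grad_norm Om w ^+ 2 = grad_inner Om w w.
  by move=> w1; exact: (semi_norm_sqr GS w1).
set g := grad_inner Om v v; set q := Lqnorm Om (p + 1) v `^ (p + 1).
have Igq : Ifun Om p v = g - q by rewrite /Ifun gE.
have g0 : 0 <= g by exact: (semi_inner_ge0 GS v1).
have gq : g < q by move: Iv; rewrite Igq subr_lt0.
have q0 : 0 < q := le_lt_trans g0 gq.
have nv0 : ~ ae_eq (lebesgue_rV n) Om v (cst 0).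
  move=> v_0; move: q0; rewrite /q Lqnorm_pairing /nonlinear_pairing /Rintegral.
  rewrite (_ : (\int[lebesgue_rV n]_(x in Om) _)%E = 0%E) ?ltxx//.
  transitivity (\int[lebesgue_rV n]_(x in Om) (cst 0%E x))%E; last exact: integral0.
  apply: ae_eq_integral_nonmeasurable.
  by move: v_0; apply: filterS => x /[apply] ->; rewrite mulr0.
have gpos : 0 < g.
  rewrite lt_neqAle g0 andbT; apply/eqP => g_0; apply: nv0.
  have := poincare oOm eigen v0; rewrite -/g -g_0 pmulr_rle0 ?(eigenvalue_gt0 eigen)// => h.
  apply: (inner_eq0_ae mOm v2); apply/eqP; rewrite eq_le h /=.
  exact: (semi_inner_ge0 LS v2).
have r0 : 0 < g / q by rewrite divr_gt0.
have r1 : g / q <= 1 by rewrite ler_pdivrMr// mul1r ltW.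
(* The solution of k^(p+1) q = k^2 g, that is I(k v) = 0. As g < q it is at most 1, so scaling does
   not increase the gradient term. *)
pose k := (g / q) `^ (p - 1)^-1.
have k0 : 0 < k by exact: powR_gt0.
have k1 : k <= 1.
  rewrite /k -[leRHS](powRr0 (g / q)); apply: ger_powR; first by rewrite r0.
  by rewrite invr_ge0; lra.
have kp : k `^ (p + 1) * q = k ^+ 2 * g.
  have -> : p + 1 = (p - 1) + 2%:R by rewrite -addrA; congr (_ + _); ring.
  rewrite powRD ?(gt_eqF k0) ?implybT// powR_mulrn ?(ltW k0)//.
  rewrite {1}/k -powRrM mulVf ?powRr1 ?(ltW r0)//; last by rewrite gt_eqF//; lra.
  by rewrite mulrAC divfK ?gt_eqF// mulrC.
pose w x := k * v x.
have w0 : inH10 Om w := semi_innerZV HS k v0.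
have w1 := inH10_H1 w0.
have gw : grad_inner Om w w = k ^+ 2 * g by exact: (semi_innerZZ GS k v1).
have Iw : Ifun Om p w = 0.
  have Ew : Lqnorm Om (p + 1) w `^ (p + 1) = k ^+ 2 * g.
    exact: (etrans (Lqnorm_scale v2 (ltW k0) q0) kp).
  by rewrite /Ifun Ew (gE _ w1) gw subrr.
have mpos := well_coef_ge0.
apply: (@le_trans _ _ (Jfun Om p w)).
  (* The infimum is bounded below by 0: when I vanishes, J reduces to a nonnegative multiple of the
     squared gradient norm. *)
  apply: ge_inf.
    exists 0 => _ [z [z0 _ Iz] <-]; have z1 := inH10_H1 z0.
    have := JfunE z1; rewrite Iz mulr0 addr0 => ->.
    exact: (mulr_ge0 mpos (semi_inner_ge0 GS z1)).
  exists w; last exact: erefl.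
  split; [exact: w0| |exact: Iw] => w_0; apply: nv0; move: w_0.
  apply: filterS => x /[apply] /eqP; rewrite mulf_eq0 gt_eqF//= => /eqP.
  exact.
have := JfunE w1; rewrite Iw mulr0 addr0 gw => ->.
apply: (ler_wpM2l mpos); apply: (ler_piMl g0).
exact: (exprn_ile1 _ (ltW k0) k1).
Qed.

Lemma Lqnorm_ae (q : R) v w : ae_eq (lebesgue_rV n) Om v w ->
  Lqnorm Om q v = Lqnorm Om q w.
Proof.
move=> vw; have E : (\int[lebesgue_rV n]_(x in Om) (`|v x| `^ q)%:E =
    \int[lebesgue_rV n]_(x in Om) (`|w x| `^ q)%:E)%E.
  by apply: ae_eq_integral_nonmeasurable; apply: filterS vw => x /[apply] ->.
exact: (congr1 (fun X => fine X `^ q^-1) E).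
Qed.

Lemma itv0T0 : itv0T T 0.
Proof. by split=> //; exact: (sol_T_gt0 sol). Qed.

Lemma grad_norm_init : grad_norm Om (u 0) = grad_norm Om u0.
Proof. by rewrite /grad_norm /grad_inner (eq_grad_ae (sol_u_init sol)). Qed.

Lemma Ifun_init : Ifun Om p (u 0) = Ifun Om p u0.
Proof. by rewrite /Ifun grad_norm_init (Lqnorm_ae _ (sol_u_init sol)). Qed.

Lemma energy_init : energy Om p (u 0) (ut 0) = energy Om p u0 u1.
Proof.
rewrite /energy grad_norm_init (Lqnorm_ae _ (sol_u_init sol)).
by rewrite (eq_L2norm_ae (sol_ut_init sol)).
Qed.

Lemma inner_init : inner Om (u 0) (u 0) = inner Om u0 u0.
Proof.
have h := sol_u_init sol.
rewrite (eq_inner_ae _ h) /inner /Rintegral; congr fine.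
by apply: ae_eq_integral_nonmeasurable; apply: filterS h => x /[apply] ->.
Qed.

Lemma inner_t_init : inner Om (ut 0) (u 0) = inner Om u0 u1.
Proof.
have h := sol_u_init sol; have h' := sol_ut_init sol.
rewrite (eq_inner_ae _ h') /inner /Rintegral; congr fine.
apply: ae_eq_integral_nonmeasurable; apply: filterS h => x /[apply] ->.
by rewrite mulrC.
Qed.

(** A literal equality: the choice in [Apow] depends on its argument only through its coefficients,
    which agree for functions equal almost everywhere. *)
Lemma Apow_init : Ath (u 0) = Ath u0.
Proof.
have E : (fun k => inner Om (u 0) (e k)) = (fun k => inner Om u0 (e k)).
  by apply/funext => k; exact: (eq_inner_ae _ (sol_u_init sol)).
exact: (congr1 (fun c : nat -> R => get [set w | inL2 Om w /\
  (fun N : nat => L2norm Om (fun x => w x -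
     \sum_(k < N) lam k `^ (theta / 2) * c k * e k x)) @ \oo --> (0 : R)]) E).
Qed.

Lemma energyE t : itv0T T t -> energy Om p (u t) (ut t) =
  2^-1 * inner Om (ut t) (ut t) + Jfun Om p (u t).
Proof.
move=> Tt; rewrite /energy /Jfun addrA.
by rewrite (semi_norm_sqr LS (sol_t_L2 Tt)).
Qed.

Hypothesis E0_lt_d : energy Om p u0 u1 < well_depth Om p.
Hypothesis I_u0_lt0 : Ifun Om p u0 < 0.

Lemma well_invariant t : itv0T T t ->
  well_depth Om p <= (p - 1) / (2 * (p + 1)) * grad_inner Om (u t) (u t).
Proof.
move=> Tt; have p1 := p_gt1.
pose h s := (p - 1) / (2 * (p + 1)) * grad_inner Om (u s) (u s).
have ch : cont0T T h by apply: cont0TM cont_grad; exact: cont0T_cst.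
have gap s : itv0T T s -> h s < well_depth Om p -> h s <= energy Om p u0 u1.
  move=> Ts hs; have us0 := sol_H10 Ts.
  have Is : 0 <= Ifun Om p (u s).
    by rewrite leNgt; apply/negP => /(well_depth_le us0); rewrite leNgt hs.
  have := energy_dissipation Ts; rewrite energy_init; apply: le_trans.
  rewrite (energyE Ts) (JfunE (inH10_H1 us0)) -/(h s).
  have y0 := semi_inner_ge0 LS (sol_t_L2 Ts).
  have P0 := dissipation_ge0 Ts.
  have J0 : 0 <= (p + 1)^-1 * Ifun Om p (u s).
    by rewrite mulr_ge0// invr_ge0; lra.
  by move: (inner _ _ _) (h s) (_^-1 * Ifun _ _ _) (dissipation s) y0 P0 J0
    => y H J P; lra.
rewrite -/(h t) leNgt; apply/negP => ht.
have h0 : well_depth Om p <= h 0.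
  by apply: well_depth_le; [exact: sol_H10 itv0T0|rewrite Ifun_init].
have ht' := gap t Tt ht.
(* The midpoint of E(0) and d would be a value of [h] by continuity, whereas [gap] excludes every
   value strictly between the two. *)
have [zE zd] := midf_lt E0_lt_d.
move: (_ / 2) zE zd => z zE zd.
have cw := cont0T_within ch (lexx 0) Tt.2.
have [s s0t hs] : exists2 s, s \in `[0, t] & h s = z.
  apply: (IVT Tt.1 cw); rewrite ge_min le_max.
  have a1 : h t <= z := le_trans ht' (ltW zE).
  have a2 : z <= h 0 := le_trans (ltW zd) h0.
  by apply/andP; split; apply/orP; [right; exact: a1|left; exact: a2].
have := gap s (itv0T_sub (lexx 0) Tt.2 s0t); rewrite hs => /(_ zd) zE'.
by have := lt_le_trans zE zE'; rewrite ltxx.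
Qed.

(** Eliminating [q] by the energy gives 2 (y - (g - q)) >= (p+3) y + (p-1) g + 2 (p+1) (P - E). Then
    (p-1) g >= 2 (p+1) d leaves 2 (p+1) (d - E) >= (p+1) b, and 2 (p+1) P exceeds (p+3) P by (p-1) P
    >= 0. *)
Let energy_arith (y g q P E d b : R) : 1 < p -> 0 <= P ->
  2^-1 * y + (2^-1 * g - (p + 1)^-1 * q) + P <= E ->
  d <= (p - 1) / (2 * (p + 1)) * g -> b <= 2 * (d - E) ->
  (p + 3) * (y + P + b) <= 2 * (y - (g - q)) + 2 * b.
Proof.
move=> p1 P0 hE hd hb.
have p10 : 0 < p + 1 by lra.
have h1 : (p + 1) * (2^-1 * y + 2^-1 * g + P) - q <= (p + 1) * E.
  have := ler_wpM2l (ltW p10) hE; apply: le_trans.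
  rewrite le_eqVlt; apply/orP; left; apply/eqP; field.
  by rewrite gt_eqF.
have h2 : 2 * (p + 1) * d <= (p - 1) * g.
  have p20 : 0 <= 2 * (p + 1) by lra.
  have := ler_wpM2l p20 hd; congr (_ <= _); field.
  by rewrite gt_eqF.
have h3 := ler_wpM2l (ltW p10) hb.
have h4 : 0 <= (p - 1) * P by rewrite mulr_ge0// subr_ge0 ltW.
lra.
Qed.

Lemma kinetic_minus_Ifun t b : itv0T T t ->
  b <= 2 * (well_depth Om p - energy Om p u0 u1) ->
  (p + 3) * (inner Om (ut t) (ut t) + dissipation t + b) <=
  2 * (inner Om (ut t) (ut t) - Ifun Om p (u t)) + 2 * b.
Proof.
move=> Tt hb; have gE : grad_norm Om (u t) ^+ 2 = grad_inner Om (u t) (u t).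
  exact: (semi_norm_sqr (grad_semi_inner oOm eigen) (inH10_H1 (sol_H10 Tt))).
have hE := energy_dissipation Tt; rewrite energy_init (energyE Tt) /Jfun in hE.
have hd := well_invariant Tt; rewrite -gE in hd.
exact: (energy_arith p_gt1 (dissipation_ge0 Tt) hE hd hb).
Qed.

(** * The concavity argument *)

Variables (beta sigma : R).
Hypothesis beta_gt0 : 0 < beta.
Hypothesis beta_le : beta <= 2 * (well_depth Om p - energy Om p u0 u1).
Hypothesis sigma_gt0 : 0 < sigma.

Local Notation w t := (inner Om (u t) (u t)).
Local Notation m t := (inner Om (ut t) (u t)).
Local Notation y t := (inner Om (ut t) (ut t)).
Local Notation a t := (inner Om (Ath (u t)) (Ath (u t))).
Local Notation A t := (\int[leb]_(r in `[0, t]) a r).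
Local Notation Y t := (y t + dissipation t + beta).

(** The term in [tau - t] contributes [- a 0] to the derivative. Thus [a t - a 0] appears there,
    which is twice the integral of (A^{theta/2} u_t, A^{theta/2} u) and can be compared with the
    dissipation; on [[0, tau]] the added term is nonnegative, so it may be thrown in on the larger
    side of [levine_CS]. *)
Definition levine tau t : R :=
  w t + A t + (tau - t) * a 0 + beta * (t + sigma) ^+ 2.

Definition levine_deriv t : R := 2 * m t + (a t - a 0) + 2 * beta * (t + sigma).

Lemma Y_gt0 t : itv0T T t -> 0 < Y t.
Proof.
move=> Tt; apply: ltr_wpDl beta_gt0; apply: addr_ge0 (dissipation_ge0 Tt).
exact: (semi_inner_ge0 LS (sol_t_L2 Tt)).
Qed.

Lemma kinetic_bound t : itv0T T t ->
  (p + 3) * Y t <= 2 * (y t - Ifun Om p (u t)) + 2 * beta.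
Proof. move=> Tt; exact: (kinetic_minus_Ifun Tt beta_le). Qed.

Lemma cont_levine_deriv : cont0T T levine_deriv.
Proof.
apply: cont0TD; first apply: cont0TD.
- by apply: cont0TM cont_moment; exact: cont0T_cst.
- by apply: cont0TD cont_Apow _; exact: cont0T_cst.
apply: cont0TM; first exact: cont0T_cst.
by apply: cont0TD; [exact: cont0T_id|exact: cont0T_cst].
Qed.

Let deriv_arith (k ms mt as_ at_ a0 b s t sg : R) :
  k * (s - t) <= ms - mt + 2^-1 * (as_ - at_) ->
  2 * (k + b) * (s - t) <= 2 * ms + (as_ - a0) + 2 * b * (s + sg) -
    (2 * mt + (at_ - a0) + 2 * b * (t + sg)).
Proof. move=> h; lra. Qed.

Lemma levine_deriv_increment t s k : 0 < t -> t < s -> (s%:E < T)%E ->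
  (forall r, r \in `[t, s] -> k <= y r - Ifun Om p (u r)) ->
  2 * (k + beta) * (s - t) <= levine_deriv s - levine_deriv t.
Proof.
by move=> t0 ts sT kI; have := virial_increment t0 ts sT kI; exact: deriv_arith.
Qed.

Let kinetic_arith (X Z b : R) : X <= 2 * Z + 2 * b -> 0 <= X -> - b <= Z.
Proof. move=> h1 h2; lra. Qed.

Let half_lt (x : R) : 0 < x -> x / 2 < x.
Proof. move=> h; lra. Qed.

(** [kinetic_bound] gives y - I >= - beta, and with k = - beta the increment bound says that
    [levine_deriv] is nondecreasing at positive times. Continuity at 0 brings in the positive
    initial value. *)
Lemma levine_deriv_gt0 t : 0 < m 0 + beta * sigma -> itv0T T t -> 0 < levine_deriv t.
Proof.
move=> g0 Tt; have p1 := p_gt1.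
have G0 : 0 < levine_deriv 0.
  rewrite /levine_deriv subrr addr0 add0r -mulrA -mulrDr.
  by rewrite pmulr_rgt0.
have nd x z : 0 < x -> x < z -> (z%:E < T)%E -> levine_deriv x <= levine_deriv z.
  move=> x0 xz zT; rewrite -subr_ge0.
  have := levine_deriv_increment (k := - beta) x0 xz zT.
  rewrite addNr mulr0 mul0r; apply=> r rxz.
  have Tr := oitv0TW (oitv0T_sub x0 zT rxz).
  have h1 := kinetic_bound Tr.
  have h2 : 0 <= (p + 3) * Y r.
    apply: mulr_ge0; last exact: (ltW (Y_gt0 Tr)).
    exact: (addr_ge0 (ltW (lt_trans ltr01 p1))).
  exact: (kinetic_arith h1 h2).
have [t_0|t_n0] := eqVneq t 0; first by rewrite t_0.
have t0 : 0 < t by rewrite lt_neqAle eq_sym t_n0 Tt.1.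
apply: lt_le_trans G0 _.
apply/ler_addgt0Pr => eps eps0.
have := cont_levine_deriv itv0T0 => /cvgrPdist_le/(_ _ eps0)/within_nbhsP[d d0 dP].
pose x := Num.min (t / 2) (d / 2).
have x0 : 0 < x by rewrite lt_min (divr_gt0 t0)// (divr_gt0 d0).
have [x1 x2] : x <= t / 2 /\ x <= d / 2 by rewrite /x !ge_min !lexx orbT.
have xt : x < t := le_lt_trans x1 (half_lt t0).
have xd : x < d := le_lt_trans x2 (half_lt d0).
have Tx : itv0T T x.
  by split; [exact: ltW|apply: lt_trans Tt.2; rewrite lte_fin].
have := dP x; rewrite subr0 gtr0_norm// => /(_ xd Tx).
rewrite ler_distl => /andP[_ h].
by apply: le_trans h _; rewrite lerD2r; exact: nd Tt.2.
Qed.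

Lemma cont_A tau t : 0 < tau -> (tau%:E < T)%E -> t \in `[0, tau] ->
  A s @[s --> within `[0, tau] (nbhs t)] --> A t.
Proof.
move=> tau0 tauT tt.
have ia := cont0T_integrable cont_Apow (lexx 0) tauT.
have := parameterized_integral_continuous (ltW tau0) ia.
by move=> /subspace_continuousP/(_ t tt).
Qed.

Lemma cont_levine tau t : 0 < tau -> (tau%:E < T)%E -> t \in `[0, tau] ->
  levine tau s @[s --> within `[0, tau] (nbhs t)] --> levine tau t.
Proof.
move=> tau0 tauT tt.
have cA := cont_A tau0 tauT tt.
have cw := cont0T_at cont_norm (lexx 0) tauT tt.
have c1 : cont0T T (fun t => (tau - t) * a 0).
  apply: cont0TM; last exact: cont0T_cst.
  by apply: cont0TD; [exact: cont0T_cst|apply: cont0TN; exact: cont0T_id].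
have c2 : cont0T T (fun t => beta * (t + sigma) ^+ 2).
  apply: cont0TM; first exact: cont0T_cst.
  by apply: cont0TM; apply: cont0TD; [exact: cont0T_id|exact: cont0T_cst|
    exact: cont0T_id|exact: cont0T_cst].
have c1' := cont0T_at c1 (lexx 0) tauT tt.
have c2' := cont0T_at c2 (lexx 0) tauT tt.
exact: (cvgD (cvgD (cvgD cw cA) c1') c2').
Qed.

Lemma levine_gt0 tau t : t \in `[0, tau] -> (tau%:E < T)%E -> 0 < levine tau t.
Proof.
move=> tt tauT; have Tt := itv0T_sub (lexx 0) tauT tt.
have tI := tt; move: tI; rewrite in_itv /= => /andP[t0 ttau].
have h1 : 0 < beta * (t + sigma) ^+ 2.
  by rewrite mulr_gt0// exprn_gt0// ltr_wpDl.
apply: ltr_wpDl h1; apply: addr_ge0; first apply: addr_ge0.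
- exact: (semi_inner_ge0 LS (sol_L2 Tt)).
- apply: Rintegral_ge0 => r; rewrite /= in_itv /= => /andP[r0 rt].
  have Tr : itv0T T r.
    by split=> //; apply: le_lt_trans Tt.2; rewrite lee_fin.
  exact: (semi_inner_ge0 LS (sol_Apow_L2 Tr)).
- apply: mulr_ge0; first by rewrite subr_ge0.
  exact: (semi_inner_ge0 LS (sol_Apow_L2 itv0T0)).
Qed.

Let levine_CS_arith (l wt mt yt at_ a0 At P x : R) :
  2 * l * mt <= wt + l ^+ 2 * yt -> l * (at_ - a0) <= At + l ^+ 2 * P ->
  2 * l * (mt + 2^-1 * (at_ - a0) + beta * x) <=
  wt + At + beta * x ^+ 2 + l ^+ 2 * (yt + P + beta).
Proof.
move=> h1 h2; have := mulr_ge0 (ltW beta_gt0) (sqr_ge0 (x - l)); lra.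
Qed.

Let deriv_sqr (X1 X2 X3 z b : R) : (2 * X1 + (X2 - X3) + 2 * b * z) ^+ 2 =
  4 * (X1 + 2^-1 * (X2 - X3) + b * z) ^+ 2.
Proof. by field. Qed.

(** Three quadratic bounds with the same [l] are added before optimising: for (u_t, u), for (a t - a
    0)/2 against the dissipation, and for t + sigma against the weight [beta]. *)
Lemma levine_CS tau t : t \in `[0, tau] -> (tau%:E < T)%E ->
  levine_deriv t ^+ 2 <= 4 * (levine tau t * Y t).
Proof.
move=> tt tauT; have Tt := itv0T_sub (lexx 0) tauT tt.
have Y0 := Y_gt0 Tt.
have h : (m t + 2^-1 * (a t - a 0) + beta * (t + sigma)) ^+ 2 <=
    (w t + A t + beta * (t + sigma) ^+ 2) * Y t.
  apply: discriminant_le; first exact: ltW.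
  move=> l; apply: levine_CS_arith; last exact: (dissipation_bound l Tt).
  have := semi_inner_quadratic LS l (sol_L2 Tt) (sol_t_L2 Tt).
  by rewrite (semi_innerC LS (sol_L2 Tt) (sol_t_L2 Tt)).
have h2 : levine_deriv t ^+ 2 =
    4 * (m t + 2^-1 * (a t - a 0) + beta * (t + sigma)) ^+ 2.
  exact: deriv_sqr.
rewrite h2; apply: ler_wpM2l => //; apply: le_trans h _.
apply: ler_wpM2r; first exact: ltW.
rewrite /levine lerD2r lerDl mulr_ge0//.
  by move: tt; rewrite in_itv /= subr_ge0 => /andP[].
exact: (semi_inner_ge0 LS (sol_Apow_L2 itv0T0)).
Qed.

Let levine_arith (ws wt As At ms at_ a0 tau s t sg del b : R) :
  ws - wt <= (2 * ms + del) * (s - t) -> As - At <= (at_ + del) * (s - t) ->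
  b * (s - t) <= del -> 0 <= s - t ->
  ws + As + (tau - s) * a0 + b * (s + sg) ^+ 2 -
  (wt + At + (tau - t) * a0 + b * (t + sg) ^+ 2) <=
  (2 * ms + (at_ - a0) + 2 * b * (t + sg) + (del + del + del)) * (s - t).
Proof.
move=> h1 h2 h3 h0; have := ler_wpM2r h0 h3; lra.
Qed.

Let third (x : R) : x / 3 + x / 3 + x / 3 = x. Proof. by field. Qed.

Lemma levine_increment tau t del : 0 < t -> t < tau -> (tau%:E < T)%E -> 0 < del ->
  exists2 d, 0 < d & forall s, t < s -> s < t + d ->
    levine tau s - levine tau t <= (levine_deriv t + del) * (s - t).
Proof.
move=> t0 ttau tauT del0; have tau0 := lt_trans t0 ttau.
have Tt : oitv0T T t by split=> //; apply: lt_trans tauT; rewrite lte_fin.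
have del3 : 0 < del / 3 by rewrite divr_gt0.
have [d1 d10 D1] := is_derive_increment (is_derive_norm Tt) del3.
have ia := cont0T_integrable cont_Apow (lexx 0) tauT.
have [dA dA'] := continuous_FTC1_closed ttau ia t0 (cont0T_for cont_Apow Tt).
have HA : is_derive t (1 : R) (fun t => A t) (a t).
  by apply: DeriveDef; [exact: dA|rewrite -derive1E; exact: dA'].
have [d2 d20 D2] := is_derive_increment HA del3.
(* For |u|^2 and the integral of a, [del / 3] each; this last third bounds the second-order term
   beta (s - t)^2. *)
have d30 : 0 < del / 3 / beta by rewrite divr_gt0.
exists (Num.min d1 (Num.min d2 (del / 3 / beta))); first by rewrite !lt_min d10 d20 d30.
move=> s ts; rewrite -ltrBlDl !lt_min => /and3P[s1 s2 s3].
rewrite -[in leRHS](third del); apply: levine_arith.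
- by apply: D1 => //; rewrite -ltrBlDl.
- by apply: D2 => //; rewrite -ltrBlDl.
- by rewrite mulrC -ler_pdivlMr// ltW.
- by rewrite subr_ge0 ltW.
Qed.

Let slope_arith (Yt Yr del X : R) : 0 < p + 3 -> Yt - del / (p + 3) <= Yr ->
  (p + 3) * Yr <= 2 * X + 2 * beta -> ((p + 3) * Yt - del - 2 * beta) / 2 <= X.
Proof.
move=> p3 h1 h2; have := ler_wpM2l (ltW p3) h1.
have -> : (p + 3) * (Yt - del / (p + 3)) = (p + 3) * Yt - del.
  by field; rewrite gt_eqF.
by move=> h3; lra.
Qed.

Let slope_arith2 (q X G Z : R) : 0 < q -> X <= 4 * (G * Z) ->
  q / 4 * X <= q * Z * G.
Proof. move=> q0 h; have := ler_wpM2l (ltW q0) h; lra. Qed.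

Let slope_eq (Z b : R) : 2 * ((Z - 2 * b) / 2 + b) = Z.
Proof. by field. Qed.

(** Shortly after [t], [Y] stays above [Y t - del / (p + 3)]: the kinetic part by continuity, the
    dissipation by monotonicity. [levine_CS] then converts [Y t] into the square of [levine_deriv t]
    over [levine tau t]. *)
Lemma levine_deriv_slope tau t del : 0 < t -> t < tau -> (tau%:E < T)%E -> 0 < del ->
  exists2 d, 0 < d & forall s, t < s -> s < t + d -> s <= tau ->
    ((1 + (p - 1) / 4) * levine_deriv t ^+ 2 / levine tau t - del) * (s - t) <=
    levine_deriv s - levine_deriv t.
Proof.
move=> t0 ttau tauT del0; have p3 : 0 < p + 3 := addr_gt0 (lt_trans ltr01 p_gt1) (ltr0Sn _ 2).
have Tt : oitv0T T t by split=> //; apply: lt_trans tauT; rewrite lte_fin.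
have tI : t \in `[0, tau] by rewrite in_itv /= (ltW t0) (ltW ttau).
have e0 : 0 < del / (p + 3) by rewrite divr_gt0.
have [d d0 D] := cont0T_near cont_norm_t Tt e0.
exists d => // s ts sd stau.
have sT : (s%:E < T)%E by apply: le_lt_trans tauT; rewrite lee_fin.
(* Chosen so that [2 * (k + beta)] equals [(p + 3) * Y t - del]. *)
pose k := ((p + 3) * Y t - del - 2 * beta) / 2.
have kI r : r \in `[t, s] -> k <= y r - Ifun Om p (u r).
  move=> rts; have Tr := oitv0TW (oitv0T_sub t0 sT rts).
  move: rts; rewrite in_itv /= => /andP[tr rs].
  apply: slope_arith (kinetic_bound Tr) => //.
  have rd : `|r - t| < d.
    by rewrite ger0_norm ?subr_ge0// ltrBlDl; apply: le_lt_trans rs sd.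
  have := D r rd; rewrite ler_distl => /andP[h _].
  have P := dissipation_nd Tr tr (ltW t0).
  rewrite [leLHS]addrAC lerD2r [leLHS]addrAC; exact: lerD.
have := levine_deriv_increment t0 ts sT kI; apply: le_trans.
apply: ler_wpM2r; first by rewrite subr_ge0 ltW.
rewrite /k slope_eq lerD2r.
have G0 := levine_gt0 tI tauT.
rewrite ler_pdivrMr//.
have -> : 1 + (p - 1) / 4 = (p + 3) / 4 by field.
by apply: slope_arith2 => //; exact: levine_CS.
Qed.

Lemma blowup_time_bound tau : 0 < m 0 + beta * sigma -> 0 < tau -> (tau%:E < T)%E ->
  (p - 1) / 4 * tau < levine tau 0 / levine_deriv 0.
Proof.
move=> g0 tau0 tauT.
have al0 : 0 < (p - 1) / 4 by rewrite divr_gt0// subr_gt0; exact: p_gt1.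
apply: concavity_bound => //.
- by move=> t tt; exact: cont_levine.
- by move=> t tt; exact: (cont0T_at cont_levine_deriv (lexx 0) tauT tt).
- by move=> t tt; exact: levine_gt0.
- by move=> t tt; apply: levine_deriv_gt0 => //; exact: (itv0T_sub (lexx 0) tauT tt).
move=> t del t0 ttau del0.
have [d1 d10 D1] := levine_increment t0 ttau tauT del0.
have [d2 d20 D2] := levine_deriv_slope t0 ttau tauT del0.
exists (Num.min d1 d2); first by rewrite lt_min d10.
move=> s ts; rewrite -ltrBlDl lt_min => /andP[s1 s2] stau; split.
  by apply: D1 => //; rewrite -ltrBlDl.
by apply: D2 => //; rewrite -ltrBlDl.
Qed.

Lemma levine0 tau : levine tau 0 = w 0 + tau * a 0 + beta * sigma ^+ 2.
Proof.
rewrite /levine subr0 add0r; congr (_ + _ + _).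
by rewrite set_itv1 /Rintegral integral_set1 addr0.
Qed.

Lemma levine_deriv0 : levine_deriv 0 = 2 * (m 0 + beta * sigma).
Proof. by rewrite /levine_deriv subrr addr0 add0r -mulrA -mulrDr. Qed.

Let final_arith (tau q g a0 w0 c : R) :
  q / 4 * tau * (2 * g) < w0 + tau * a0 + c ->
  tau * (q / 2 * g - a0) < w0 + c.
Proof. move=> h; lra. Qed.

(** [levine tau 0] contains [tau * a 0], so the concavity bound is linear in [tau] on both sides;
    the factor 2 of [levine_deriv 0] turns (p-1)/4 into (p-1)/2. *)
Lemma blowup_time_le tau : 0 < m 0 + beta * sigma -> 0 < tau -> (tau%:E < T)%E ->
  tau * ((p - 1) / 2 * (m 0 + beta * sigma) - a 0) <= w 0 + beta * sigma ^+ 2.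
Proof.
move=> g0 tau0 tauT; have := blowup_time_bound g0 tau0 tauT.
rewrite levine0 levine_deriv0 ltr_pdivlMr; last by rewrite mulr_gt0.
by move: (w 0) (a 0) (m 0) => X1 X2 X3 h; apply: ltW; exact: final_arith.
Qed.

End solution.

(** The second entry of the maximum is the [sigma] at which the denominator of the time bound
    vanishes; beyond it [m0 + beta * sigma] exceeds a multiple of [a0 >= 0], so g(0) > 0. The entry
    0 makes [sigma] positive, hence G > 0. *)
Lemma shift_above_threshold (R : realFieldType) (p beta a0 m0 sigma : R) :
  1 < p -> 0 < beta -> 0 <= a0 ->
  Num.max 0 (beta^-1 * (2 / (p - 1) * a0 - m0)) < sigma ->
  [/\ 0 < sigma, 0 < m0 + beta * sigma &
      a0 < (p - 1) / 2 * (m0 + beta * sigma)].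
Proof.
move=> p1 b0 a00; rewrite gt_max => /andP[s0 hs].
have q0 : 0 < p - 1 by rewrite subr_gt0.
have h : 2 / (p - 1) * a0 < m0 + beta * sigma.
  by move: hs; rewrite mulrC ltr_pdivrMr// [sigma * _]mulrC ltrBlDl.
have h0 : 0 <= 2 / (p - 1) * a0 by rewrite mulr_ge0// divr_ge0// ltW.
split=> //; first exact: le_lt_trans h.
have -> : a0 = (p - 1) / 2 * (2 / (p - 1) * a0) by field; rewrite gt_eqF.
by rewrite ltr_pM2l// divr_gt0.
Qed.

Theorem theorem2p2 (R : realType) (n : nat) (n_ge1 : (1 <= n)%N)
  (Om : set 'rV[R]_n) (Om_open : open Om) (Om_bounded : bounded_set Om)
  (lam : nat -> R) (e : nat -> 'rV[R]_n -> R)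
  (eigen : dirichlet_eigenpairs Om lam e)
  (theta : R) (theta01 : 0 <= theta <= 1)
  (p : R) (p_gt1 : 1 < p)
  (p_subcritical : (3 <= n)%N -> p < (n%:R + 2) / (n%:R - 2))
  (u0 u1 : 'rV[R]_n -> R) (u0_H10 : inH10 Om u0) (u1_L2 : inL2 Om u1)
  (E0_lt_d : energy Om p u0 u1 < well_depth Om p)
  (I_u0_lt0 : Ifun Om p u0 < 0)
  (Tmax : \bar R) (u : R -> 'rV[R]_n -> R)
  (u_sol : energy_solution Om lam e theta p u0 u1 Tmax u)
  (beta : R)
  (beta_range : 0 < beta <= 2 * (well_depth Om p - energy Om p u0 u1)) :
  let a0 := L2norm Om (Apow Om lam e (theta / 2) u0) ^+ 2 in
  let sigma_theta :=
    Num.max 0 (beta^-1 * (2 / (p - 1) * a0 - inner Om u0 u1)) in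
  forall sigma : R, sigma_theta < sigma ->
    [/\ (p - 1) / 2 * (inner Om u0 u1 + beta * sigma) > a0,
        (Tmax < +oo)%E &
        (Tmax <= ((L2norm Om u0 ^+ 2 + beta * sigma ^+ 2) /
                  ((p - 1) / 2 * (inner Om u0 u1 + beta * sigma) - a0))%:E)%E].
Proof.
move=> a0 sigma_theta sigma hsigma.
have [ut [utt sol]] := u_sol; have /andP[b0 bd] := beta_range.
have a00 : 0 <= a0 := sqr_ge0 _.
have [s0 g0 ha] := shift_above_threshold p_gt1 b0 a00 hsigma.
have LS := inL2_semi_inner (open_measurable_rV Om_open).
have aE : a0 = inner Om (Apow Om lam e (theta / 2) u0) (Apow Om lam e (theta / 2) u0).
  exact: (semi_norm_sqr LS (Apow_L2 Om_open eigen (theta_half01 theta01) u0_H10)).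
have wE : L2norm Om u0 ^+ 2 = inner Om u0 u0.
  exact: (semi_norm_sqr LS (inH1_L2 (inH10_H1 u0_H10))).
have bound tau : 0 < tau -> (tau%:E < Tmax)%E ->
    tau <= (L2norm Om u0 ^+ 2 + beta * sigma ^+ 2) /
      ((p - 1) / 2 * (inner Om u0 u1 + beta * sigma) - a0).
  move=> tau0 tauT; rewrite ler_pdivlMr ?subr_gt0//.
  rewrite wE aE -(inner_init sol) -(inner_t_init sol) -(Apow_init sol).
  apply: (blowup_time_le Om_open eigen theta01 sol n_ge1 p_gt1 E0_lt_d I_u0_lt0
    b0 bd s0 _ tau0 tauT).
  by rewrite (inner_t_init sol).
have B0 : 0 <= (L2norm Om u0 ^+ 2 + beta * sigma ^+ 2) /
    ((p - 1) / 2 * (inner Om u0 u1 + beta * sigma) - a0).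
  apply: divr_ge0; last by rewrite subr_ge0 ltW.
  by apply: addr_ge0; [exact: sqr_ge0|apply: mulr_ge0; [exact: ltW|exact: sqr_ge0]].
have T_le : (Tmax <= ((L2norm Om u0 ^+ 2 + beta * sigma ^+ 2) /
    ((p - 1) / 2 * (inner Om u0 u1 + beta * sigma) - a0))%:E)%E.
  (* If [Tmax] exceeded the bound, a real [tau] strictly between the two would contradict [bound];
     this also rules out an infinite [Tmax]. *)
  rewrite leNgt; apply/negP => /lt_real_between[tau Btau tauT].
  have := bound tau (le_lt_trans B0 Btau) tauT.
  by rewrite leNgt Btau.
split=> //; exact: le_lt_trans T_le (ltry _).
Qed.
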